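(* Let $K:\mathbb B_d\times\mathbb B_d\to\mathcal M_n(\mathbb C)$ be a non-negative definite kernel. (a) Suppose $n=d$ and $K$ is quasi-invariant under $\mathcal U(d)$ with multiplier $c$, where $c:\mathcal U(d)\to GL_d(\mathbb C)$ is an irreducible unitary representation, i.e. $K(\boldsymbol z,\boldsymbol w)=c(u)K(u^{-1}\cdot\boldsymbol z,u^{-1}\cdot\boldsymbol w)c(u)^*$ for all $u\in\mathcal U(d)$. Then there exists $U\in\mathcal U(d)$ such that $UK(\boldsymbol z,\boldsymbol w)U^*$ is either of the form $$\sum_{\ell=1}^\infty(a_{\ell,1}-a_{\ell,2})\langle\boldsymbol z,\boldsymbol w\rangle^{\ell-1}\bar{\boldsymbol w}\boldsymbol z^\dagger+\sum_{\ell=0}^\infty a_{\ell,2}\langle\boldsymbol z,\boldsymbol w\rangle^\ell I_d,$$ where $a_{\ell,1}\ge0$ and $a_{\ell,1}\le(\ell+1)a_{\ell,2}$ for all $\ell\in\mathbb Z_+$, or of the form $$\sum_{\ell=1}^\infty(\tilde a_{\ell,1}-\tilde a_{\ell,2})\langle\boldsymbol z,\boldsymbol w\rangle^{\ell-1}\boldsymbol z\bar{\boldsymbol w}^\dagger+\sum_{\ell=0}^\infty\tilde a_{\ell,2}\langle\boldsymbol z,\boldsymbol w\rangle^\ell I_d,$$ where $\tilde a_{\ell,2}\ge0$ and $(d-1)\tilde a_{\ell,2}\le(\ell+d-1)\tilde a_{\ell,1}$ for all $\ell\in\mathbb Z_+$. (b) If $1<n<d$, there is no $n$-dimensional irreducible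 unitary representation $c:\mathcal U(d)\to GL_n(\mathbb C)$ such that $K$ is quasi-invariant under $\mathcal U(d)$ with multiplier $c$.
   Context: $\mathbb B_d$ is the unit ball of $\mathbb C^d$, $\mathcal U(d)$ the unitary group, $\langle\boldsymbol z,\boldsymbol w\rangle=\sum_iz_i\bar w_i$; $\bar{\boldsymbol w}\boldsymbol z^\dagger$ is the $d\times d$ matrix with $(i,j)$ entry $\bar w_iz_j$, and $\boldsymbol z\bar{\boldsymbol w}^\dagger$ the matrix with $(i,j)$ entry $z_i\bar w_j$. The coefficients $a_{\ell,i},\tilde a_{\ell,i}$ are real numbers, with the convention $a_{0,1}=a_{0,2}$ and $\tilde a_{0,1}=\tilde a_{0,2}$.
   Formalization: The kernel K is additionally assumed sesqui-analytic (holomorphic in z, anti-holomorphic in w on the ball); without this part (a) fails, e.g. for K(z,w)=exp(-|z-w|^2)I_d with c(u)=u and d≥2. *)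

(* Defs.v *)
(* MathComp-Analysis over an arbitrary realType R,
   complex numbers C := R[i] (mathcomp-real-closed complex). *)
From HB Require Import structures.
From mathcomp Require Import all_boot all_order all_algebra.
From mathcomp Require Import all_classical all_reals all_analysis.
From mathcomp Require Import complex.
Set Implicit Arguments. Unset Strict Implicit. Unset Printing Implicit Defensive.
Import Order.TTheory GRing.Theory Num.Theory.
Import numFieldNormedType.Exports.
Local Open Scope classical_set_scope.
Local Open Scope ring_scope.

Section Defs.
Variable R : realType.
Local Notation C := R[i].

(* conjugate transpose A^* *)
Definition mxstar m n (A : 'M[C]_(m, n)) : 'M[C]_(n, m) :=
  (map_mx Num.conj A)^T.

(* <z, w> = sum_i z_i conj(w_i) ; vectors of C^d are column vectors *)
Definition cinner d (z w : 'cV[C]_d) : C := \sum_(i < d) z i 0 * (w i 0)^*.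

(* the open unit ball B_d *)
Definition in_ball d (z : 'cV[C]_d) : Prop := cinner z z < 1.

(* the unitary group U(d) *)
Definition unitary d (u : 'M[C]_d) : Prop :=
  mxstar u *m u = 1%:M /\ u *m mxstar u = 1%:M.

(* non-negative definite kernel on B_d with values in M_n(C):
   sum_{i,j} < K(z_i, z_j) xi_j , xi_i > >= 0 *)
Definition nonneg_def_kernel d n (K : 'cV[C]_d -> 'cV[C]_d -> 'M[C]_n) : Prop :=
  forall (m : nat) (pts : 'I_m -> 'cV[C]_d) (xi : 'I_m -> 'cV[C]_n),
    (forall i, in_ball (pts i)) ->
    0 <= \sum_(i < m) \sum_(j < m) (mxstar (xi i) *m K (pts i) (pts j) *m xi j) 0 0.

(* standing assumption of the paper: K is sesqui-analytic, i.e. holomorphic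
   in z and anti-holomorphic in w on B_d x B_d (complex Frechet
   differentiability on the open ball) *)
Definition holomorphic_on_ball d n (f : 'cV[C]_d -> 'M[C]_n) : Prop :=
  forall z : ('cV[C]_d : normedModType C), in_ball z -> differentiable f z.

Definition sesqui_analytic d n (K : 'cV[C]_d -> 'cV[C]_d -> 'M[C]_n) : Prop :=
  (forall w, in_ball w -> holomorphic_on_ball (fun z => K z w)) /\
  (forall z, in_ball z -> holomorphic_on_ball (fun w => map_mx Num.conj (K z w))).

(* a (continuous) unitary representation c : U(d) -> GL_n(C);
   c is only ever evaluated on unitary matrices *)
Definition unitary_rep d n (c : 'M[C]_d -> 'M[C]_n) : Prop :=
  (forall u v, unitary u -> unitary v -> c (u *m v) = c u *m c v) /\
  (forall u, unitary u -> unitary (c u)) /\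
  {within [set u : ('M[C]_d : normedModType C) | unitary u], continuous
     (c : ('M[C]_d : normedModType C) -> ('M[C]_n : normedModType C))}.

(* a c(U(d))-invariant (complex linear) subspace of C^n *)
Definition invariant_subspace d n (c : 'M[C]_d -> 'M[C]_n)
    (W : set 'cV[C]_n) : Prop :=
  W 0 /\ (forall v w, W v -> W w -> W (v + w)) /\
  (forall (a : C) v, W v -> W (a *: v)) /\
  (forall u v, unitary u -> W v -> W (c u *m v)).

Definition irreducible_rep d n (c : 'M[C]_d -> 'M[C]_n) : Prop :=
  forall W, invariant_subspace c W -> W = [set 0] \/ W = setT.

(* K(z,w) = c(u) K(u^{-1} z, u^{-1} w) c(u)^* *)
Definition quasi_invariant d n (K : 'cV[C]_d -> 'cV[C]_d -> 'M[C]_n)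
    (c : 'M[C]_d -> 'M[C]_n) : Prop :=
  forall u, unitary u -> forall z w, in_ball z -> in_ball w ->
    K z w = c u *m K (invmx u *m z) (invmx u *m w) *m mxstar (c u).

(* first normal form: U K(z,w) U^* =
   sum_{l>=1} (a_{l,1}-a_{l,2}) <z,w>^(l-1) (conj w) z^dagger
   + sum_{l>=0} a_{l,2} <z,w>^l I_d, with a_{0,1} = a_{0,2} *)
Definition form1 d (U : 'M[C]_d) (K : 'cV[C]_d -> 'cV[C]_d -> 'M[C]_d)
    (a1 a2 : nat -> R) : Prop :=
  a1 0%N = a2 0%N /\
  (forall l : nat, 0 <= a1 l /\ a1 l <= l.+1%:R * a2 l) /\
  forall z w, in_ball z -> in_ball w ->
    exists S1 S2 : ('M[C]_d : normedModType C),
      (fun N : nat => \sum_(l < N)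
          (((a1 l.+1 - a2 l.+1)%:C)%C * cinner z w ^+ l) *:
            (\matrix_(i < d, j < d) ((w i 0)^* * z j 0))) @ \oo --> S1 /\
      (fun N : nat => \sum_(l < N)
          (((a2 l)%:C)%C * cinner z w ^+ l) *: (1%:M : 'M[C]_d)) @ \oo --> S2 /\
      U *m K z w *m mxstar U = S1 + S2.

(* second normal form: U K(z,w) U^* =
   sum_{l>=1} (b_{l,1}-b_{l,2}) <z,w>^(l-1) z (conj w)^dagger
   + sum_{l>=0} b_{l,2} <z,w>^l I_d, with b_{0,1} = b_{0,2} *)
Definition form2 d (U : 'M[C]_d) (K : 'cV[C]_d -> 'cV[C]_d -> 'M[C]_d)
    (b1 b2 : nat -> R) : Prop :=
  b1 0%N = b2 0%N /\
  (forall l : nat, 0 <= b2 l /\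
     (d%:R - 1) * b2 l <= (l%:R + d%:R - 1) * b1 l) /\
  forall z w, in_ball z -> in_ball w ->
    exists S1 S2 : ('M[C]_d : normedModType C),
      (fun N : nat => \sum_(l < N)
          (((b1 l.+1 - b2 l.+1)%:C)%C * cinner z w ^+ l) *:
            (\matrix_(i < d, j < d) (z i 0 * (w j 0)^*))) @ \oo --> S1 /\
      (fun N : nat => \sum_(l < N)
          (((b2 l)%:C)%C * cinner z w ^+ l) *: (1%:M : 'M[C]_d)) @ \oo --> S2 /\
      U *m K z w *m mxstar U = S1 + S2.

End Defs.

(* Main.v *)
(** Simultaneous diagonalisation of [c] on the torus and the action of the
    permutation matrices on its weights show that an irreducible [c] of
    dimension [n] with [1 < n <= d] has [n = d] and that, up to a character of
    the determinant, [c (diag t) = diag (th t_i)] for one character [th] of the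
    circle.  Multiplicativity of [c] on planar rotations forces [Re (th s)] to
    be a multiplicative solution of Jensen's equation in [Re s], hence [th] is
    the identity or complex conjugation, and [c u] is conjugate to [chi u] times
    [u] or the conjugate of [u].

    After conjugation, and transposition in the second case, the kernel satisfies
    [L (u z) (u w) = u L z w u^*].  Moving a pair of vectors into a plane by a
    unitary and expanding in power series (Cauchy's theorem on circles) gives
    [L z w = A <z,w> z w^* + B <z,w> I].  Averaging over roots of unity shows
    that every homogeneous part of [L] is non-negative definite; the coefficient
    inequalities are its values at the vectors [e_0 + s e_j], [s ^ N = 1],
    together with a multiple of [e_0] or [e_1] placed at the point [e_0]. *)
Require Import Defs.
From HB Require Import structures.
From mathcomp Require Import all_boot all_order all_algebra.
From mathcomp Require Import all_classical all_reals all_analysis.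
From mathcomp Require Import perm.
From mathcomp Require Import complex.
From mathcomp Require Import ring lra.
Import Order.TTheory GRing.Theory Num.Theory.
Import numFieldNormedType.Exports.
Local Open Scope classical_set_scope.
Local Open Scope ring_scope.
Set Implicit Arguments. Unset Strict Implicit. Unset Printing Implicit Defensive.

(** * Complex moduli and complex-valued integrals *)

(** The representation is known explicitly on the torus only; the rest is recovered from traces.
    Every unitary is conjugate to a torus element, so the trace of [c u] depends on the spectrum of
    [u] alone, and inserting two independent torus elements into a product isolates single matrix
    entries. For weights, the obstacle to [n <= d] is counting: a non-constant weight has at least
    ['C(d, m) >= d] permuted copies. Rigidity of the character rests on order: its real part is
    non-negative on squares, hence monotone. The constants in the inequalities come from
    representation theory. For [d >= 2], polynomials of degree [l >= 1] with values in [C^d] split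
    into two irreducible pieces, and the degree [l] part of the kernel is non-negative iff it is so
    on each. One piece is seen by evaluation at [e_0]; the other by a first-order operator at [e_0],
    the divergence for the standard action and a component of the curl for the conjugate one. The
    test vectors discretise these operators over roots of unity. *)

Section Modulus.
Variable R : realType.
Local Notation C := R[i].

(** The modulus takes values in [R] rather than in [C], so that estimates are inequalities between
    reals, within reach of [lra] and [nra]; [nmE] gives the link with the complex-valued norm. *)
Definition nm (z : C) : R := Normc.normc z.

Lemma nmE (z : C) : (nm z)%:C%C = `|z|.
Proof. by rewrite normc_def; case: z. Qed.

Lemma nm_ge0 (z : C) : 0 <= nm z.
Proof. by rewrite -lecR nmE; exact: normr_ge0. Qed.

Lemma nm0 : nm 0 = 0. Proof. exact: Normc.normc0. Qed.
Lemma nm1 : nm 1 = 1. Proof. exact: Normc.normc1. Qed.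
Lemma nmM (x y : C) : nm (x * y) = nm x * nm y.
Proof. exact: Normc.normcM. Qed.
Lemma nmD (x y : C) : nm (x + y) <= nm x + nm y.
Proof. exact: le_normcD. Qed.
Lemma nmN (x : C) : nm (- x) = nm x. Proof. exact: normcN. Qed.
Lemma nmBC (x y : C) : nm (x - y) = nm (y - x).
Proof. by rewrite -nmN opprB. Qed.
Lemma nmB (x y : C) : nm (x - y) <= nm x + nm y.
Proof. by rewrite -(nmN y); exact: nmD. Qed.
Lemma nm_tri (y x z : C) : nm (x - z) <= nm (x - y) + nm (y - z).
Proof. by apply: le_trans (nmD _ _); rewrite addrA subrK. Qed.
Lemma nm_eq0 (x : C) : (nm x == 0) = (x == 0).
Proof.
apply/eqP/eqP => [|->]; [exact: Normc.eq0_normc|exact: nm0].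
Qed.
Lemma nm_gt0 (x : C) : (0 < nm x) = (x != 0).
Proof. by rewrite lt_def nm_ge0 andbT nm_eq0. Qed.
Lemma nmV (x : C) : nm x^-1 = (nm x)^-1. Proof. exact: Normc.normcV. Qed.
Lemma nmR (x : R) : nm x%:C%C = `|x|.
Proof. by apply: complexI; rewrite nmE normc_def /= expr0n addr0 sqrtr_sqr. Qed.
Lemma nmX (x : C) n : nm (x ^+ n) = nm x ^+ n.
Proof. by elim: n => [|n IH]; rewrite ?nm1 // !exprS nmM IH. Qed.
Lemma nmJ (x : C) : nm (x^*) = nm x.
Proof. by apply: complexI; rewrite !nmE norm_conjC. Qed.
Lemma nm_sqr (x : C) : ((nm x) ^+ 2)%:C%C = x * x^*.
Proof. by rewrite rmorphXn /= nmE normCK. Qed.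
Lemma nmi : nm 'i%C = 1.
Proof. by rewrite /nm /Normc.normc expr0n expr1n add0r sqrtr1. Qed.




Lemma nm_sum (I : Type) (r : seq I) (P : pred I) (F : I -> C) :
  nm (\sum_(i <- r | P i) F i) <= \sum_(i <- r | P i) nm (F i).
Proof.
elim/big_rec2 : _ => [|i y x _ H]; first by rewrite nm0.
by apply: le_trans (nmD _ _) _; rewrite lerD2l.
Qed.

Lemma Re_le_nm (z : C) : `|complex.Re z| <= nm z.
Proof. by rewrite -lecR nmE; exact: normc_ge_Re. Qed.
Lemma Im_le_nm (z : C) : `|complex.Im z| <= nm z.
Proof.
have := Re_le_nm (z * 'i%C); rewrite ReiNIm normrN nmM.
by rewrite nmi mulr1.
Qed.
Lemma nm_le_ReIm (z : C) : nm z <= `|complex.Re z| + `|complex.Im z|.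
Proof.
rewrite {1}(complexE z); apply: le_trans (nmD _ _) _.
by rewrite nmM nmi mul1r !nmR.
Qed.

Lemma complexP (x y : C) :
  complex.Re x = complex.Re y -> complex.Im x = complex.Im y -> x = y.
Proof. by case: x y => [a b] [c d] /= -> ->. Qed.

Lemma cReD (x y : C) : complex.Re (x + y) = complex.Re x + complex.Re y.
Proof. by case: x y => [a b] [c d]. Qed.
Lemma cImD (x y : C) : complex.Im (x + y) = complex.Im x + complex.Im y.
Proof. by case: x y => [a b] [c d]. Qed.
Lemma cReN (x : C) : complex.Re (- x) = - complex.Re x.
Proof. by case: x. Qed.
Lemma cImN (x : C) : complex.Im (- x) = - complex.Im x.
Proof. by case: x. Qed.
Lemma cReM (x y : C) : complex.Re (x * y) =
  complex.Re x * complex.Re y - complex.Im x * complex.Im y.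
Proof. by case: x y => [a b] [c d]. Qed.
Lemma cImM (x y : C) : complex.Im (x * y) =
  complex.Re x * complex.Im y + complex.Im x * complex.Re y.
Proof. by case: x y => [a b] [c d]. Qed.
Lemma conj_ReIm (x : C) : x^* = (complex.Re x -i* complex.Im x)%C.
Proof. by case: x. Qed.

End Modulus.

Section Integral.
Variable R : realType.
Local Notation C := R[i].
Local Notation mu := (@lebesgue_measure R).

Definition ccont (h : R -> C) (x : R) :=
  forall e : R, 0 < e -> exists2 d : R, 0 < d &
    forall y, `|y - x| < d -> nm (h y - h x) <= e.

Definition ccont_on (h : R -> C) (a b : R) :=
  forall x, a <= x -> x <= b -> ccont h x.

Lemma ccont_Re h x : ccont h x -> {for x, continuous (fun t => complex.Re (h t))}.
Proof.
move=> hx; apply/cvgrPdist_le => e e0; have [d d0 H] := hx _ e0.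
apply/nbhs_ballP; exists d => //= y; rewrite /ball /= distrC => /H.
by move=> K; apply: le_trans K; rewrite -cReN -cReD nmBC Re_le_nm.
Qed.

Lemma ccont_Im h x : ccont h x -> {for x, continuous (fun t => complex.Im (h t))}.
Proof.
move=> hx; apply/cvgrPdist_le => e e0; have [d d0 H] := hx _ e0.
apply/nbhs_ballP; exists d => //= y; rewrite /ball /= distrC => /H.
by move=> K; apply: le_trans K; rewrite -cImN -cImD nmBC Im_le_nm.
Qed.

Lemma within_itv (g : R -> R) (a b : R) :
  (forall x, a <= x -> x <= b -> {for x, continuous g}) ->
  {within `[a, b], continuous g}.
Proof.
move=> H; apply: continuous_in_subspaceT => x.
by rewrite inE /= in_itv /= => /andP[ax xb]; exact: H.
Qed.

Lemma int_itv (g : R -> R) (a b : R) :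
  (forall x, a <= x -> x <= b -> {for x, continuous g}) ->
  mu.-integrable `[a, b] (EFin \o g).
Proof.
move=> H; apply: continuous_compact_integrable; first exact: segment_compact.
exact: within_itv.
Qed.

Definition cint (h : R -> C) (a b : R) : C :=
  (\int[mu]_(x in `[a, b]) complex.Re (h x) +i*
   \int[mu]_(x in `[a, b]) complex.Im (h x))%C.

Lemma eq_cint (h k : R -> C) a b :
  (forall x, a <= x -> x <= b -> h x = k x) -> cint h a b = cint k a b.
Proof.
move=> H; congr Complex; apply: eq_Rintegral => x;
  by rewrite inE /= in_itv /= => /andP[ax xb]; rewrite H.
Qed.

Lemma cint_cat (h : R -> C) a b c : a <= b -> b <= c -> ccont_on h a c ->
  cint h a c = cint h a b + cint h b c.
Proof.
move=> ab bc hc.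
have H (g : R -> R) : (forall x, a <= x -> x <= c -> {for x, continuous g}) ->
  \int[mu]_(x in `[a, c]) g x =
  \int[mu]_(x in `[a, b]) g x + \int[mu]_(x in `[b, c]) g x.
  move=> gc; apply/eqP; rewrite addrC -subr_eq; apply/eqP.
  rewrite Rintegral_itvB ?bnd_simp //; last exact: int_itv.
  rewrite Rintegral_itv_obnd_cbnd //.
  apply: integrableS (int_itv gc) => //.
  by apply: subset_itvr; rewrite bnd_simp.
by rewrite /cint !H // => x ax xc; [apply: ccont_Im|apply: ccont_Re]; exact: hc.
Qed.

Lemma cintD (h k : R -> C) a b : ccont_on h a b -> ccont_on k a b ->
  cint (fun x => h x + k x) a b = cint h a b + cint k a b.
Proof.
move=> hc kc; rewrite /cint; apply: complexP; rewrite /=.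
  under eq_Rintegral do rewrite cReD.
  by rewrite RintegralD //; apply: int_itv => x ax xb; apply: ccont_Re; auto.
under eq_Rintegral do rewrite cImD.
by rewrite RintegralD //; apply: int_itv => x ax xb; apply: ccont_Im; auto.
Qed.

Lemma cintZ (c : C) (h : R -> C) a b : ccont_on h a b ->
  cint (fun x => c * h x) a b = c * cint h a b.
Proof.
move=> hc; rewrite /cint.
have iR : mu.-integrable `[a, b] (EFin \o (fun x => complex.Re (h x))).
  by apply: int_itv => x ax xb; apply: ccont_Re; auto.
have iI : mu.-integrable `[a, b] (EFin \o (fun x => complex.Im (h x))).
  by apply: int_itv => x ax xb; apply: ccont_Im; auto.
have iZ (u : R -> R) r : mu.-integrable `[a, b] (EFin \o u) ->
   mu.-integrable `[a, b] (EFin \o (fun x => r * u x)).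
  by move=> iu; have := integrableZl _ r iu; apply.
apply: complexP; rewrite ?cReM ?cImM /=.
  under eq_Rintegral do rewrite cReM.
  by rewrite RintegralB ?RintegralZl //; apply: iZ.
under eq_Rintegral do rewrite cImM.
by rewrite RintegralD ?RintegralZl //; apply: iZ.
Qed.

Lemma ccont_cst (c : C) x : ccont (fun=> c) x.
Proof. by move=> e e0; exists 1 => // y _; rewrite subrr nm0 ltW. Qed.

Lemma cint_cst (c : C) a b : a <= b -> cint (fun=> c) a b = c * (b - a)%:C%C.
Proof.
move=> ab; apply: complexP; rewrite ?cReM ?cImM /= ?Rintegral_cst //=;
  rewrite lebesgue_measure_itv /= lte_fin;
  case: ltP => // ba; rewrite ?mulr0 ?subr0 ?add0r //.
  by rewrite (_ : b = a) ?subrr ?mulr0 //; apply/eqP; rewrite eq_le ba ab.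
by rewrite (_ : b = a) ?subrr ?mulr0 //; apply/eqP; rewrite eq_le ba ab.
Qed.

Lemma cint_id a b : a <= b ->
  cint (fun x => x%:C%C) a b = ((b ^+ 2 - a ^+ 2) / 2)%:C%C.
Proof.
rewrite le_eqVlt => /orP[/eqP <-|ab].
  rewrite subrr mul0r; apply: complexP => /=; rewrite set_itv1 //; exact: Rintegral_set1.
apply: complexP => /=; last by rewrite Rintegral_cst ?mul0r.
rewrite /Rintegral (continuous_FTC2 (F := fun x : R => x ^+ 2 / 2)) //.
- by rewrite -EFinB /= mulrBl.
- by apply: within_itv => x _ _; exact: cvg_id.
- split.
  + move=> x _; exact: derivableM.
  + apply: cvg_at_right_filter; apply: cvgM; last exact: cvg_cst.
    by apply: exprn_continuous.
  + apply: cvg_at_left_filter; apply: cvgM; last exact: cvg_cst.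
    by apply: exprn_continuous.
- move=> x _; rewrite derive1E deriveM // derive_cst scaler0 add0r exp_derive.
  by rewrite /GRing.scale /= mulr1 expr1 mulrA mulVf ?mul1r // pnatr_eq0.
Qed.

(** The factor 2 comes from bounding the real and the imaginary part separately. It is harmless:
    later uses need only smallness or a geometric rate. *)
Lemma nm_cint (h : R -> C) (M : R) a b : a <= b -> ccont_on h a b ->
  (forall x, a <= x -> x <= b -> nm (h x) <= M) ->
  nm (cint h a b) <= 2 * M * (b - a).
Proof.
move=> ab hc hM.
have H (g : R -> R) : (forall x, a <= x -> x <= b -> {for x, continuous g}) ->
  (forall x, a <= x -> x <= b -> `|g x| <= M) ->
  `|\int[mu]_(x in `[a, b]) g x| <= M * (b - a).
  move=> gc gM; have ig := int_itv gc.
  apply: le_trans (le_normr_Rintegral _ ig) _ => //.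
  have -> : M * (b - a) = \int[mu]_(x in `[a, b]) M.
    have := congr1 (@complex.Re R) (cint_cst (M%:C)%C ab).
    by rewrite /= mulr0 subr0.
  apply: le_Rintegral => //.
  - exact: integrable_norm ig.
  - by apply: int_itv => x _ _; exact: cvg_cst.
  - by move=> x /=; rewrite in_itv /= => /andP[]; exact: gM.
apply: le_trans (nm_le_ReIm _) _.
rewrite -mulrA mulr_natl mulr2n; apply: lerD; apply: H => x ax xb.
- by apply: ccont_Re; auto.
- by apply: le_trans (Re_le_nm _) (hM _ _ _).
- by apply: ccont_Im; auto.
- by apply: le_trans (Im_le_nm _) (hM _ _ _).
Qed.

End Integral.

(** * Goursat's theorem for rectangles *)

#[local] Opaque nm cint.

Section Goursat.
Variable R : realType.
Local Notation C := R[i].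

Definition ccon (f : C -> C) (z : C) := forall e : R, 0 < e ->
  exists2 d : R, 0 < d & forall w, nm (w - z) < d -> nm (f w - f z) <= e.

(** A division-free form of complex differentiability: the point [z] needs no exclusion, and the
    inequality is already the remainder estimate used in [goursat]. *)
Definition cdiff (f : C -> C) (z : C) := exists A : C, forall e : R, 0 < e ->
  exists2 d : R, 0 < d &
    forall w, nm (w - z) < d -> nm (f w - f z - A * (w - z)) <= e * nm (w - z).

Lemma cdiff_ccon f z : cdiff f z -> ccon f z.
Proof.
move=> [A H] e e0; have [d d0 Hd] := H _ ltr01.
have A1 : 0 < nm A + 1 by rewrite ltr_wpDl // nm_ge0.
exists (Num.min d (e / (nm A + 1))); first by rewrite lt_min d0 divr_gt0.
move=> w; rewrite lt_min => /andP[/Hd K].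
rewrite ltr_pdivlMr // => we; rewrite -(subrK (A * (w - z)) (f w - f z)).
apply: le_trans (nmD _ _) _; rewrite nmM; nra.
Qed.

Lemma ccont_path (f : C -> C) (p : R -> C) (K x : R) : ccon f (p x) ->
  (forall y, nm (p y - p x) <= K * `|y - x|) -> ccont (fun y => f (p y)) x.
Proof.
move=> fc pK e /fc[d d0 H].
have K1 : 0 < `|K| + 1 by rewrite ltr_wpDl.
exists (d / (`|K| + 1)); first by rewrite divr_gt0.
move=> y; rewrite ltr_pdivlMr // => yx; apply: H; apply: le_lt_trans (pK y) _.
apply: le_lt_trans yx; rewrite mulrC ler_wpM2l //.
by apply: le_trans (ler_norm K) _; rewrite lerDl.
Qed.

Lemma ccont_h (f : C -> C) (x y : R) : ccon f (x +i* y)%C ->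
  ccont (fun s => f (s +i* y)%C) x.
Proof.
move=> fc; apply: (@ccont_path f (fun s => (s +i* y)%C) 1) => // s.
have -> : ((s +i* y) - (x +i* y) = (s - x)%:C)%C.
  by apply: complexP; rewrite ?cReD ?cReN ?cImD ?cImN //= subrr.
by rewrite nmR mul1r.
Qed.

Lemma ccont_v (f : C -> C) (x y : R) : ccon f (x +i* y)%C ->
  ccont (fun t => f (x +i* t)%C) y.
Proof.
move=> fc; apply: (@ccont_path f (fun s => (x +i* s)%C) 1) => // t.
have -> : ((x +i* t) - (x +i* y) = 'i * (t - y)%:C)%C.
  by apply: complexP; rewrite ?cReD ?cReN ?cImD ?cImN ?cReM ?cImM //=; ring.
by rewrite nmM nmi nmR.
Qed.

(** The contour integral of [g dz] around the rectangle, counterclockwise; on the vertical sides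
    [dz = i dt]. *)
Definition rectint (g : C -> C) (a b c d : R) : C :=
  cint (fun s => g (s +i* c)%C) a b + 'i%C * cint (fun t => g (b +i* t)%C) c d
  - cint (fun s => g (s +i* d)%C) a b - 'i%C * cint (fun t => g (a +i* t)%C) c d.

Lemma rectintE g a b c d : rectint g a b c d =
  cint (fun s => g (s +i* c)%C) a b + 'i%C * cint (fun t => g (b +i* t)%C) c d
  - cint (fun s => g (s +i* d)%C) a b - 'i%C * cint (fun t => g (a +i* t)%C) c d.
Proof. by []. Qed.

#[local] Opaque rectint.

Definition rect_con (g : C -> C) (a b c d : R) := forall s t,
  a <= s -> s <= b -> c <= t -> t <= d -> ccon g (s +i* t)%C.

Lemma rect_con_h g a b c d t : rect_con g a b c d -> c <= t -> t <= d ->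
  ccont_on (fun s => g (s +i* t)%C) a b.
Proof. by move=> H ct td s s1 s2; apply: ccont_h; apply: H. Qed.

Lemma rect_con_v g a b c d s : rect_con g a b c d -> a <= s -> s <= b ->
  ccont_on (fun t => g (s +i* t)%C) c d.
Proof. by move=> H ct td t s1 s2; apply: ccont_v; apply: H. Qed.

Lemma rect_con_sub g a b c d a' b' c' d' : rect_con g a b c d ->
  a <= a' -> b' <= b -> c <= c' -> d' <= d -> rect_con g a' b' c' d'.
Proof. by move=> H h1 h2 h3 h4 s t h5 h6 h7 h8; apply: H; lra. Qed.

Lemma rectint_splitx g a m b c d : rect_con g a b c d ->
  a <= m -> m <= b -> c <= d ->
  rectint g a b c d = rectint g a m c d + rectint g m b c d.
Proof.
move=> gc am mb cd; rewrite !rectintE.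
rewrite (cint_cat am mb (rect_con_h gc (lexx c) cd)).
rewrite (cint_cat am mb (rect_con_h gc cd (lexx d))).
ring.
Qed.

Lemma rectint_splity g a b c m d : rect_con g a b c d ->
  a <= b -> c <= m -> m <= d ->
  rectint g a b c d = rectint g a b c m + rectint g a b m d.
Proof.
move=> gc ab cm md; rewrite !rectintE.
rewrite (cint_cat cm md (rect_con_v gc (lexx a) ab)).
rewrite (cint_cat cm md (rect_con_v gc ab (lexx b))).
ring.
Qed.

Lemma affine_con (A B z : C) : ccon (fun w => A + B * w) z.
Proof.
apply: cdiff_ccon; exists B => e e0; exists 1 => // w _.
rewrite (_ : _ - _ - _ = 0) ?nm0; last by ring.
by rewrite mulr_ge0 ?nm_ge0 // ltW.
Qed.

(** Cauchy's theorem for affine functions, by explicit evaluation of the four sides. It allows the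
    first-order Taylor polynomial to be subtracted under the boundary integral. *)
Lemma rectint_affine (A B : C) a b c d : a <= b -> c <= d ->
  rectint (fun w => A + B * w) a b c d = 0.
Proof.
move=> ab cd.
have idc x : ccont (fun s : R => s%:C%C) x.
  move=> e e0; exists e => // y yx.
  have -> : y%:C%C - x%:C%C = (y - x)%:C%C :> C by rewrite rmorphB.
  by rewrite nmR ltW.
have Zc (k : C) x : ccont (fun s : R => k * s%:C%C) x.
  have := @ccont_path (fun w => 0 + k * w) (fun s => s%:C%C) 1 x (affine_con _ _ _).
  move=> H; have {H} := H _; move=> H e e0.
  have [|d0 d1 d2] := H _ e e0; last by exists d0 => // y /d2; rewrite !add0r.
  move=> y; have -> : y%:C%C - x%:C%C = (y - x)%:C%C :> C by rewrite rmorphB.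
  by rewrite nmR mul1r.
have H (P Q : C) u v : u <= v -> cint (fun s => P + Q * s%:C%C) u v =
  P * (v - u)%:C%C + Q * ((v ^+ 2 - u ^+ 2) / 2)%:C%C.
  move=> uv; rewrite cintD; last 2 first.
  - by move=> x _ _; exact: ccont_cst.
  - by move=> x _ _; exact: Zc.
  by rewrite cintZ ?cint_cst ?cint_id // => x _ _; exact: idc.
have Hh t : cint (fun s => A + B * (s +i* t)%C) a b =
    (A + B * ('i%C * t%:C%C)) * (b - a)%:C%C + B * ((b ^+ 2 - a ^+ 2) / 2)%:C%C.
  rewrite -H //; apply: eq_cint => s _ _.
  by rewrite (complexE (s +i* t)%C) /=; ring.
have Hv s : cint (fun t => A + B * (s +i* t)%C) c d =
    (A + B * s%:C%C) * (d - c)%:C%C + (B * 'i%C) * ((d ^+ 2 - c ^+ 2) / 2)%:C%C.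
  rewrite -H //; apply: eq_cint => t _ _.
  by rewrite (complexE (s +i* t)%C) /=; ring.
rewrite !rectintE !Hh !Hv !rmorphB /=; ring.
Qed.

Lemma nm_four (x y z t : C) (M u v : R) :
  nm x <= 2 * M * u -> nm z <= 2 * M * u ->
  nm t <= 2 * M * v -> nm y <= 2 * M * v ->
  nm (x + 'i%C * y - z - 'i%C * t) <= 4 * M * (u + v).
Proof.
have := nmB (x + 'i%C * y - z) ('i%C * t).
have := nmB (x + 'i%C * y) z; have := nmD x ('i%C * y).
rewrite !nmM nmi !mul1r.
move: (nm _) (nm _) (nm _) (nm _) (nm _) (nm _) (nm _) => *; lra.
Qed.

Lemma nm_quarter (x y z t : C) (e : R) : 4 * e <= nm (x + y + (z + t)) ->
  e <= nm x \/ e <= nm y \/ e <= nm z \/ e <= nm t.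
Proof.
have := nmD (x + y) (z + t); have := nmD x y; have := nmD z t.
move: (nm _) (nm _) (nm _) (nm _) (nm _) (nm _) (nm _) => r1 r2 r3 r4 r5 r6 r7.
have [|?] := leP e r5; first by auto.
have [|?] := leP e r6; first by auto.
have [|?] := leP e r2; first by auto.
have [|?] := leP e r3; first by auto.
lra.
Qed.

(** The affine part integrates to 0, so [M] only has to bound the remainder of [g]. Each side costs
    [2 M] times its length and the sides come in equal pairs, hence the 4. *)
Lemma rectint_bound (g : C -> C) (A B : C) (M a b c d : R) :
  a <= b -> c <= d -> rect_con g a b c d ->
  (forall s t, a <= s -> s <= b -> c <= t -> t <= d ->
     nm (g (s +i* t)%C - (A + B * (s +i* t)%C)) <= M) ->
  nm (rectint g a b c d) <= 4 * M * (b - a + (d - c)).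
Proof.
move=> ab cd gc gM.
pose r w := g w - (A + B * w).
have rc : rect_con r a b c d.
  move=> s t h1 h2 h3 h4 e e0.
  have e20 : 0 < e / 2 by rewrite divr_gt0.
  have [d1 d10 H1] := gc s t h1 h2 h3 h4 _ e20.
  have [d2 d20 H2] := affine_con A B (s +i* t)%C e20.
  exists (Num.min d1 d2); first by rewrite lt_min d10 d20.
  move=> w; rewrite lt_min => /andP[/H1 K1 /H2 K2].
  rewrite /r (_ : _ - _ = (g w - g (s +i* t)%C) -
    ((A + B * w) - (A + B * (s +i* t)%C))); last by ring.
  by apply: le_trans (nmB _ _) _; lra.
have afc : rect_con (fun w => A + B * w) a b c d.
  by move=> s t _ _ _ _; exact: affine_con.
have -> : rectint g a b c d = rectint r a b c d.
  rewrite -[RHS]addr0 -(rectint_affine A B ab cd) !rectintE.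
  have E (u v : R -> C) x y : ccont_on u x y -> ccont_on v x y ->
     cint u x y + cint v x y = cint (fun s => u s + v s) x y.
    by move=> *; rewrite cintD.
  rewrite -[cint (fun s => g (s +i* c)%C) _ _](_ :
    cint (fun s => r (s +i* c)%C) a b +
    cint (fun s => A + B * (s +i* c)%C) a b = _); last first.
    rewrite E; [|exact: rect_con_h rc _ _|exact: rect_con_h afc _ _].
    by apply: eq_cint => s _ _; rewrite /r subrK.
  rewrite -[cint (fun s => g (s +i* d)%C) _ _](_ :
    cint (fun s => r (s +i* d)%C) a b +
    cint (fun s => A + B * (s +i* d)%C) a b = _); last first.
    rewrite E; [|exact: rect_con_h rc _ _|exact: rect_con_h afc _ _].
    by apply: eq_cint => s _ _; rewrite /r subrK.
  rewrite -[cint (fun s => g (a +i* s)%C) _ _](_ :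
    cint (fun s => r (a +i* s)%C) c d +
    cint (fun s => A + B * (a +i* s)%C) c d = _); last first.
    rewrite E; [|exact: rect_con_v rc _ _|exact: rect_con_v afc _ _].
    by apply: eq_cint => s _ _; rewrite /r subrK.
  rewrite -[cint (fun s => g (b +i* s)%C) _ _](_ :
    cint (fun s => r (b +i* s)%C) c d +
    cint (fun s => A + B * (b +i* s)%C) c d = _); last first.
    rewrite E; [|exact: rect_con_v rc _ _|exact: rect_con_v afc _ _].
    by apply: eq_cint => s _ _; rewrite /r subrK.
  by do 8! move: (cint _ _ _) => ?; ring.
have H1 : nm (cint (fun s => r (s +i* c)%C) a b) <= 2 * M * (b - a).
  apply: nm_cint => //; first exact: rect_con_h rc _ _.
  by move=> *; exact: gM.
have H2 : nm (cint (fun s => r (s +i* d)%C) a b) <= 2 * M * (b - a).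
  apply: nm_cint => //; first exact: rect_con_h rc _ _.
  by move=> *; exact: gM.
have H3 : nm (cint (fun s => r (a +i* s)%C) c d) <= 2 * M * (d - c).
  apply: nm_cint => //; first exact: rect_con_v rc _ _.
  by move=> *; exact: gM.
have H4 : nm (cint (fun s => r (b +i* s)%C) c d) <= 2 * M * (d - c).
  apply: nm_cint => //; first exact: rect_con_v rc _ _.
  by move=> *; exact: gM.
rewrite rectintE; move: H1 H2 H3 H4; clear.
do 4! move: (cint _ _ _) => ?; exact: nm_four.
Qed.

(** Pigeonhole on the four quarters. The sides are written [p + p] and [q + q] so that halving
    involves no division. *)
Lemma rect_quarter g x y p q e : 0 <= p -> 0 <= q ->
  rect_con g x (x + (p + p)) y (y + (q + q)) ->
  4 * e <= nm (rectint g x (x + (p + p)) y (y + (q + q))) ->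
  exists x' y', [/\ x' = x \/ x' = x + p, y' = y \/ y' = y + q &
    e <= nm (rectint g x' (x' + p) y' (y' + q))].
Proof.
rewrite (addrA x) (addrA y) => p0 q0 gc.
rewrite (@rectint_splitx g x (x + p)) //; [|lra..].
rewrite (@rectint_splity g x (x + p) y (y + q)); [| |lra..]; last first.
  by apply: rect_con_sub gc _ _ _ _; lra.
rewrite (@rectint_splity g (x + p) _ y (y + q)); [| |lra..]; last first.
  by apply: rect_con_sub gc _ _ _ _; lra.
case/nm_quarter => [H|[H|[H|H]]].
- by exists x, y; split; auto.
- by exists x, (y + q); split; auto.
- by exists (x + p), y; split; auto.
- by exists (x + p), (y + q); split; auto.
Qed.

Lemma nested_intervals (x r : nat -> R) : (forall n, x n <= x n.+1) ->
  (forall n, x n.+1 + r n.+1 <= x n + r n) -> (forall n, 0 <= r n) ->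
  exists l, forall n, x n <= l /\ l <= x n + r n.
Proof.
move=> xi ri r0.
have xm m n : (m <= n)%N -> x m <= x n.
  move=> mn; rewrite -(subnKC mn); elim: (n - m)%N => [|k IH]; rewrite ?addn0 //.
  by rewrite addnS (le_trans IH).
have rm m n : (m <= n)%N -> x n + r n <= x m + r m.
  move=> mn; rewrite -(subnKC mn); elim: (n - m)%N => [|k IH]; rewrite ?addn0 //.
  by rewrite addnS; exact: le_trans (ri _) IH.
have ub m n : x n <= x m + r m.
  case/orP: (leq_total m n) => mn.
    by apply: le_trans (rm _ _ mn); rewrite lerDl.
  by apply: le_trans (xm _ _ mn) _; rewrite lerDl.
have hs : has_sup (range x).
  split; first by exists (x 0%N); exists 0%N.
  by exists (x 0%N + r 0%N) => _ [n _ <-].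
exists (sup (range x)) => n; split.
  by apply: ub_le_sup; [case: hs|exists n].
by apply: ge_sup; [case: hs|move=> _ [m _ <-]].
Qed.

(* Bisection: a counterexample would give nested rectangles whose boundary
   integrals decay only like 4^-n, against differentiability at their
   common point. *)
Theorem goursat (g : C -> C) (a b c d : R) : a <= b -> c <= d ->
  (forall s t, a <= s -> s <= b -> c <= t -> t <= d -> cdiff g (s +i* t)%C) ->
  rectint g a b c d = 0.
Proof.
move=> ab cd gd.
have gc : rect_con g a b c d.
  by move=> s t *; apply: cdiff_ccon; exact: gd.
apply/eqP; rewrite -nm_eq0; apply/eqP; set eta := nm _.
apply/eqP; case: (eqVneq eta 0) => // etan0; exfalso.
have eta0 : 0 < eta by rewrite lt_def etan0 nm_ge0.
pose p n : R := (b - a) / 2 ^+ n; pose q n : R := (d - c) / 2 ^+ n.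
have p0 n : 0 <= p n by rewrite divr_ge0 ?subr_ge0 ?exprn_ge0.
have q0 n : 0 <= q n by rewrite divr_ge0 ?subr_ge0 ?exprn_ge0.
have two0 n : (2 : R) ^+ n != 0 by rewrite expf_neq0 // pnatr_eq0.
have pS n : p n = p n.+1 + p n.+1.
  by rewrite /p exprS; field; rewrite two0.
have qS n : q n = q n.+1 + q n.+1.
  by rewrite /q exprS; field; rewrite two0.
pose Inv n (z : R * R) := [/\ a <= z.1, z.1 + p n <= b, c <= z.2, z.2 + q n <= d &
   eta / 4 ^+ n <= nm (rectint g z.1 (z.1 + p n) z.2 (z.2 + q n))].
have inv0 : Inv 0%N (a, c).
  split=> //=; rewrite /p /q expr0 !divr1 ?subrKC //.
(* [cid] turns the existence of a bad quarter into data, so that the bisection can be iterated with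
   its invariant attached. *)
have step n (z : {z | Inv n z}) : {z' | Inv n.+1 z' /\
  [/\ (sval z).1 <= z'.1, z'.1 + p n.+1 <= (sval z).1 + p n,
      (sval z).2 <= z'.2 & z'.2 + q n.+1 <= (sval z).2 + q n]}.
  apply: cid; case: z => -[x y] [/= h1 h2 h3 h4 h5].
  have e4 : eta / 4 ^+ n = 4 * (eta / 4 ^+ n.+1).
    by rewrite exprS; field; rewrite expf_neq0 // pnatr_eq0.
  have [||x' [y' [hx hy he]]] :=
    @rect_quarter g x y _ _ (eta / 4 ^+ n.+1) (p0 n.+1) (q0 n.+1).
  - by rewrite -pS -qS; exact: rect_con_sub gc _ _ _ _.
  - by rewrite -pS -qS -e4.
  exists (x', y'); rewrite /Inv /=.
  move: hx hy (eta / 4 ^+ n.+1) (p0 n.+1) (q0 n.+1) (pS n) (qS n) he h1 h2 h3 h4.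
  move: (p n) (q n) (p n.+1) (q n.+1); clear.
  move=> p q p' q' [->|->] [->|->] e *; split; split => //; lra.
pose F := fix F n : {z | Inv n z} := match n with
  | 0 => exist _ (a, c) inv0
  | n'.+1 => exist _ (sval (step n' (F n'))) (proj1 (svalP (step n' (F n')))) end.
pose x n := (sval (F n)).1; pose y n := (sval (F n)).2.
have st n : [/\ x n <= x n.+1, x n.+1 + p n.+1 <= x n + p n,
      y n <= y n.+1 & y n.+1 + q n.+1 <= y n + q n].
  exact: (proj2 (svalP (step n (F n)))).
have inv n : Inv n (x n, y n) by rewrite /x /y; case: (F n) => -[].
have [xl Hx] : exists l, forall n, x n <= l /\ l <= x n + p n.
  by apply: nested_intervals => // n; case: (st n).
have [yl Hy] : exists l, forall n, y n <= l /\ l <= y n + q n.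
  by apply: nested_intervals => // n; case: (st n).
have [B HB] : cdiff g (xl +i* yl)%C.
  have [/= i1 i2 i3 i4 _] := inv 0%N; have := Hx 0%N; have := Hy 0%N.
  by move=> [u1 u2] [u3 u4]; apply: gd; clear -i1 i2 i3 i4 u1 u2 u3 u4; lra.
pose S : R := (b - a) + (d - c).
have S0 : 0 <= S by rewrite /S; lra.
(* Chosen so that the bound [4 e S^2 / 4^n] on the n-th rectangle falls below [eta / 4^n]; the [+ 1]
   covers the degenerate case [S = 0]. *)
pose e := eta / (8 * (S ^+ 2 + 1)).
have S2 : 0 < 8 * (S ^+ 2 + 1) by rewrite mulr_gt0 // ltr_wpDl // sqr_ge0.
have e0 : 0 < e by rewrite divr_gt0.
have [dl dl0 Hd] := HB _ e0.
have [n Hn] : exists n, S / 2 ^+ n < dl.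
  have [n nS] : exists n : nat, S / dl < n%:R.
    by exists (Num.bound (S / dl)); apply: archi_boundP; rewrite divr_ge0 // ltW.
  exists n; rewrite ltr_pdivrMr ?exprn_gt0 // mulrC -ltr_pdivrMr //.
  apply: lt_trans nS _; rewrite -natrX ltr_nat; exact: ltn_expl.
have [/= i1 i2 i3 i4 i5] := inv n; have [u1 u2] := Hx n; have [u3 u4] := Hy n.
have Sn : S / 2 ^+ n = p n + q n by rewrite /S /p /q mulrDl.
have bd := @rectint_bound g (g (xl +i* yl)%C - B * (xl +i* yl)%C) B
  (e * (S / 2 ^+ n)) (x n) (x n + p n) (y n) (y n + q n).
have {bd}: nm (rectint g (x n) (x n + p n) (y n) (y n + q n)) <=
   4 * (e * (S / 2 ^+ n)) * (S / 2 ^+ n).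
  have -> : 4 * (e * (S / 2 ^+ n)) * (S / 2 ^+ n) = 4 * (e * (S / 2 ^+ n)) *
     (x n + p n - x n + (y n + q n - y n)) by rewrite Sn; congr (_ * _); ring.
  apply: bd; [by rewrite lerDl|by rewrite lerDl| |].
    by apply: rect_con_sub gc _ _ _ _; clear -i1 i2 i3 i4 u1 u2 u3 u4; lra.
  move=> s t h1 h2 h3 h4.
  have W : nm ((s +i* t) - (xl +i* yl))%C <= S / 2 ^+ n.
    apply: le_trans (nm_le_ReIm _) _; rewrite cReD cReN cImD cImN /= Sn.
    by apply: lerD; rewrite ler_norml; apply/andP; split; clear -h1 h2 h3 h4 u1 u2 u3 u4; lra.
  have := Hd (s +i* t)%C (le_lt_trans W Hn).
  rewrite (_ : _ - _ - _ = g (s +i* t)%C -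
    (g (xl +i* yl)%C - B * (xl +i* yl)%C + B * (s +i* t)%C)); last by ring.
  by move=> K; apply: le_trans K _; rewrite ler_pM2l.
move=> /(le_trans i5).
have -> : 4 * (e * (S / 2 ^+ n)) * (S / 2 ^+ n) = 4 * e * S ^+ 2 / 4 ^+ n.
  have -> : (4 : R) ^+ n = 2 ^+ n * 2 ^+ n by rewrite -exprMn -natrM.
  by field; rewrite two0.
rewrite ler_pM2r ?invr_gt0 ?exprn_gt0 //; apply/negP; rewrite -ltNge.
rewrite (_ : 4 * e * S ^+ 2 = eta * (4 * S ^+ 2 / (8 * (S ^+ 2 + 1)))); last first.
  by rewrite /e; field; rewrite gt_eqF // ltr_wpDl // sqr_ge0.
rewrite -[ltRHS]mulr1 ltr_pM2l // ltr_pdivrMr // mul1r.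
by have := sqr_ge0 S; lra.
Qed.

End Goursat.

(** * Complex differentiability and the exponential *)

Section Cdiff.
Variable R : realType.
Local Notation C := R[i].
Implicit Types (f g : C -> C) (z : C).

Lemma ccon_near f g z : ccon f z -> (exists2 d : R, 0 < d &
  forall w, nm (w - z) < d -> f w = g w) -> ccon g z.
Proof.
move=> H [d d0 Hd] e /H[d1 d10 H1]; exists (Num.min d d1).
  by rewrite lt_min d0.
move=> w; rewrite lt_min => /andP[/Hd <- /H1]; rewrite -Hd //.
by rewrite subrr nm0.
Qed.

Lemma cdiff_near f g z : cdiff f z -> (exists2 d : R, 0 < d &
  forall w, nm (w - z) < d -> f w = g w) -> cdiff g z.
Proof.
move=> [A H] [d d0 Hd]; exists A => e /H[d1 d10 H1]; exists (Num.min d d1).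
  by rewrite lt_min d0.
move=> w; rewrite lt_min => /andP[/Hd <- /H1]; rewrite -Hd //.
by rewrite subrr nm0.
Qed.

Lemma cdiff_eq f g z : f =1 g -> cdiff f z -> cdiff g z.
Proof. by move=> fg /cdiff_near; apply; exists 1. Qed.

Lemma ccon_mul f g z : ccon f z -> ccon g z -> ccon (fun w => f w * g w) z.
Proof.
move=> Hf Hg e e0.
have a0 := nm_ge0 (f z); have b0 := nm_ge0 (g z).
pose K := nm (f z) + nm (g z) + 1.
have K0 : 0 < K by rewrite /K; lra.
pose e1 := Num.min 1 (e / K).
have e10 : 0 < e1 by rewrite lt_min ltr01 divr_gt0.
have [d1 d10 H1] := Hf _ e10; have [d2 d20 H2] := Hg _ e10.
exists (Num.min d1 d2); first by rewrite lt_min d10.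
move=> w; rewrite lt_min => /andP[/H1 k1 /H2 k2].
rewrite (_ : _ - _ = (f w - f z) * (g w - g z) + (f w - f z) * g z +
  f z * (g w - g z)); last by ring.
apply: le_trans (nmD _ _) _; have := nmD ((f w - f z) * (g w - g z)) ((f w - f z) * g z).
rewrite !nmM => k3.
have e11 : e1 <= 1 by rewrite ge_min lexx.
have : e1 * K <= e by rewrite -ler_pdivlMr // ge_min lexx orbT.
have c0 := nm_ge0 (f w - f z); have c1 := nm_ge0 (g w - g z).
rewrite /K; move: k1 k2 k3 c0 c1 a0 b0 e11 e10; clear.
move: (nm _) (nm _) (nm _) (nm _) (nm _) => *; nra.
Qed.

Lemma cdiff_cst (c z : C) : cdiff (fun=> c) z.
Proof.
exists 0 => e e0; exists 1 => // w _; rewrite subrr mul0r subr0 nm0.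
by rewrite mulr_ge0 ?nm_ge0 // ltW.
Qed.

Lemma cdiff_id z : cdiff id z.
Proof.
exists 1 => e e0; exists 1 => // w _; rewrite mul1r subrr nm0.
by rewrite mulr_ge0 ?nm_ge0 // ltW.
Qed.

Lemma cdiffD f g z : cdiff f z -> cdiff g z -> cdiff (fun w => f w + g w) z.
Proof.
move=> [A Hf] [B Hg]; exists (A + B) => e e0.
have e20 : 0 < e / 2 by rewrite divr_gt0.
have [d1 d10 H1] := Hf _ e20; have [d2 d20 H2] := Hg _ e20.
exists (Num.min d1 d2); first by rewrite lt_min d10.
move=> w; rewrite lt_min => /andP[/H1 k1 /H2 k2].
rewrite (_ : _ - _ - _ = (f w - f z - A * (w - z)) + (g w - g z - B * (w - z)));
  last by ring.
by apply: le_trans (nmD _ _) _; lra.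
Qed.

Lemma cdiff_comp f g z : cdiff g z -> cdiff f (g z) -> cdiff (fun w => f (g w)) z.
Proof.
move=> [B Hg] [A Hf]; exists (A * B) => e e0.
have a0 := nm_ge0 A; have b0 := nm_ge0 B.
pose K := nm A + nm B + 1.
have K0 : 0 < K by rewrite /K; lra.
pose e1 := Num.min 1 (e / K).
have e10 : 0 < e1 by rewrite lt_min ltr01 divr_gt0.
have [d1 d10 H1] := Hf _ e10; have [d2 d20 H2] := Hg _ e10.
exists (Num.min d2 (d1 / K)); first by rewrite lt_min d20 divr_gt0.
move=> w; rewrite lt_min ltr_pdivlMr // => /andP[/H2 k2 k3].
have e11 : e1 <= 1 by rewrite ge_min lexx.
have eK : e1 * K <= e by rewrite -ler_pdivlMr // ge_min lexx orbT.
have c0 := nm_ge0 (w - z).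
have k4 : nm (g w - g z) <= (nm B + 1) * nm (w - z).
  rewrite -(subrK (B * (w - z)) (g w - g z)); apply: le_trans (nmD _ _) _.
  by rewrite nmM; move: k2; move: (nm _) => r *; nra.
have {H1}k1 : nm (f (g w) - f (g z) - A * (g w - g z)) <= e1 * nm (g w - g z).
  apply: H1; move: k3 k4 a0 b0 c0; rewrite /K; clear.
  by move: (nm _) (nm _) (nm _) (nm _) => *; nra.
rewrite (_ : _ - _ - _ = (f (g w) - f (g z) - A * (g w - g z)) +
  A * (g w - g z - B * (w - z))); last by ring.
apply: le_trans (nmD _ _) _; rewrite nmM.
have m1 : e1 * nm (g w - g z) <= e1 * ((nm B + 1) * nm (w - z)).
  by rewrite ler_wpM2l // ltW.
have m2 : nm A * nm (g w - g z - B * (w - z)) <= nm A * (e1 * nm (w - z)).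
  by rewrite ler_wpM2l.
have m3 : (e1 * K) * nm (w - z) <= e * nm (w - z) by rewrite ler_wpM2r.
move: k1 m1 m2 m3; rewrite /K; clear.
move: (nm _) (nm _) (nm _) (nm _) (nm _) (nm _) => *; nra.
Qed.

(** Polarisation, [4 f g = (f + g)^2 - (f - g)^2]: only squaring and multiplication by a constant
    need an estimate, and both enter through [cdiff_comp]. *)
Lemma cdiffM f g z : cdiff f z -> cdiff g z -> cdiff (fun w => f w * g w) z.
Proof.
have sq (k : C -> C) (u : C) : cdiff k u -> cdiff (fun w => k w * k w) u.
  move=> kd; refine (@cdiff_comp (fun w : C => w * w) k u kd _).
  exists (k u + k u) => e e0; exists e => // w wd.
  rewrite (_ : _ - _ - _ = (w - k u) * (w - k u)); last by ring.
  by rewrite nmM ler_wpM2r ?nm_ge0 // ltW.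
have Zd (c : C) (k : C -> C) (u : C) : cdiff k u -> cdiff (fun w => c * k w) u.
  move=> kd; refine (@cdiff_comp (fun w : C => c * w) k u kd _).
  exists c => e e0; exists 1 => // w _; rewrite -mulrBr subrr nm0.
  by rewrite mulr_ge0 ?nm_ge0 // ltW.
move=> fd gd.
have sd := sq _ _ (cdiffD fd gd).
have dd := sq _ _ (cdiffD fd (Zd (-1) _ _ gd)).
have := Zd 4^-1 _ _ (cdiffD sd (Zd (-1) _ _ dd)).
by apply: cdiff_eq => w /=; field.
Qed.

Lemma cdiffV z : z != 0 -> cdiff GRing.inv z.
Proof.
move=> z0; exists (- (z ^- 2)) => e e0.
have n0 : 0 < nm z by rewrite nm_gt0.
have z3 : 0 < nm z ^+ 3 by rewrite exprn_gt0.
(* The first radius keeps [nm w >= nm z / 2]; the second then makes the factor [(w - z) / (w z^2)]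
   of the exact remainder at most [e]. *)
exists (Num.min (nm z / 2) (e * nm z ^+ 3 / 2)).
  by rewrite lt_min !divr_gt0 ?mulr_gt0.
move=> w; rewrite lt_min => /andP[h1 h2].
have wz : nm z / 2 <= nm w.
  by have := nmD (z - w) w; rewrite subrK nmBC; move: h1; clear; lra.
have w0 : w != 0 by rewrite -nm_gt0; apply: lt_le_trans wz; rewrite divr_gt0.
rewrite (_ : _ - _ - _ = (w - z) / (w * z ^+ 2) * (w - z)); last first.
  by field; rewrite w0 z0.
rewrite nmM ler_wpM2r ?nm_ge0 // nmM nmV nmM nmX ler_pdivrMr; last first.
  by rewrite mulr_gt0 ?nm_gt0 ?exprn_gt0.
apply: le_trans (ltW h2) _; rewrite -mulrA ler_pM2l //.
have -> : nm z ^+ 3 / 2 = nm z / 2 * nm z ^+ 2 by rewrite exprS; ring.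
by rewrite ler_wpM2r // sqr_ge0.
Qed.

Lemma cdiffX f z n : cdiff f z -> cdiff (fun w => f w ^+ n) z.
Proof.
move=> fd; elim: n => [|n IH].
  by apply: (cdiff_eq (f := fun=> 1)); [move=> w|exact: cdiff_cst].
apply: (cdiff_eq (f := fun w => f w * f w ^+ n)).
  by move=> w; rewrite exprS.
exact: cdiffM.
Qed.

Lemma is_derive_eps (f : R -> R) (x l : R) : is_derive x 1 f l ->
  forall e, 0 < e -> exists2 d, 0 < d &
    forall h, `|h| < d -> `|f (h + x) - f x - l * h| <= e * `|h|.
Proof.
move=> [df fl] e e0.
have : (fun h => h^-1 *: (f (h *: 1 + x) - f x)) @ 0^' --> l by rewrite -fl; exact: df.
move/cvgrPdist_le => /(_ e e0) /nbhs_ballP[d /= d0 Hd].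
exists d => // h hd; case: (eqVneq h 0) => [->|h0].
  by rewrite add0r subrr mulr0 subr0 normr0 mulr0.
have := Hd h; rewrite /ball /= sub0r normrN => /(_ hd h0) H.
have -> : f (h + x) - f x - l * h = (h^-1 *: (f (h *: 1 + x) - f x) - l) * h.
  by rewrite /GRing.scale /= mulr1; field.
by rewrite normrM ler_wpM2r // distrC.
Qed.

(** * The unit circle and the complex exponential *)

Definition cis (t : R) : C := (cos t +i* sin t)%C.

Lemma cisD s t : cis (s + t) = cis s * cis t.
Proof. by apply: complexP; rewrite ?cReM ?cImM /= ?cosD ?sinD //; ring. Qed.

Lemma cis0 : cis 0 = 1. Proof. by rewrite /cis cos0 sin0. Qed.
Lemma cispi : cis pi = -1.
Proof. by apply: complexP; rewrite ?cReN ?cImN /= ?cospi ?sinpi ?oppr0. Qed.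
Lemma cis2pi : cis (2 * pi) = 1.
Proof. by rewrite mulr_natl mulr2n cisD cispi mulrNN mulr1. Qed.
Lemma cisMn t n : cis (t *+ n) = cis t ^+ n.
Proof. by elim: n => [|n IH]; rewrite ?cis0 // mulrS cisD IH exprS. Qed.
Lemma nm_cis t : nm (cis t) = 1.
Proof.
by apply: complexI; rewrite nmE normc_def /= cos2Dsin2 sqrtr1.
Qed.
Lemma cis_neq0 t : cis t != 0.
Proof. by rewrite -nm_gt0 nm_cis. Qed.

Definition cexp (w : C) : C := (expR (complex.Re w))%:C%C * cis (complex.Im w).

Lemma cexpD v w : cexp (v + w) = cexp v * cexp w.
Proof. by rewrite /cexp cReD cImD expRD cisD rmorphM; ring. Qed.

(** Only the derivative at 0 is computed, from those of [expR], [cos] and [sin] there; the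
    functional equation [cexpD] carries it to every point. *)
Lemma cdiff_cexp0 : cdiff cexp 0.
Proof.
exists 1 => e' e'0.
(* The real and imaginary parts of the remainder will each be at most [4 e nm w], whence the 8;
   [e <= 1] and the radius [e / 2] control products of first-order terms. *)
pose e := Num.min 1 (e' / 8).
have e0 : 0 < e by rewrite lt_min ltr01 divr_gt0.
have e1 : e <= 1 by rewrite ge_min lexx.
have e8 : 8 * e <= e' by rewrite mulrC -ler_pdivlMr // ge_min lexx orbT.
have [d1 d10 H1] := is_derive_eps (is_derive_expR (0 : R)) e0.
have [d2 d20 H2] := is_derive_eps (is_derive_cos (0 : R)) e0.
have [d3 d30 H3] := is_derive_eps (is_derive_sin (0 : R)) e0.
exists (Num.min (e / 2) (Num.min d1 (Num.min d2 d3))).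
  by rewrite !lt_min d10 d20 d30 divr_gt0.
move=> w; rewrite subr0 !lt_min => /and4P[h0 h1 h2 h3].
have rx := Re_le_nm w; have ry := Im_le_nm w.
have := H1 _ (le_lt_trans rx h1); have := H2 _ (le_lt_trans ry h2).
have := H3 _ (le_lt_trans ry h3).
rewrite !addr0 sin0 cos0 expR0 oppr0 mul0r !mul1r !subr0.
move=> k3 k2 k1; apply: le_trans (nm_le_ReIm _) _; move: k3 k2 k1.
have -> : cexp 0 = 1 by rewrite /cexp /= expR0 cis0 mulr1.
rewrite ?addr0 !cReD !cImD !cReN !cImN /cexp cReM cImM /= !mul0r ?subr0 ?oppr0 ?addr0.
have := sin_le1 (complex.Im w); have := sin_geN1 (complex.Im w).
have := cos_le1 (complex.Im w); have := cos_geN1 (complex.Im w).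
move: rx ry h0.
move: (complex.Re w) (complex.Im w) (nm w) => x y n.
move: (cos y) (sin y) (expR x) => c s E rx ry h0 c1 c2 s1 s2 k3 k2 k1.
clear -e0 e1 e8 rx ry h0 c1 c2 s1 s2 k3 k2 k1.
have n0 : 0 <= n := le_trans (normr_ge0 _) rx.
have sy : `|s| <= 2 * n.
  by have := ler_normD (s - y) y; rewrite subrK; nra.
have A1 : `|E * c - 1 - x| <= 4 * e * n.
  rewrite (_ : _ - _ - _ = (E - 1 - x) * c + (1 + x) * (c - 1)); last by ring.
  apply: le_trans (ler_normD _ _) _; rewrite !normrM.
  have : `|c| <= 1 by rewrite ler_norml c1.
  have : `|1 + x| <= 2 by have := ler_normD 1 x; rewrite normr1; lra.
  have := normr_ge0 (E - 1 - x); have := normr_ge0 (c - 1).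
  have a1 : `|E - 1 - x| <= e * n by apply: le_trans k1 _; rewrite ler_wpM2l // ltW.
  have a2 : `|c - 1| <= e * n by apply: le_trans k2 _; rewrite ler_wpM2l // ltW.
  move: a1 a2; move: (`|_|) (`|_|) (`|_|) (`|_|) => *; nra.
have A2 : `|E * s - y| <= 4 * e * n.
  rewrite (_ : _ - _ = (E - 1 - x) * s + x * s + (s - y)); last by ring.
  apply: le_trans (ler_normD _ _) _.
  have := ler_normD ((E - 1 - x) * s) (x * s); rewrite !normrM.
  have : `|s| <= 1 by rewrite ler_norml s1.
  have := normr_ge0 (E - 1 - x); have := normr_ge0 s; have := normr_ge0 x.
  have a1 : `|E - 1 - x| <= e * n by apply: le_trans k1 _; rewrite ler_wpM2l // ltW.
  have a3 : `|s - y| <= e * n by apply: le_trans k3 _; rewrite ler_wpM2l // ltW.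
  have a4 : `|s| <= e by lra.
  move: a1 a3 a4 rx sy; move: (`|_|) (`|_|) (`|_|) (`|_|) (`|_|) => *; nra.
by nra.
Qed.

Lemma cdiff_cexp z : cdiff cexp z.
Proof.
apply: (cdiff_eq (f := fun w => cexp z * cexp (w + - z))).
  by move=> w; rewrite -cexpD addrC subrK.
apply: cdiffM; first exact: cdiff_cst.
apply: (@cdiff_comp cexp (fun w => w + - z)).
  by apply: cdiffD; [exact: cdiff_id|exact: cdiff_cst].
by rewrite subrr; exact: cdiff_cexp0.
Qed.

End Cdiff.

(** * Integrals over circles *)

Section Circle.
Variable R : realType.
Local Notation C := R[i].
Implicit Types (f g : C -> C) (z : C).

(** Integration is against the angle, that is [dz / (i z)] and not [dz]: constants integrate to
    [2 pi] at every radius, and a Taylor coefficient is the mean of [f] times a negative power. *)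
Definition circ f (r : R) : C := cint (fun t => f (r%:C%C * cis t)) 0 (2 * pi).

Lemma twopi_gt0 : 0 < 2 * pi :> R.
Proof. by rewrite mulr_gt0 // pi_gt0. Qed.

Lemma nm_rcis (r t : R) : 0 <= r -> nm (r%:C%C * cis t) = r.
Proof. by move=> r0; rewrite nmM nm_cis mulr1 nmR ger0_norm. Qed.

Lemma cis_lip (s t : R) : nm (cis s - cis t) <= 2 * `|s - t|.
Proof.
have mvt (h h' : R -> R) : (forall x : R, is_derive x 1 h (h' x)) ->
  (forall x, `|h' x| <= 1) -> `|h s - h t| <= `|s - t|.
  move=> hd hb.
  have main a b : a <= b -> `|h b - h a| <= `|b - a|.
    move=> ab; have hc : {within `[a, b], continuous h}.
      apply: within_itv => x _ _; apply: differentiable_continuous.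
      by apply/derivable1_diffP; case: (hd x).
    have [c _ ->] := @MVT_segment R h h' a b ab (fun x _ => hd x) hc.
    by rewrite normrM ler_piMl.
  by case/orP: (le_total s t) => st; [rewrite distrC [leRHS]distrC|]; exact: main.
apply: le_trans (nm_le_ReIm _) _; rewrite cReD cReN cImD cImN /=.
rewrite mulr_natl mulr2n; apply: lerD.
  apply: (mvt cos (fun x => - sin x) (@is_derive_cos R)) => x.
  by rewrite normrN ler_norml sin_le1 sin_geN1.
apply: (mvt sin cos (@is_derive_sin R)) => x.
by rewrite ler_norml cos_le1 cos_geN1.
Qed.

Lemma ccont_circ f (r t : R) : 0 <= r -> ccon f (r%:C%C * cis t) ->
  ccont (fun t => f (r%:C%C * cis t)) t.
Proof.
move=> r0 fc.
apply: (@ccont_path _ f (fun t => r%:C%C * cis t) (r * 2)) => // y.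
by rewrite -mulrBr nmM nmR ger0_norm // -mulrA ler_wpM2l // cis_lip.
Qed.

Definition circ_con f (r : R) := forall z, nm z = r -> ccon f z.

Lemma ccont_on_circ f (r a b : R) : 0 <= r -> circ_con f r ->
  ccont_on (fun t => f (r%:C%C * cis t)) a b.
Proof.
by move=> r0 fc t _ _; apply: ccont_circ => //; apply: fc; rewrite nm_rcis.
Qed.

Lemma eq_circ f g r : 0 <= r -> (forall z, nm z = r -> f z = g z) ->
  circ f r = circ g r.
Proof. by move=> r0 fg; apply: eq_cint => t _ _; rewrite fg // nm_rcis. Qed.

Lemma circD f g r : 0 <= r -> circ_con f r -> circ_con g r ->
  circ (fun z => f z + g z) r = circ f r + circ g r.
Proof.
by move=> r0 fc gc; rewrite /circ -cintD //; exact: ccont_on_circ.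
Qed.

Lemma circZ c f r : 0 <= r -> circ_con f r ->
  circ (fun z => c * f z) r = c * circ f r.
Proof.
by move=> r0 fc; rewrite /circ -cintZ //; exact: ccont_on_circ.
Qed.

Lemma circ_cst c r : circ (fun=> c) r = c * (2 * pi)%:C%C.
Proof. by rewrite /circ cint_cst ?subr0 // ltW // twopi_gt0. Qed.

(** The extreme value theorem on the parametrised circle. The parameter runs over [[- pi, pi]]
    because the argument of [z] is recovered as plus or minus an [acos]. *)
Lemma circ_bounded f r : 0 <= r -> circ_con f r ->
  exists2 M, 0 <= M & forall z, nm z = r -> nm (f z) <= M.
Proof.
move=> r0 fc.
have [||c _ cM] := @EVT_max R (fun t => nm (f (r%:C%C * cis t))) (- pi) pi.
- by rewrite (le_trans (y := 0)) ?oppr_le0 ?pi_ge0.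
- apply: within_itv => t _ _; apply/cvgrPdist_le => e e0.
  have [d d0 H] := ccont_circ r0 (fc _ (nm_rcis t r0)) e0.
  apply/nbhs_ballP; exists d => //= y; rewrite /ball /= distrC => /H K.
  apply: le_trans K; rewrite distrC ler_norml.
  have := nmD (f (r%:C%C * cis y) - f (r%:C%C * cis t)) (f (r%:C%C * cis t)).
  have := nmD (f (r%:C%C * cis t) - f (r%:C%C * cis y)) (f (r%:C%C * cis y)).
  rewrite !subrK (nmBC (f (r%:C%C * cis t))); clear.
  by move: (nm _) (nm _) (nm _) => *; apply/andP; split; lra.
exists (nm (f (r%:C%C * cis c))); first exact: nm_ge0.
move=> z zr.
have [t tpi zE] : exists2 t, t \in `[- pi, pi] & z = r%:C%C * cis t.
  case: (eqVneq r 0) => [r00|rn0].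
    exists 0; first by rewrite in_itv /= oppr_le0 pi_ge0.
    by rewrite r00 mul0r; apply/eqP; rewrite -nm_eq0 zr r00.
  have rp : 0 < r by rewrite lt_def rn0.
  pose x := complex.Re z / r; pose y := complex.Im z / r.
  have xy1 : x ^+ 2 + y ^+ 2 = 1.
    have : complex.Re z ^+ 2 + complex.Im z ^+ 2 = r ^+ 2.
      by apply: complexI; rewrite add_Re2_Im2 -nmE zr rmorphXn.
    by rewrite /x /y !exprMn -mulrDl => ->; rewrite exprVn divff // expf_neq0.
  have x1 : -1 <= x <= 1.
    by have := sqr_ge0 y; apply: contraTT; rewrite negb_and -!ltNge => /orP[]; nra.
  have sE : sin (acos x) = `|y|.
    by rewrite sin_acos // -xy1 addrAC subrr add0r sqrtr_sqr.
  have zxy : z = r%:C%C * (x +i* y)%C.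
    apply: complexP; rewrite ?cReM ?cImM /= /x /y mul0r.
      by rewrite subr0 mulrC divfK.
    by rewrite addr0 mulrC divfK.
  case: (leP 0 y) => y0.
    exists (acos x).
      by rewrite in_itv /= acos_lepi // andbT (le_trans (y := 0)) ?acos_ge0 // oppr_le0 pi_ge0.
    by rewrite zxy /cis sE ger0_norm // acosK // in_itv.
  exists (- acos x).
    by rewrite in_itv /= lerN2 acos_lepi //= (le_trans (y := 0)) ?pi_ge0 // oppr_le0 acos_ge0.
  by rewrite zxy /cis cosN sinN sE ltr0_norm // opprK acosK // in_itv.
by rewrite zE; exact: cM.
Qed.

Lemma nm_circ f r M : 0 <= r -> circ_con f r ->
  (forall z, nm z = r -> nm (f z) <= M) -> nm (circ f r) <= 2 * M * (2 * pi).
Proof.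
move=> r0 fc fM; rewrite -[X in _ * X](subr0 (2 * pi)).
apply: nm_cint; first by rewrite ltW // twopi_gt0.
  exact: ccont_on_circ.
by move=> t _ _; apply: fM; rewrite nm_rcis.
Qed.

(* In the coordinate [w = ln z] the annulus becomes a rectangle whose two
   horizontal sides cancel by 2 pi i - periodicity. *)
Lemma circ_annulus f (r1 r2 : R) : 0 < r1 -> r1 <= r2 ->
  (forall z, r1 <= nm z -> nm z <= r2 -> cdiff f z) -> circ f r1 = circ f r2.
Proof.
move=> r10 r12 fd; have r20 := lt_le_trans r10 r12.
have l12 : ln r1 <= ln r2 by rewrite ler_ln.
have := @goursat _ (fun w => f (cexp w)) _ _ _ _ l12 (ltW twopi_gt0) _.
have H s t : ln r1 <= s -> s <= ln r2 -> cdiff (fun w => f (cexp w)) (s +i* t)%C.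
  move=> s1 s2; apply: cdiff_comp; first exact: cdiff_cexp.
  have -> : cexp (s +i* t)%C = (expR s)%:C%C * cis t by [].
  apply: fd; rewrite nm_rcis ?expR_ge0 //.
    by rewrite -[r1]lnK ?ler_expR // posrE.
  by rewrite -[r2]lnK ?ler_expR // posrE.
move=> /(_ (fun s t s1 s2 _ _ => H s t s1 s2)); rewrite rectintE.
have -> : (fun s => f (cexp (s +i* (2 * pi))%C)) = (fun s => f (cexp (s +i* 0)%C)).
  by apply/funext => s; rewrite /cexp /= cis2pi cis0.

rewrite [X in X - _](_ : _ = 'i%C * circ f r2); last first.
  rewrite addrAC subrr add0r; congr (_ * _); apply: eq_cint => t _ _.
  by rewrite /cexp /= lnK.
rewrite [X in _ - _ * X](_ : _ = circ f r1); last first.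
  by apply: eq_cint => t _ _; rewrite /cexp /= lnK.
rewrite -mulrBr => /eqP; rewrite mulf_eq0 -nm_eq0 nmi oner_eq0 /=.
by rewrite subr_eq0 => /eqP.
Qed.

End Circle.

(** * Power series of holomorphic functions *)

Section Series.
Variable R : realType.
Local Notation C := R[i].
Implicit Types (f g : C -> C) (z : C).

(** Compactness of [[0, 2 pi]] upgrades continuity at each point of the circle to an estimate
    uniform in the angle. *)
Lemma circ_continuous f (r0 e : R) : 0 <= r0 -> circ_con f r0 -> 0 < e ->
  exists2 d, 0 < d & forall r, 0 <= r -> `|r - r0| < d -> circ_con f r ->
    nm (circ f r - circ f r0) <= e.
Proof.
move=> r00 fc e0.
(* [nm_cint] over an interval of length [2 pi] multiplies a uniform bound by exactly [4 pi]. *)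
pose e1 := e / (4 * pi).
have p0 : 0 < 4 * pi :> R by rewrite mulr_gt0 // pi_gt0.
have e10 : 0 < e1 by rewrite divr_gt0.
have e20 : 0 < e1 / 2 by rewrite divr_gt0.
pose P (r t : R) := 0 <= r ->
  nm (f (r%:C%C * cis t) - f (r0%:C%C * cis t)) <= e1.
have : \forall r \near r0, `[0, 2 * pi] `<=` P r.
  have /compact_near_coveringP := @segment_compact R 0 (2 * pi).
  move=> /(_ R (nbhs r0) P); apply => t _.
  have [d d0 H] := fc _ (nm_rcis t r00) _ e20.
  have dr : 0 < d / (4 * (r0 + 1)) by rewrite divr_gt0 // mulr_gt0 // ltr_wpDl.
  exists (ball t (d / (4 * (r0 + 1))), ball r0 (d / 2)).
    by split; apply/nbhs_ballP; [exists (d / (4 * (r0 + 1)))|exists (d / 2)] => //=;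
      rewrite divr_gt0.
  move=> [t' r] /= [bt br] rr.
  rewrite /ball /= in bt br.
  have k0 : nm (r0%:C%C * cis t' - r0%:C%C * cis t) < d / 2.
    rewrite -mulrBr nmM nmR ger0_norm //.
    have := cis_lip t' t; rewrite distrC => k.
    have : r0 * nm (cis t' - cis t) <= r0 * (2 * `|t - t'|) by rewrite ler_wpM2l.
    move: bt; rewrite ltr_pdivlMr ?mulr_gt0 ?ltr_wpDl //.
    have := normr_ge0 (t - t'); move: (`|t - t'|) (nm _) => a b a0.
    by move=> a1; move/le_lt_trans; apply; nra.
  have k1 : nm (r0%:C%C * cis t' - r0%:C%C * cis t) < d.
    by apply: lt_le_trans k0 _; rewrite ler_pdivrMr // mulr_natr mulr2n lerDl ltW.
  have k2 : nm (r%:C%C * cis t' - r0%:C%C * cis t) < d.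
    apply: le_lt_trans (nm_tri (r0%:C%C * cis t') _ _) _.
    rewrite -mulrBl -rmorphB nmM nm_cis mulr1 nmR distrC.
    by rewrite [ltRHS](_ : _ = d / 2 + d / 2); [exact: ltrD|field].
  apply: le_trans (nm_tri (f (r0%:C%C * cis t)) _ _) _.
  rewrite (nmBC (f (r0%:C%C * cis t))).
  rewrite [leRHS](_ : _ = e1 / 2 + e1 / 2); last by field.
  by apply: lerD; exact: H.
move=> /nbhs_ballP[d /= d0 H]; exists d => // r rr rd fcr.
have Hr t : 0 <= t -> t <= 2 * pi ->
    nm (f (r%:C%C * cis t) - f (r0%:C%C * cis t)) <= e1.
  move=> t0 t1; apply: (H r _ t) => //.
    by rewrite /ball /= distrC.
  by rewrite /= in_itv /= t0.
have -> : circ f r - circ f r0 =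
    cint (fun t => f (r%:C%C * cis t) + (-1) * f (r0%:C%C * cis t)) 0 (2 * pi).
  have Zc : ccont_on (fun t => (-1) * f (r0%:C%C * cis t)) 0 (2 * pi).
    move=> t a b e' e'0.
    have [d' d'0 K] := ccont_on_circ (a := 0) (b := 2 * pi) r00 fc a b e'0.
    by exists d' => // y /K; rewrite -mulrBr nmM nmN nm1 mul1r.
  rewrite cintD //; last exact: ccont_on_circ.
  rewrite cintZ; last exact: ccont_on_circ.
  by rewrite mulN1r.
apply: le_trans (nm_cint (M := e1) _ _ _) _.
- by rewrite ltW // twopi_gt0.
- move=> t a b e' e'0.
  have e'2 : 0 < e' / 2 by rewrite divr_gt0.
  have [d1 d10 K1] := ccont_on_circ (a := 0) (b := 2 * pi) r00 fc a b e'2.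
  have [d2 d20 K2] := ccont_on_circ (a := 0) (b := 2 * pi) rr fcr a b e'2.
  exists (Num.min d1 d2); first by rewrite lt_min d10.
  move=> y; rewrite lt_min => /andP[/K1 h1 /K2 h2].
  rewrite (_ : _ - _ = (f (r%:C%C * cis y) - f (r%:C%C * cis t)) -
    (f (r0%:C%C * cis y) - f (r0%:C%C * cis t))); last by ring.
  apply: le_trans (nmB _ _) _.
  by rewrite [leRHS](_ : _ = e' / 2 + e' / 2); [exact: lerD|field].
- by move=> t t0 t1; rewrite mulN1r; exact: Hr.
have pn : pi != 0 :> R by rewrite gt_eqF ?pi_gt0.
rewrite subr0 /e1 le_eqVlt; apply/orP; left; apply/eqP.
by move: pn; move: pi => p pn; field.
Qed.

(** Convergence at a geometric rate: what partial sums of power series satisfy inside the disc, and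
    stable under linear combinations and index shifts. *)
Definition geo (u : C) (S : nat -> C) := exists M q : R,
  [/\ 0 <= M, 0 <= q, q < 1 & forall N, nm (u - S N) <= M * q ^+ N].

Definition ser (a : nat -> C) (r : R) f := forall z, nm z < r ->
  geo (f z) (fun N => \sum_(k < N) a k * z ^+ k).

Definition coef f (k : nat) (r : R) : C :=
  circ (fun z => f z * z^-1 ^+ k) r / (2 * pi)%:C%C.

Lemma twopiC_neq0 : (2 * pi)%:C%C != 0 :> C.
Proof. by rewrite (inj_eq (@complexI R)) gt_eqF // twopi_gt0. Qed.

Section Cauchy.
Variables (f : C -> C) (r : R).
Hypothesis fd : forall z, nm z < r -> cdiff f z.

Lemma cdiff_coef k z : z != 0 -> nm z < r -> cdiff (fun z => f z * z^-1 ^+ k) z.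
Proof.
move=> z0 zr; apply: cdiffM; first exact: fd.
by apply: cdiffX; exact: cdiffV.
Qed.

Lemma coef_indep k (r1 r2 : R) : 0 < r1 -> r1 < r -> 0 < r2 -> r2 < r ->
  coef f k r1 = coef f k r2.
Proof.
move=> r10 r1r r20 r2r; rewrite /coef.
wlog r12 : r1 r2 r10 r1r r20 r2r / r1 <= r2.
  move=> H; case/orP: (le_total r1 r2) => r12; first exact: H.
  by symmetry; exact: H.
rewrite (circ_annulus r10 r12) // => z h1 h2; apply: cdiff_coef.
  by rewrite -nm_gt0; exact: lt_le_trans h1.
exact: le_lt_trans r2r.
Qed.

Variable z0 : C.
Hypothesis z0r : nm z0 < r.

(** The difference quotient of [f] at [z0], times [z] to compensate for the angular measure of
    [circ]. At [z0] it is completed by the derivative, which gives continuity there but a priori no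
    derivative. *)
Lemma quotient_ex : exists q : C -> C,
  [/\ forall z, z != z0 -> q z = (f z - f z0) * (z - z0)^-1 * z,
      forall z, nm z < r -> ccon q z &
      forall z, nm z < r -> z != z0 -> cdiff q z].
Proof.
have [B HB] := fd z0r.
pose q0 z := if z == z0 then B else (f z - f z0) * (z - z0)^-1.
have q0d z : nm z < r -> z != z0 -> cdiff q0 z.
  move=> zr zz0; apply: (@cdiff_near _ (fun z => (f z + - f z0) * (z + - z0)^-1)).
    apply: cdiffM; first by apply: cdiffD; [exact: fd|exact: cdiff_cst].
    apply: (@cdiff_comp _ GRing.inv (fun z => z + - z0)).
      by apply: cdiffD; [exact: cdiff_id|exact: cdiff_cst].
    by apply: cdiffV; rewrite subr_eq0.
  exists (nm (z - z0)); first by rewrite nm_gt0 subr_eq0.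
  move=> w wz; rewrite /q0; case: eqP => // wz0.
  by move: wz; rewrite wz0 nmBC ltxx.
have q0c z : nm z < r -> ccon q0 z.
  move=> zr; case: (eqVneq z z0) => [->|zz0]; last exact/cdiff_ccon/q0d.
  move=> e e0; have [d d0 H] := HB _ e0; exists d => // w /H.
  rewrite /q0 eqxx; case: (eqVneq w z0) => [_ _|wz0]; first by rewrite subrr nm0 ltW.
  have wn : w - z0 != 0 by rewrite subr_eq0.
  rewrite -[X in X <= _ -> _](_ : nm ((f w - f z0) / (w - z0) - B) * nm (w - z0) = _).
    by rewrite ler_pM2r // nm_gt0.
  by rewrite -nmM mulrBl divfK.
exists (fun z => q0 z * z); split.
- by move=> z zz0; rewrite /q0 (negbTE zz0).
- by move=> z zr; apply: ccon_mul; [exact: q0c|exact/cdiff_ccon/cdiff_id].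
- by move=> z zr zz0; apply: cdiffM; [exact: q0d|exact: cdiff_id].
Qed.

(* The integrals over circles are constant on either side of [nm z0], vanish
   at radius 0, and vary continuously with the radius. *)
Lemma circ_quotient q : (forall z, nm z < r -> ccon q z) ->
  (forall z, nm z < r -> z != z0 -> cdiff q z) -> q 0 = 0 ->
  forall s, 0 <= s -> s < r -> circ q s = 0.
Proof.
move=> qc qd q00.
have cc s : s < r -> circ_con q s by move=> sr z zs; apply: qc; rewrite zs.
have r0 : 0 < r := le_lt_trans (nm_ge0 _) z0r.
have eq0 (z : C) : (forall e : R, 0 < e -> nm z <= e) -> z = 0.
  move=> H; apply/eqP; rewrite -nm_eq0 eq_le nm_ge0 andbT.
  by apply/ler_addgt0Pr => e e0; rewrite add0r; exact: H.
have at0 : circ q 0 = 0.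
  by rewrite -[RHS](mul0r (2 * pi)%:C%C) -(circ_cst 0 0); apply: eq_circ => // z /eqP;
    rewrite nm_eq0 => /eqP ->.
have below s : 0 <= s -> s < nm z0 -> circ q s = 0.
  rewrite le_eqVlt => /predU1P[<- _ //|s0 sz0].
  have sr := lt_trans sz0 z0r.
  apply: eq0 => e e0; have [d d0 H] := circ_continuous (lexx 0) (cc _ r0) e0.
  pose s' := Num.min s (d / 2).
  have s'0 : 0 < s' by rewrite lt_min s0 divr_gt0.
  have s's : s' <= s by rewrite ge_min lexx.
  have -> : circ q s = circ q s'.
    symmetry; apply: circ_annulus => // z h1 h2; apply: qd.
      exact: le_lt_trans sr.
    by apply: contraTneq (le_lt_trans h2 sz0) => ->; rewrite ltxx.
  have := H s' (ltW s'0); rewrite at0 !subr0; apply; last first.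
    by apply: cc; exact: le_lt_trans sr.
  rewrite gtr0_norm //; apply: (le_lt_trans (y := d / 2)).
    by rewrite ge_min lexx orbT.
  by rewrite ltr_pdivrMr // mulr_natr mulr2n ltrDl.
have atz : circ q (nm z0) = 0.
  have := nm_ge0 z0; rewrite le_eqVlt => /predU1P[<- //|n0].
  apply: eq0 => e e0; have [d d0 H] := circ_continuous (ltW n0) (cc _ z0r) e0.
  pose s := Num.max 0 (nm z0 - d / 2).
  have s0 : 0 <= s by rewrite le_max lexx.
  have sz : s < nm z0 by rewrite gt_max n0 ltrBlDr ltrDl divr_gt0.
  have := H s s0; rewrite (below s) // sub0r nmN; apply; last first.
    by apply: cc; exact: lt_trans z0r.
  rewrite ltr0_norm ?subr_lt0 // opprB ltrBlDr -ltrBlDl.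
  apply: (lt_le_trans (y := nm z0 - d / 2)); last by rewrite le_max lexx orbT.
  by rewrite ltrD2l ltrN2 ltr_pdivrMr // mulr_natr mulr2n ltrDl.
move=> s s0 sr; case: (ltgtP s (nm z0)) => [sz|zs|-> //]; first exact: below.
apply: eq0 => e e0; have [d d0 H] := circ_continuous (nm_ge0 z0) (cc _ z0r) e0.
pose s' := Num.min s (nm z0 + d / 2).
have s'z : nm z0 < s' by rewrite lt_min zs ltrDl divr_gt0.
have s's : s' <= s by rewrite ge_min lexx.
have s'0 : 0 < s' := le_lt_trans (nm_ge0 _) s'z.
have -> : circ q s = circ q s'.
  symmetry; apply: circ_annulus => // z h1 h2; apply: qd.
    exact: le_lt_trans sr.
  by apply: contraTneq (lt_le_trans s'z h1) => ->; rewrite ltxx.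
have := H s' (ltW s'0); rewrite atz !subr0; apply; last first.
  by apply: cc; exact: le_lt_trans sr.
rewrite gtr0_norm ?subr_gt0 // ltrBlDl; apply: (le_lt_trans (y := nm z0 + d / 2)).
  by rewrite ge_min lexx orbT.
by rewrite ltrD2l ltr_pdivrMr // mulr_natr mulr2n ltrDl.
Qed.

End Cauchy.

(** By homogeneity the integral at radius 2 is [2^-(k+1)] times the one at radius 1, whereas
    [circ_annulus] makes the two equal. *)
Lemma circ_negpow k (s : R) : 0 < s -> circ (fun z => z^-1 ^+ k.+1) s = 0.
Proof.
move=> s0.
have H (u : R) : 0 < u ->
    circ (fun z => z^-1 ^+ k.+1) u = u%:C%C^-1 ^+ k.+1 * circ (fun z => z^-1 ^+ k.+1) 1.
  move=> u0; rewrite /circ.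
  have cc : circ_con (fun z : C => z^-1 ^+ k.+1) 1.
    move=> z z1; apply: cdiff_ccon; apply: (@cdiffX _ GRing.inv); apply: cdiffV.
    by rewrite -nm_gt0 z1.
  rewrite -cintZ; last exact: (ccont_on_circ (ler01 : 0 <= 1 :> R) cc).
  by apply: eq_cint => t _ _; rewrite rmorph1 mul1r invfM exprMn.
suff c0 : circ (fun z : C => z^-1 ^+ k.+1) 1 = 0 by rewrite (H _ s0) c0 mulr0.
have := @circ_annulus R (fun z => z^-1 ^+ k.+1) 1 2 ltr01 (ler1n _ 2).
rewrite (H 2) //; set c := circ _ 1 => E.
have {E}: c = 2%:C%C^-1 ^+ k.+1 * c.
  apply: E => z z1 _; apply: (@cdiffX _ GRing.inv); apply: cdiffV.
  by rewrite -nm_gt0; exact: lt_le_trans z1.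
move/eqP; rewrite -subr_eq0 -{1}(mul1r c) -mulrBl mulf_eq0 subr_eq0 => /orP[|/eqP //].
move=> /eqP/(congr1 (@nm R)); rewrite nm1 nmX nmV nmR normr_nat => /esym/eqP.
by rewrite lt_eqF // exprn_ilt1 // ?invf_lt1 // ltr1n.
Qed.

Lemma circ_sum (F : nat -> C -> C) (s : R) N : 0 <= s ->
  (forall k z, nm z = s -> cdiff (F k) z) ->
  circ (fun z => \sum_(k < N) F k z) s = \sum_(k < N) circ (F k) s.
Proof.
move=> s0 Fd.
have Sd M z : nm z = s -> cdiff (fun z => \sum_(k < M) F k z) z.
  move=> zs; elim: M => [|M IH].
    by apply: (@cdiff_eq _ (fun=> 0)) (cdiff_cst _ _) => w; rewrite big_ord0.
  apply: (@cdiff_eq _ (fun z => \sum_(k < M) F k z + F M z)).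
    by move=> w; rewrite big_ord_recr.
  by apply: cdiffD => //; exact: Fd.
elim: N => [|N IH].
  rewrite big_ord0 (_ : (fun z => _) = fun=> 0) ?circ_cst ?mul0r //.
  by apply/funext => z; rewrite big_ord0.
rewrite big_ord_recr /= -IH -circD //.
- by apply: eq_circ => // z _; rewrite big_ord_recr.
- by move=> z zs; exact/cdiff_ccon/Sd.
- by move=> z zs; apply/cdiff_ccon/Fd.
Qed.

(** The vanishing of [circ q s] is Cauchy's integral formula in disguise: expanding
    [1 / (1 - z0 / z)] as a finite geometric sum yields the Taylor polynomial, [2 pi] times [f z0],
    and a remainder of ratio [nm z0 / s]. *)
Theorem hol_series f (r r1 : R) : (forall z, nm z < r -> cdiff f z) ->
  0 < r1 -> r1 < r -> ser (fun k => coef f k r1) r f.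
Proof.
move=> fd r10 r1r z0 z0r.
(* An intermediate circle that surrounds [z0] and stays in the disc. *)
pose s := (nm z0 + r) / 2.
have n0 := nm_ge0 z0.
have s0 : 0 < s by rewrite /s divr_gt0 // ltr_wpDl // (lt_trans r10).
have zs : nm z0 < s by rewrite /s ltr_pdivlMr // mulr_natr mulr2n ltrD2l.
have sr : s < r by rewrite /s ltr_pdivrMr // mulr_natr mulr2n ltrD2r.
have [q [qE qc qd]] := quotient_ex fd z0r.
(* The factor [z] in [q] gives this at once unless [z0 = 0]; then [q z = f z - f 0] away from 0, and
   continuity of [q] decides the value. *)
have q00 : q 0 = 0.
  have qm : ccon (fun z => q z * (z - z0)) 0.
    apply: ccon_mul; first by apply: qc; rewrite nm0 (lt_trans r10).
    by apply: cdiff_ccon; apply: cdiffD; [exact: cdiff_id|exact: cdiff_cst].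
  case: (eqVneq z0 0) => [z00|zn0]; last by rewrite qE 1?eq_sym // mulr0.
  have Q : ccon q 0 by apply: qc; rewrite nm0 (lt_trans r10).
  have F : ccon f 0 by apply: cdiff_ccon; apply: fd; rewrite nm0 (lt_trans r10).
  apply/eqP; rewrite -nm_eq0 eq_le nm_ge0 andbT.
  apply/ler_addgt0Pr => e e0; rewrite add0r.
  have e20 : 0 < e / 2 by rewrite divr_gt0.
  have [d1 d10 H1] := Q _ e20; have [d2 d20 H2] := F _ e20.
  pose h : R := Num.min d1 d2 / 2.
  have m0 : 0 < Num.min d1 d2 by rewrite lt_min d10.
  have h0 : 0 < h by rewrite divr_gt0.
  have hd : h < Num.min d1 d2 by rewrite ltr_pdivrMr // mulr_natr mulr2n ltrDl.
  have nh : nm (h%:C%C - 0) = h by rewrite subr0 nmR gtr0_norm.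
  have hn0 : h%:C%C != 0 :> C by rewrite -nm_gt0 -[X in nm X]subr0 nh.
  have k1 := H1 h%:C%C; have k2 := H2 h%:C%C; rewrite nh in k1 k2.
  have {}k1 := k1 (lt_le_trans hd _); have {}k2 := k2 (lt_le_trans hd _).
  have := k1 (ltac:(by rewrite ge_min lexx)).
  have := k2 (ltac:(by rewrite ge_min lexx orbT)).
  rewrite qE z00 // subr0 mulfVK //.
  move: (f h%:C%C - f 0) (q 0) => a b; have := nm_tri a b 0.
  by rewrite !subr0 nmBC; move: (nm _) (nm _) (nm _) => *; lra.
have Q0 := circ_quotient z0r qc qd q00 (ltW s0) sr.
have scon : circ_con q s by move=> z zS; apply: qc; rewrite zS.
have [M M0 HM] := circ_bounded (ltW s0) scon.
pose K := 2 * M * (2 * pi) / (2 * pi).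
exists (nm (f z0) + K), (nm z0 / s).
have K0 : 0 <= K by rewrite /K !(mulr_ge0, invr_ge0) // ?pi_ge0.
split.
- by rewrite addr_ge0 ?nm_ge0.
- by rewrite divr_ge0 ?nm_ge0 ?ltW.
- by rewrite ltr_pdivrMr // mul1r.
case=> [|N]; first by rewrite big_ord0 subr0 expr0 mulr1 lerDl.
have znz z : nm z = s -> z != 0 by move=> zS; rewrite -nm_gt0 zS.
have znz0 z : nm z = s -> z != z0.
  by move=> zS; apply: contraTneq zs => <-; rewrite zS ltxx.
have powd k z : nm z = s -> cdiff (fun z => z^-1 ^+ k) z.
  by move=> zS; apply: (@cdiffX _ GRing.inv); apply: cdiffV; exact: znz.
pose F k z := z0 ^+ k * (f z * z^-1 ^+ k).
pose G k z := z0 ^+ k * (z^-1 ^+ k).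
have Fd k z : nm z = s -> cdiff (F k) z.
  move=> zS; apply: cdiffM; first exact: cdiff_cst.
  by apply: cdiff_coef => //; [exact: fd|exact: znz|rewrite zS].
have Gd k z : nm z = s -> cdiff (G k) z.
  by move=> zS; apply: cdiffM; [exact: cdiff_cst|exact: powd].
have SFd z : nm z = s -> cdiff (fun z => \sum_(k < N.+1) F k z) z.
  move=> zS; elim: N.+1 => [|m IH].
    by apply: (@cdiff_eq _ (fun=> 0)) (cdiff_cst _ _) => w; rewrite big_ord0.
  apply: (@cdiff_eq _ (fun z => \sum_(k < m) F k z + F m z)).
    by move=> w; rewrite big_ord_recr.
  by apply: cdiffD => //; exact: Fd.
have SGd z : nm z = s -> cdiff (fun z => \sum_(k < N.+1) G k z) z.
  move=> zS; elim: N.+1 => [|m IH].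
    by apply: (@cdiff_eq _ (fun=> 0)) (cdiff_cst _ _) => w; rewrite big_ord0.
  apply: (@cdiff_eq _ (fun z => \sum_(k < m) G k z + G m z)).
    by move=> w; rewrite big_ord_recr.
  by apply: cdiffD => //; exact: Gd.
have qcc : circ_con (fun z => z^-1 ^+ N.+1 * q z) s.
  move=> z zS; apply: ccon_mul; last by apply: scon.
  by apply/cdiff_ccon/powd.
(* On the circle [q = (f z - f z0) / (1 - z0 / z)], and cutting the geometric series after the power
   [N] leaves [(z0 / z)^(N+1)] times [q] itself. *)
have E : circ q s = circ (fun z => \sum_(k < N.+1) F k z) s +
   ((- f z0) * circ (fun z => \sum_(k < N.+1) G k z) s +
    z0 ^+ N.+1 * circ (fun z => z^-1 ^+ N.+1 * q z) s).
  have s0' := ltW s0.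
  have c1 : circ_con (fun z => - f z0 * (\sum_(k < N.+1) G k z)) s.
    move=> z zS; apply/cdiff_ccon/cdiffM; first exact: cdiff_cst.
    exact: SGd.
  have c2 : circ_con (fun z => z0 ^+ N.+1 * (z^-1 ^+ N.+1 * q z)) s.
    move=> z zS; apply: ccon_mul; last exact: qcc.
    exact/cdiff_ccon/cdiff_cst.
  rewrite -(circZ (- f z0) s0'); last by move=> z zS; apply/cdiff_ccon/SGd.
  rewrite -(circZ (z0 ^+ N.+1) s0') // -(circD s0' c1 c2) -circD //.
  - apply: eq_circ => // z zS.
    have zn := znz _ zS; have zn0 := znz0 _ zS.
    have zz0 : z - z0 != 0 by rewrite subr_eq0.
    have SF : \sum_(k < N.+1) F k z = f z * \sum_(k < N.+1) G k z.
      by rewrite mulr_sumr; apply: eq_bigr => k _; rewrite /F /G; ring.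
    have SG : \sum_(k < N.+1) G k z = (1 - (z0 / z) ^+ N.+1) / (1 - z0 / z).
      have w1 : 1 - z0 / z != 0.
        rewrite subr_eq0 eq_sym; apply: contra zn0 => /eqP w1.
        by rewrite -(divfK zn z0) w1 mul1r.
      apply: (canRL (mulfK w1)).
      rewrite (eq_bigr (fun k : 'I_N.+1 => (z0 / z) ^+ k)).
        by rewrite mulrC -[1 - _ / _]opprB mulNr -subrX1 opprB.
      by move=> k _; rewrite /G exprMn.
    rewrite SF SG (qE z) // exprMn.
    have w1 : z - z0 != 0 by [].
    field; rewrite zn zz0.
    by [].
  - by move=> z zS; apply/cdiff_ccon/SFd.
  - move=> z zS; apply: ccon_near (_ : ccon (fun z => (- f z0) * (\sum_(k < N.+1) G k z) +
      z0 ^+ N.+1 * (z^-1 ^+ N.+1 * q z)) z) _; last by exists 1.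
    apply: cdiff_ccon; apply: cdiffD.
      by apply: cdiffM; [exact: cdiff_cst|exact: SGd].
    apply: cdiffM; first exact: cdiff_cst.
    apply: cdiffM; first exact: powd.
    by apply: qd; [rewrite zS|exact: znz0].
have cF k : circ (F k) s = z0 ^+ k * (2 * pi)%:C%C * coef f k r1.
  rewrite (coef_indep fd k r10 r1r s0 sr) /coef /F circZ ?ltW //.
    by rewrite -mulrA (mulrC (2 * pi)%:C%C) divfK ?twopiC_neq0.
  move=> z zS; apply: cdiff_ccon; apply: (cdiff_coef fd); first exact: znz.
  by rewrite zS.
have cG : circ (fun z => \sum_(k < N.+1) G k z) s = (2 * pi)%:C%C.
  rewrite circ_sum ?ltW // big_ord_recl /= big1 ?addr0.
    by rewrite -[RHS]mul1r -(circ_cst 1 s); apply: eq_circ => [|z _]; rewrite ?ltW // /G !expr0 mulr1.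
  move=> k _; rewrite /G circZ ?ltW //; last by move=> z zS; apply/cdiff_ccon/powd.
  by rewrite circ_negpow // mulr0.
rewrite Q0 circ_sum ?ltW // cG in E.
have {E} E : f z0 - \sum_(k < N.+1) coef f k r1 * z0 ^+ k =
  z0 ^+ N.+1 * circ (fun z => z^-1 ^+ N.+1 * q z) s / (2 * pi)%:C%C.
  apply: (mulIf twopiC_neq0); rewrite divfK ?twopiC_neq0 // mulrBl mulr_suml.
  rewrite (eq_bigr (fun k : 'I_N.+1 => circ (F k) s)).
    by move/eqP: E; rewrite addrA eq_sym addr_eq0 => /eqP E; rewrite -[RHS]opprK -E; ring.
  by move=> k _; rewrite cF; ring.
rewrite E !nmM nmV nmX nmR gtr0_norm ?twopi_gt0 //.
have B : nm (circ (fun z => z^-1 ^+ N.+1 * q z) s) <= 2 * (s^-1 ^+ N.+1 * M) * (2 * pi).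
  apply: nm_circ => //; first exact: ltW.
  move=> z zS; rewrite nmM nmX nmV zS ler_wpM2l ?HM //.
  by rewrite exprn_ge0 // invr_ge0 ltW.
rewrite exprMn.
apply: (@le_trans _ _ (nm z0 ^+ N.+1 * (2 * (s^-1 ^+ N.+1 * M) * (2 * pi)) / (2 * pi))).
  by rewrite ler_pM2r ?invr_gt0 ?twopi_gt0 // ler_wpM2l // exprn_ge0.
rewrite (_ : _ / _ = K * (nm z0 ^+ N.+1 * s^-1 ^+ N.+1)); last by rewrite /K; ring.
rewrite ler_wpM2r ?lerDr ?nm_ge0 // mulr_ge0 ?exprn_ge0 ?nm_ge0 //.
by rewrite invr_ge0 ltW.
Qed.

End Series.

(** * Uniqueness of power series, and rotation-invariant functions of two variables *)

#[local] Opaque circ.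

Section SeriesTheory.
Variable R : realType.
Local Notation C := R[i].
Implicit Types (f g : C -> C) (z u v : C) (S T : nat -> C) (a b : nat -> C).

Lemma geom_small (M q e : R) : 0 <= q -> q < 1 -> 0 < e ->
  exists N0, forall N, (N0 <= N)%N -> M * q ^+ N <= e.
Proof.
move=> q0 q1 e0.
have K0 : 0 < e / (`|M| + 1) by rewrite divr_gt0 // ltr_wpDl.
have : `|q| < 1 by rewrite ger0_norm.
move=> /cvg_expr /cvgrPdist_le /(_ _ K0) [N0 _ H]; exists N0 => N NN.
have := H N NN; rewrite sub0r normrN ger0_norm ?exprn_ge0 //.
rewrite ler_pdivlMr ?ltr_wpDl // => K.
apply: le_trans K; rewrite mulrC ler_wpM2l ?exprn_ge0 //.
by apply: le_trans (ler_norm M) _; rewrite lerDl.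
Qed.

Lemma geo_small u S e : geo u S -> 0 < e ->
  exists N0, forall N, (N0 <= N)%N -> nm (u - S N) <= e.
Proof.
move=> [M [q [M0 q0 q1 H]]] e0; have [N0 HN] := geom_small M q0 q1 e0.
by exists N0 => N /HN; exact: le_trans (H N).
Qed.

Lemma nm_small_eq0 z : (forall e : R, 0 < e -> nm z <= e) -> z = 0.
Proof.
move=> H; apply/eqP; rewrite -nm_eq0 eq_le nm_ge0 andbT.
by apply/ler_addgt0Pr => e e0; rewrite add0r; exact: H.
Qed.

Lemma geo_unique u v S : geo u S -> geo v S -> u = v.
Proof.
move=> gu gv; apply/eqP; rewrite -subr_eq0; apply/eqP; apply: nm_small_eq0 => e e0.
have e20 : 0 < e / 2 by rewrite divr_gt0.
have [N1 H1] := geo_small gu e20; have [N2 H2] := geo_small gv e20.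
apply: le_trans (nm_tri (S (maxn N1 N2)) _ _) _; rewrite (nmBC (S _)).
have := H1 _ (leq_maxl N1 N2); have := H2 _ (leq_maxr N1 N2).
by move: (nm _) (nm _) => *; lra.
Qed.

Lemma eq_geo u S T : S =1 T -> geo u S -> geo u T.
Proof. by move=> /funext ->. Qed.

Lemma geoZ u S (c : C) : geo u S -> geo (c * u) (fun N => c * S N).
Proof.
move=> [M [q [M0 q0 q1 H]]]; exists (nm c * M), q; split => //.
  by rewrite mulr_ge0 ?nm_ge0.
by move=> N; rewrite -mulrBr nmM -mulrA ler_wpM2l ?nm_ge0.
Qed.

Lemma geoD u v S T : geo u S -> geo v T -> geo (u + v) (fun N => S N + T N).
Proof.
move=> [M [q [M0 q0 q1 H]]] [M' [q' [M'0 q'0 q'1 H']]].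
exists (M + M'), (Num.max q q'); split.
- by rewrite addr_ge0.
- by rewrite le_max q0.
- by rewrite gt_max q1.
move=> N; rewrite opprD addrACA mulrDl; apply: le_trans (nmD _ _) _; apply: lerD.
  by apply: le_trans (H N) _; rewrite ler_wpM2l // lerXn2r ?nnegrE ?le_max ?q0 ?lexx.
by apply: le_trans (H' N) _; rewrite ler_wpM2l // lerXn2r ?nnegrE ?le_max ?q0 ?q'0 ?lexx ?orbT.
Qed.

Lemma geo_shift u S : geo u S -> geo u (fun N => S N.+1).
Proof.
move=> [M [q [M0 q0 q1 H]]]; exists M, q; split => // N.
apply: le_trans (H _) _; rewrite ler_wpM2l // exprS ler_piMl ?exprn_ge0 //.
exact: ltW.
Qed.

(** Raising the ratio to at least [1/2] makes the index shift cost a factor 2, also when the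
    original ratio is 0. *)
Lemma geo_shiftV u S : geo u (fun N => S N.+1) -> geo u S.
Proof.
move=> [M [q [M0 q0 q1 H]]]; exists (nm (u - S 0%N) + 2 * M), (Num.max q (2^-1)); split => //.
- by rewrite addr_ge0 ?nm_ge0 ?mulr_ge0.
- by rewrite le_max q0.
- by rewrite gt_max q1 invf_lt1 // ltr1n.
case=> [|N]; first by rewrite expr0 mulr1 lerDl mulr_ge0.
apply: le_trans (H N) _; rewrite mulrDl.
set m := Num.max _ _.
have m2 : 2^-1 <= m by rewrite le_max lexx orbT.
have mq : q <= m by rewrite le_max lexx.
have m0 : 0 <= m by apply: le_trans m2; rewrite invr_ge0.
have qN : q ^+ N <= m ^+ N by rewrite lerXn2r ?nnegrE.
have : M * q ^+ N <= 2 * M * m ^+ N.+1.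
  rewrite exprS; have mN : 0 <= m ^+ N by rewrite exprn_ge0.
  have m21 : 1 <= 2 * m by lra.
  apply: (@le_trans _ _ (M * m ^+ N)); first by rewrite ler_wpM2l.
  rewrite (_ : 2 * M * (m * m ^+ N) = (2 * m) * (M * m ^+ N)); last by ring.
  by rewrite ler_peMl // mulr_ge0.
move/le_trans; apply; rewrite lerDr mulr_ge0 ?nm_ge0 ?exprn_ge0 //.
Qed.

(** Taylor remainder at 0. Subtracting consecutive partial sums at [rho = r / 2] bounds
    [nm (a N) * rho ^+ N] by [2 M]; for [nm z <= rho / 2] the tail is dominated by a geometric
    series of ratio [1/2]. *)
Lemma ser_tail a (r : R) f m : 0 < r -> ser a r f ->
  exists K d : R, [/\ 0 <= K, 0 < d & forall z, nm z <= d ->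
    nm (f z - \sum_(k < m) a k * z ^+ k) <= K * nm z ^+ m].
Proof.
move=> r0 af; pose rho : R := r / 2.
have rho0 : 0 < rho by rewrite divr_gt0.
have rr : rho < r by rewrite ltr_pdivrMr // mulr_natr mulr2n ltrDl.
have nrho : nm rho%:C%C = rho by rewrite nmR gtr0_norm.
have [M [q [M0 q0 q1 H]]] := af rho%:C%C (ltac:(by rewrite nrho)).
have aM N : nm (a N) * rho ^+ N <= 2 * M.
  have -> : nm (a N) * rho ^+ N = nm (a N * rho%:C%C ^+ N) by rewrite nmM nmX nrho.
  have -> : a N * rho%:C%C ^+ N = (f rho%:C%C - \sum_(k < N) a k * rho%:C%C ^+ k) -
     (f rho%:C%C - \sum_(k < N.+1) a k * rho%:C%C ^+ k).
    by rewrite big_ord_recr /=; ring.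
  apply: le_trans (nmB _ _) _; rewrite mulr_natl mulr2n.
  have HM k : nm (f rho%:C%C - \sum_(j < k) a j * rho%:C%C ^+ j) <= M.
    by apply: le_trans (H k) _; rewrite ler_piMr // exprn_ile1 // ltW.
  by apply: lerD; exact: HM.
exists (4 * M / rho ^+ m), (rho / 2); split.
- by rewrite divr_ge0 ?mulr_ge0 ?exprn_ge0 // ltW.
- by rewrite divr_gt0.
move=> z zd; pose x := nm z / rho.
have x0 : 0 <= x by rewrite divr_ge0 ?nm_ge0 ?ltW.
have x2 : x <= 2^-1 by rewrite /x ler_pdivrMr // mulrC.
have zr : nm z < r.
  apply: le_lt_trans zd _; apply: lt_trans rr.
  by rewrite ltr_pdivrMr // mulr_natr mulr2n ltrDl.
have step j : nm (\sum_(k < m + j) a k * z ^+ k - \sum_(k < m) a k * z ^+ k) <=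
    4 * M * x ^+ m * (1 - 2^-1 ^+ j).
  elim: j => [|j IH]; first by rewrite addn0 !subrr nm0 mulr0.
  rewrite addnS big_ord_recr /= addrAC; apply: le_trans (nmD _ _) _.
  have : nm (a (m + j)%N * z ^+ (m + j)) <= 2 * M * x ^+ m * 2^-1 ^+ j.
    have -> : nm (a (m + j)%N * z ^+ (m + j)) = nm (a (m + j)%N) * rho ^+ (m + j) * x ^+ (m + j).
      by rewrite nmM nmX -mulrA -exprMn /x mulrC [rho * _]mulrC divfK ?gt_eqF // mulrC.
    apply: (@le_trans _ _ (2 * M * x ^+ (m + j))).
      by rewrite ler_wpM2r ?aM // exprn_ge0.
    rewrite exprD mulrA ler_wpM2l //.
      by rewrite !mulr_ge0 ?exprn_ge0.
    by rewrite lerXn2r ?nnegrE // invr_ge0.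
  move: IH; rewrite [2^-1 ^+ j.+1]exprS.
  move: (nm _) (nm _) (x ^+ m) (2^-1 ^+ j) => *; lra.
rewrite (_ : 4 * M / rho ^+ m * nm z ^+ m = 4 * M * x ^+ m); last first.
  by rewrite /x (expr_div_n (nm z) rho m) -[LHS]mulrA (mulrC (_ ^-1)).
apply/ler_addgt0Pr => e e0.
have [N0 HN] := geo_small (af z zr) e0.
apply: le_trans (nm_tri (\sum_(k < m + N0) a k * z ^+ k) _ _) _.
rewrite [leRHS]addrC; apply: lerD; first by apply: HN; rewrite leq_addl.
apply: le_trans (step N0) _; rewrite ler_piMr //.
  by rewrite !mulr_ge0 ?exprn_ge0.
Qed.

Lemma ser_unique a b (r : R) f g : 0 < r -> ser a r f -> ser b r g ->
  (forall z, nm z < r -> f z = g z) -> forall k, a k = b k.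
Proof.
move=> r0 af bg fg k; elim/ltn_ind: k => k IH.
have [K1 [d1 [K10 d10 H1]]] := ser_tail k.+1 r0 af.
have [K2 [d2 [K20 d20 H2]]] := ser_tail k.+1 r0 bg.
apply/eqP; rewrite -subr_eq0; apply/eqP; apply: nm_small_eq0 => e e0.
pose t := Num.min (Num.min d1 d2) (Num.min (r / 2) (e / (K1 + K2 + 1))).
have K0 : 0 < K1 + K2 + 1 by rewrite ltr_wpDl // addr_ge0.
have t0 : 0 < t by rewrite !lt_min d10 d20 !divr_gt0.
have td1 : t <= d1 by rewrite !ge_min lexx.
have td2 : t <= d2 by rewrite !ge_min lexx !orbT.
have tr : t <= r / 2 by rewrite !ge_min lexx !orbT.
have te : t <= e / (K1 + K2 + 1) by rewrite !ge_min lexx !orbT.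
have nt : nm t%:C%C = t by rewrite nmR gtr0_norm.
have {}H1 := H1 t%:C%C; have {}H2 := H2 t%:C%C; rewrite nt in H1 H2.
have {}H1 := H1 td1; have {}H2 := H2 td2.
have E : f t%:C%C = g t%:C%C.
  apply: fg; rewrite nt; apply: le_lt_trans tr _.
  by rewrite ltr_pdivrMr // mulr_natr mulr2n ltrDl.
have D : (a k - b k) * t%:C%C ^+ k =
   (g t%:C%C - \sum_(i < k.+1) b i * t%:C%C ^+ i) -
   (f t%:C%C - \sum_(i < k.+1) a i * t%:C%C ^+ i).
  have S : \sum_(i < k) a i * t%:C%C ^+ i = \sum_(i < k) b i * t%:C%C ^+ i.
    by apply: eq_bigr => i _; rewrite IH.
  by rewrite E !big_ord_recr /= S; ring.
have tk0 : 0 < t ^+ k by rewrite exprn_gt0.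
rewrite -(ler_pM2r tk0) -{1}nt -nmX -nmM D; apply: le_trans (nmB _ _) _.
apply: le_trans (lerD H2 H1) _.
rewrite (_ : K2 * _ + _ = (K1 + K2) * t * t ^+ k); last by rewrite exprS; ring.
rewrite ler_wpM2r //; first exact: ltW.
by move: te; rewrite ler_pdivlMr // => te; nra.
Qed.

Lemma ser_eq a (r : R) f g : (forall z, nm z < r -> f z = g z) ->
  ser a r f -> ser a r g.
Proof. by move=> fg H z zr; rewrite -fg //; exact: H. Qed.

Lemma eq_ser a b (r : R) f : a =1 b -> ser a r f -> ser b r f.
Proof. by move=> /funext ->. Qed.

Lemma serZ a (r : R) f c : ser a r f -> ser (fun k => c * a k) r (fun z => c * f z).
Proof.
move=> H z zr; apply: eq_geo (geoZ c (H z zr)) => N.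
by rewrite mulr_sumr; apply: eq_bigr => k _; rewrite mulrA.
Qed.

Lemma ser_dil a (r r' : R) f c : ser a r f ->
  (forall z, nm z < r' -> nm (c * z) < r) ->
  ser (fun k => a k * c ^+ k) r' (fun z => f (c * z)).
Proof.
move=> H cr z zr; apply: eq_geo (H _ (cr _ zr)) => N.
by apply: eq_bigr => k _; rewrite exprMn mulrA.
Qed.

Lemma ser0 a (r : R) f : 0 < r -> ser a r f -> f 0 = a 0%N.
Proof.
move=> r0 H; apply: (@geo_unique _ _ (fun N => \sum_(k < N) a k * 0 ^+ k)).
  by apply: H; rewrite nm0.
apply: geo_shiftV; exists 0, 0; split => // N.
rewrite big_ord_recl expr0 mulr1 big1 ?addr0 ?subrr ?nm0 ?mul0r //.
by move=> i _; rewrite expr0n /= mulr0.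
Qed.

(** For [m < n] the witness is the [(n - m)]-th root [exp (i pi / (n - m))] of -1. *)
Lemma exists_unit_neq m n : m <> n -> exists2 s : C, nm s = 1 & s ^+ m != s ^+ n.
Proof.
wlog mn : m n / (m < n)%N.
  move=> H /eqP; rewrite neq_ltn => /orP[] mn.
    by apply: H => // /eqP; rewrite ltn_eqF.
  by have [|s s1 sn] := H n m mn _; [move/eqP; rewrite ltn_eqF|exists s; rewrite // eq_sym].
move=> _; have k0 : (0 < n - m)%N by rewrite subn_gt0.
rewrite -(subnKC (ltnW mn)); move: k0.
move: (n - m)%N => k k0; exists (cis (pi / k%:R)); first exact: nm_cis.
rewrite exprD -{1}(mulr1 (_ ^+ m)) (inj_eq (mulfI _)) ?expf_neq0 ?cis_neq0 //.
rewrite -cisMn -(mulr_natr (_ / _)) divfK ?cispi; last by rewrite pnatr_eq0 -lt0n.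
by rewrite eq_sym eqNr oner_eq0.
Qed.

(** Comparing coefficients gives [s^(j+l) a l = s^k a l] for all unit [s]. Two exponents are used so
    that a covariance of negative weight ([k < j]), which kills the whole series, fits the same
    statement. *)
Lemma ser_rot a (r : R) f j k : 0 < r -> ser a r f ->
  (forall s z, nm s = 1 -> nm z < r -> s ^+ j * f (s * z) = s ^+ k * f z) ->
  forall l, (j + l)%N <> k -> a l = 0.
Proof.
move=> r0 af H l /exists_unit_neq[s s1 sn].
have S1 : ser (fun l => s ^+ j * (a l * s ^+ l)) r (fun z => s ^+ j * f (s * z)).
  by apply: serZ; apply: ser_dil af _ => z; rewrite nmM s1 mul1r.
have S2 : ser (fun l => s ^+ k * a l) r (fun z => s ^+ k * f z) by exact: serZ.
have /eqP := ser_unique r0 S1 S2 (fun z => H s z s1) l.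
rewrite (mulrC (a l)) mulrA -exprD -subr_eq0 -mulrBl mulf_eq0 subr_eq0.
by rewrite (negbTE sn) => /eqP.
Qed.

Lemma ser_single a (r : R) f k : ser a r f -> (forall l, l <> k -> a l = 0) ->
  forall z, nm z < r -> f z = a k * z ^+ k.
Proof.
move=> H ak z zr; apply: geo_unique (H z zr) _.
have : geo (a k * z ^+ k) (fun N => \sum_(j < N + k.+1) a j * z ^+ j).
  exists 0, 0; split => // N; rewrite (bigD1 (Ordinal (_ : (k < N + k.+1)%N))) //=.
    by rewrite addnS ltnS leq_addl.
  move=> kN; rewrite big1 ?addr0 ?subrr ?nm0 ?mul0r // => i ik.
  by rewrite ak ?mul0r // => E; move: ik; rewrite -val_eqE /= E eqxx.
elim: k.+1 => [|m IH]; first by apply: eq_geo => N; rewrite addn0.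
move=> G; apply: IH; apply: geo_shiftV; apply: eq_geo G => N.
by rewrite addnS addSn.
Qed.

Lemma ser_zero a (r : R) f : ser a r f -> (forall l, a l = 0) ->
  forall z, nm z < r -> f z = 0.
Proof.
by move=> H a0 z zr; rewrite (@ser_single a r f 0%N) // a0 mul0r.
Qed.

Section TwoVariables.
Variable psi : C -> C -> C.
Hypothesis psi1 : forall v z, nm v < 1 -> nm z < 1 -> cdiff (psi^~ v) z.
Hypothesis psi2 : forall z v, nm z < 1 -> nm v < 1 -> cdiff (psi z) v.
Hypothesis psi_rot : forall s z v, nm s = 1 -> nm z < 1 -> nm v < 1 ->
  psi (s * z) v = psi z (s * v).

(** For [nm w = 1] the values [psi (w z) v] and [psi z (w v)] agree, so both have the same Cauchy
    coefficients in [w]. This equates [c v l * z^l] with [d z l * v^l]; fixing [v = 1/2] makes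
    [d z l] a multiple of [z^l]. *)
Lemma two_var : exists a F, ser a 1 F /\
  forall z v, nm z < 1 -> nm v < 1 -> psi z v = F (z * v).
Proof.
have h1 : 2^-1 < 1 :> R by rewrite invf_lt1 // ltr1n.
have h0 : 0 < 2^-1 :> R by rewrite invr_gt0.
pose c v l := coef (psi^~ v) l 2^-1; pose d z l := coef (psi z) l 2^-1.
have cs v : nm v < 1 -> ser (c v) 1 (psi^~ v).
  by move=> v1; apply: hol_series => // z; exact: psi1.
have ds z : nm z < 1 -> ser (d z) 1 (psi z).
  by move=> z1; apply: hol_series => // v; exact: psi2.
have cd z v l : nm z < 1 -> nm v < 1 -> c v l * z ^+ l = d z l * v ^+ l.
  move=> z1 v1; pose m := Num.max (nm z) (nm v).
  have m1 : m < 1 by rewrite gt_max z1.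
  have zm : nm z <= m by rewrite le_max lexx.
  have vm : nm v <= m by rewrite le_max lexx orbT.
  have m0 : 0 <= m := le_trans (nm_ge0 _) zm.
  have m1' : 0 < 1 + m by rewrite ltr_pwDl.
  (* Larger than 1 yet with [r m < 1], so that the unit circle lies inside the disc of analyticity
     in [w]. *)
  pose r := 2 / (1 + m).
  have r1 : 1 < r by rewrite /r ltr_pdivlMr // mul1r; lra.
  have rm (w x : C) : nm x <= m -> nm w < r -> nm (w * x) < 1.
    move=> xm wr; rewrite nmM; apply: (@le_lt_trans _ _ (r * m)).
      by rewrite ler_pM ?nm_ge0 // ltW.
    by rewrite /r mulrAC ltr_pdivrMr //; lra.
  have Zd (x w : C) : cdiff (fun w => w * x) w.
    by apply: cdiffM; [exact: cdiff_id|exact: cdiff_cst].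
  have S1 : ser (fun l => coef (fun w => psi (w * z) v) l 1) r (fun w => psi (w * z) v).
    apply: hol_series => // w wr.
    apply: (@cdiff_comp _ (psi^~ v) (fun w => w * z)); first exact: Zd.
    by apply: psi1 => //; exact: rm.
  have S2 : ser (fun l => coef (fun w => psi z (w * v)) l 1) r (fun w => psi z (w * v)).
    apply: hol_series => // w wr.
    apply: (@cdiff_comp _ (psi z) (fun w => w * v)); first exact: Zd.
    by apply: psi2 => //; exact: rm.
  have r0 : 0 < r := lt_trans ltr01 r1.
  have T1 : ser (fun l => c v l * z ^+ l) r (fun w => psi (w * z) v).
    apply: (@ser_eq _ _ (fun w => psi (z * w) v)); first by move=> w _; rewrite mulrC.
    by apply: (ser_dil (cs v v1)) => w wr; rewrite mulrC; exact: rm.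
  have T2 : ser (fun l => d z l * v ^+ l) r (fun w => psi z (w * v)).
    apply: (@ser_eq _ _ (fun w => psi z (v * w))); first by move=> w _; rewrite mulrC.
    by apply: (ser_dil (ds z z1)) => w wr; rewrite mulrC; exact: rm.
  rewrite (ser_unique r0 T1 S1 _ l) // (ser_unique r0 T2 S2 _ l) //.
  congr (_ / _); apply: eq_circ => // w w1; congr (_ * _).
  by rewrite psi_rot.
pose h : C := (2^-1)%:C%C.
have nh : nm h < 1 by rewrite nmR gtr0_norm.
have hn0 : h != 0 by rewrite -nm_gt0 nmR normr_gt0 gt_eqF.
pose a l := c h l * h ^- l.
have da z l : nm z < 1 -> d z l = a l * z ^+ l.
  move=> z1; apply: (mulIf (expf_neq0 l hn0)); rewrite -cd // /a [RHS]mulrAC divfK //.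
  by rewrite expf_neq0.
have ga z v : nm z < 1 -> nm v < 1 ->
    geo (psi z v) (fun N => \sum_(k < N) a k * (z * v) ^+ k).
  move=> z1 v1; apply: eq_geo (ds z z1 v v1) => N.
  by apply: eq_bigr => k _; rewrite da // exprMn mulrA.
(* With [z = v] a square root of [x], every point of the disc is a product [z v]; thus the series
   converges on the whole disc and [F] may be chosen as its sum. *)
have split x : nm x < 1 -> exists zv : C * C, [/\ nm zv.1 < 1, nm zv.2 < 1 & zv.1 * zv.2 = x].
  move=> x1; pose y := sqrtC x; have y2 : y * y = x by rewrite -expr2 sqrtCK.
  have y1 : nm y < 1.
    rewrite -(@ltr_pXn2r _ 2) ?nnegrE ?nm_ge0 ?ler01 // expr1n.
    by rewrite -nmX expr2 y2.
  by exists (y, y).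
have [F HF] : exists F : C -> C, forall x, nm x < 1 -> geo (F x) (fun N => \sum_(k < N) a k * x ^+ k).
  pose F x := xget 0 [set u | geo u (fun N => \sum_(k < N) a k * x ^+ k)].
  exists F => x /split[[z v] /= [z1 v1 <-]].
  by apply: (@xgetPex _ 0 [set u | geo u _]); exists (psi z v); exact: ga.
exists a, F; split => // z v z1 v1; apply: geo_unique (ga z v z1 v1) (HF _ _).
by rewrite nmM mulr_ilt1 ?nm_ge0.
Qed.

End TwoVariables.

End SeriesTheory.

(** * Unitary matrices *)

Section Unitary.
Variable R : realType.
Local Notation C := R[i].

Lemma mxstarE m n (A : 'M[C]_(m, n)) i j : mxstar A i j = (A j i)^*.
Proof. by rewrite !mxE. Qed.

Lemma mxstar_tC m n (A : 'M[C]_(m, n)) : mxstar A = map_mx Num.conj (A^T).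
Proof. by rewrite /mxstar map_trmx. Qed.

Lemma mxstarK m n (A : 'M[C]_(m, n)) : mxstar (mxstar A) = A.
Proof. by apply/matrixP => i j; rewrite !mxE conjCK. Qed.

Lemma mxstarM m n p (A : 'M[C]_(m, n)) (B : 'M[C]_(n, p)) :
  mxstar (A *m B) = mxstar B *m mxstar A.
Proof. by rewrite /mxstar map_mxM trmx_mul. Qed.

Lemma mxstar1 n : mxstar (1%:M : 'M[C]_n) = 1%:M.
Proof. by rewrite /mxstar map_mx1 trmx1. Qed.

Lemma unitaryP n (u : 'M[C]_n) : mxstar u *m u = 1%:M -> unitary u.
Proof. by move=> H; split=> //; exact: mulmx1C. Qed.

Lemma unitary_unitarymx n (u : 'M[C]_n) : unitary u <-> u \is unitarymx.
Proof.
split=> [[_ H]|/unitarymxP H]; first by apply/unitarymxP; rewrite -mxstar_tC.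
by apply: unitaryP; apply: mulmx1C; rewrite mxstar_tC.
Qed.

Lemma unitary1 n : unitary (1%:M : 'M[C]_n).
Proof. by apply: unitaryP; rewrite mxstar1 mulmx1. Qed.

Lemma unitaryM n (u v : 'M[C]_n) : unitary u -> unitary v -> unitary (u *m v).
Proof.
move=> [u1 _] [v1 _]; apply: unitaryP.
by rewrite mxstarM mulmxA -(mulmxA _ (mxstar u)) u1 mulmx1.
Qed.

Lemma unitary_star n (u : 'M[C]_n) : unitary u -> unitary (mxstar u).
Proof. by move=> [u1 u2]; apply: unitaryP; rewrite mxstarK. Qed.

Lemma unitary_inv n (u : 'M[C]_n) : unitary u -> invmx u = mxstar u.
Proof.
move=> /unitary_unitarymx uu; rewrite mxstar_tC.
exact: invmx_unitary uu.
Qed.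

Lemma conj_nm1 (s : C) : s * s^* = 1 <-> nm s = 1.
Proof.
rewrite -nm_sqr; split=> [H|->]; last by rewrite expr1n.
apply/eqP; rewrite -(@eqrXn2 _ 2) ?nm_ge0 // expr1n; apply/eqP.
exact: complexI.
Qed.

Definition torus n (t : 'rV[C]_n) := forall i, nm (t 0 i) = 1.

Lemma mxstar_diag n (t : 'rV[C]_n) : mxstar (diag_mx t) = diag_mx (map_mx Num.conj t).
Proof.
apply/matrixP => i j; rewrite !mxE eq_sym.
by case: eqP => [->|_]; rewrite ?mulr1n ?mulr0n ?conjC0.
Qed.

Lemma unitary_diag n (t : 'rV[C]_n) : torus t <-> unitary (diag_mx t).
Proof.
split=> [T|[_ /matrixP H] i].
  apply: unitaryP; rewrite mxstar_diag mulmx_diag; apply/matrixP => i j.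
  rewrite !mxE; case: eqP => // _; rewrite !mulr1n mulrC.
  exact/conj_nm1.
have := H i i; rewrite mxstar_diag mulmx_diag !mxE eqxx !mulr1n.
by move/conj_nm1.
Qed.

Lemma unitary_spectral n (u : 'M[C]_n) : unitary u ->
  exists V : 'M[C]_n, exists t : 'rV[C]_n,
    [/\ unitary V, torus t & u = mxstar V *m diag_mx t *m V].
Proof.
move=> uu; have : u \is normalmx.
  by apply/normalmxP; case: uu; rewrite mxstar_tC => -> ->.
move/orthomx_spectral_subproof => [[V t] /= VU E].
have VU' : unitary V by apply/unitary_unitarymx.
exists V, t; rewrite -unitary_inv //; split => //.
have tE : diag_mx t = V *m u *m mxstar V.
  rewrite E -unitary_inv // !mulmxA mulmxV ?unitarymx_unit // mul1mx.
  by rewrite mulmxK ?unitarymx_unit.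
by apply/unitary_diag; rewrite tE; apply: unitaryM; [apply: unitaryM|exact: unitary_star].
Qed.

Lemma span_ind (vT : vectType C) (Q : vT -> Prop) (As : seq vT) v :
  Q 0 -> (forall x y, Q x -> Q y -> Q (x + y)) ->
  (forall a x, Q x -> Q (a *: x)) -> (forall x, x \in As -> Q x) ->
  v \in <<As>>%VS -> Q v.
Proof.
move=> Q0 QD QZ QA; rewrite -{1}(in_tupleE As) => /coord_span ->.
elim/big_ind: _ => // i _; apply: QZ; apply: QA.
by rewrite mem_nth ?size_tuple.
Qed.

(** A list of elements of [S] of maximal dimension already spans [S]; this reduces an infinite
    commuting family to a finite one. *)
Lemma finite_span (vT : vectType C) (S : vT -> Prop) :
  exists As : seq vT, (forall x, x \in As -> S x) /\
    (forall x, S x -> x \in <<As>>%VS).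
Proof.
pose P k := `[< exists As : seq vT, (forall x, x \in As -> S x) /\ \dim <<As>> = k >].
have P0 : exists k, P k.
  by exists 0%N; apply/asboolP; exists [::]; rewrite span_nil dimv0.
have Pb k : P k -> (k <= \dim {:vT})%N.
  by move/asboolP => [As [_ <-]]; exact/dimvS/subvf.
case: (ex_maxnP P0 Pb) => k /asboolP[As [AS Ak]] kmax.
exists As; split=> // x Sx.
have : (\dim <<x :: As>> <= k)%N.
  apply: kmax; apply/asboolP; exists (x :: As); split => // y.
  by rewrite in_cons => /orP[/eqP ->|/AS].
rewrite -Ak => H; have sub : (<<As>> <= <<x :: As>>)%VS.
  by apply: sub_span => y yA; rewrite in_cons yA orbT.
have /eqP -> : <<As>>%VS == <<x :: As>>%VS by rewrite eqEdim sub.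
by apply: memv_span; rewrite in_cons eqxx.
Qed.

(** A unitary simultaneous trigonalisation is diagonal here: the adjoints belong to the family too,
    so each matrix is triangular both ways. *)
Lemma codiag n (S : 'M[C]_n -> Prop) :
  (forall A B, S A -> S B -> A *m B = B *m A) ->
  (forall A, S A -> S (mxstar A)) ->
  exists2 P : 'M[C]_n, unitary P & forall A i j, S A -> i != j ->
    (P *m A *m mxstar P) i j = 0.
Proof.
move=> Scomm Sstar; have [As [AS SA]] := finite_span S.
have [] := @cotrigonalization _ n As.
  by move=> A B /AS sA /AS sB; exact: Scomm.
move=> P PU /allP /= H; exists P; first by apply/unitary_unitarymx.
have PU' := unitarymx_unit PU.
have trig A : S A -> is_trig_mx (P *m A *m mxstar P).
  move=> /SA; apply: (@span_ind _ (fun A => is_trig_mx (P *m A *m mxstar P))).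
  - rewrite mulmx0 mul0mx; by apply/is_trig_mxP => i j _; rewrite mxE.
  - move=> x y /is_trig_mxP hx /is_trig_mxP hy; apply/is_trig_mxP => i j ij.
    by rewrite mulmxDr mulmxDl mxE hx // hy // addr0.
  - move=> a x /is_trig_mxP hx; apply/is_trig_mxP => i j ij.
    by rewrite -scalemxAr -scalemxAl mxE hx // mulr0.
  - by move=> x /H xt; rewrite mxstar_tC -(conjymx x PU).
move=> A i j sA ij; case: (ltngtP i j) => [lt|lt|/val_inj E].
- by have /is_trig_mxP -> := trig _ sA.
- have /is_trig_mxP /(_ j i lt) := trig _ (Sstar _ sA).
  rewrite -{1}(mxstarK P) -mxstarM -mulmxA -mxstarM mxstarE mulmxA => /eqP.
  by rewrite conjC_eq0 => /eqP.
- by move: ij; rewrite E eqxx.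
Qed.

End Unitary.

(** * Small orbits on sets of weights *)

Section Combinatorics.
Local Open Scope set_scope.

Lemma bin_ge d m : (0 < m)%N -> (m < d)%N -> (d <= 'C(d, m))%N.
Proof.
elim: d m => // d IH [//|m] _; rewrite ltnS => md.
have [/eqP|m0] := posnP m; first by move/eqP ->; rewrite bin1.
have [E|mn] := eqVneq m.+1 d; first by rewrite E -bin_sub // subSnn bin1.
rewrite binS addnC -addn1 leq_add //; first by rewrite IH // ltn_neqAle mn.
by rewrite bin_gt0.
Qed.

(** Otherwise [1 < m < d - 1], and Pascal's rule with [bin_ge] gives ['C(d, m) >= 2 (d - 1) > d]. *)
Lemma bin_eq d m : (0 < m)%N -> (m < d)%N -> ('C(d, m) <= d)%N ->
  m = 1%N \/ m = d.-1.
Proof.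
case: d m => // d [//|m] _; rewrite ltnS => md.
have [->|m0] := posnP m; first by left.
have [->|mn] := eqVneq m.+1 d; first by right.
have m1d : (m.+1 < d)%N by rewrite ltn_neqAle mn.
rewrite binS; have := bin_ge (ltn0Sn m) m1d; have := bin_ge m0 (ltnW m1d).
move=> h1 h2 h3; have : (d + d <= d.+1)%N by apply: leq_trans h3; exact: leq_add.
rewrite -[d.+1]addn1 leq_add2l => d1.
by have := leq_trans m1d d1.
Qed.

Lemma perm_between d (A B : {set 'I_d}) : #|A| = #|B| ->
  exists s : 'S_d, forall i, (s i \in A) = (i \in B).
Proof.
move=> AB.
pose e (X : {set 'I_d}) := enum X ++ enum (~: X).
have eu X : uniq (e X).
  rewrite cat_uniq !enum_uniq andbT /=; apply/hasPn => i.
  by rewrite !mem_enum inE.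
have em X i : i \in e X by rewrite mem_cat !mem_enum inE orbN.
have es X : size (e X) = d by rewrite size_cat -!cardE cardsC card_ord.
pose f i := nth i (e A) (index i (e B)).
have il i : (index i (e B) < d)%N by have := em B i; rewrite -index_mem es.
have fi : injective f.
  move=> i j; rewrite /f (set_nth_default j); last by rewrite es.
  move/eqP; rewrite nth_uniq ?eu ?es // => /eqP E.
  by rewrite -(nth_index i (em B i)) E (set_nth_default j) ?es // nth_index ?em.
exists (perm fi) => i; rewrite permE /f /e nth_cat index_cat mem_enum -!cardE AB.
case iB: (i \in B).
  rewrite cardE index_mem mem_enum iB -mem_enum mem_nth // -cardE AB cardE.
  by rewrite index_mem mem_enum.
rewrite ltnNge leq_addr /= addKn; apply/negbTE.
have : nth i (enum (~: A)) (index i (enum (~: B))) \in enum (~: A).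
  apply: mem_nth; have := cardsC A; rewrite AB -(cardsC B) => /addnI E.
  by rewrite -cardE E cardE index_mem mem_enum inE iB.
by rewrite mem_enum inE.
Qed.

(** Let [m] be the size of the level set [A k0] of the value [x]. Permuting the row realises every
    [m]-subset as some [A k], so [d <= 'C(d, m) <= n <= d]. Equality makes [A] injective and leaves
    [m = 1] or [m = d - 1]. *)
Lemma small_orbit (X : Type) n d (phi : 'I_n -> 'I_d -> X) k0 i0 j0 :
  (n <= d)%N ->
  (forall k (s : 'S_d), exists m, forall i, phi m i = phi k (s i)) ->
  phi k0 i0 <> phi k0 j0 ->
  n = d /\ exists (p q : X) (pi : 'I_n -> 'I_d), [/\ p <> q, injective pi &
    forall k i, phi k i = if i == pi k then p else q].
Proof.
move=> nd orb neq.
pose x := phi k0 i0; pose A k := [set i | `[< phi k i = x >]].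
have AE k i : reflect (phi k i = x) (i \in A k) by rewrite inE; exact: asboolP.
pose m := #|A k0|.
have m0 : (0 < m)%N by apply/card_gt0P; exists i0; apply/AE.
have j0A : j0 \notin A k0 by apply/AE => E; apply: neq; rewrite E.
have md : (m < d)%N.
  rewrite -[X in (_ < X)%N](card_ord d) -cardsT; apply: proper_card.
  by rewrite properT; apply: contraNneq j0A => ->; rewrite inE.
have surj (S : {set 'I_d}) : #|S| = m -> exists k,
    A k = S /\ exists s : 'S_d, (forall i, (s i \in A k0) = (i \in S)) /\
      forall i, phi k i = phi k0 (s i).
  move=> Sm; have [s Hs] := perm_between (esym Sm).
  have [k Hk] := orb k0 s; exists k; split; last by exists s.
  by apply/setP => i; rewrite -Hs; apply/AE/AE; rewrite Hk.
pose D := [set S : {set 'I_d} | #|S| == m].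
have Dsub : D \subset [set A k | k : 'I_n].
  by apply/fintype.subsetP => S; rewrite inE => /eqP/surj[k [<- _]]; apply: imset_f.
have cD : #|D| = 'C(d, m) by rewrite card_draws card_ord.
have cI : (#|[set A k | k : 'I_n]| <= n)%N.
  by apply: leq_trans (leq_imset_card _ _) _; rewrite card_ord.
have dD : (d <= 'C(d, m))%N := bin_ge m0 md.
have Dn : ('C(d, m) <= n)%N by rewrite -cD; apply: leq_trans cI; exact: subset_leq_card.
have nE : n = d by apply/eqP; rewrite eqn_leq nd (leq_trans dD).
have cIn : #|[set A k | k : 'I_n]| = n.
  apply/eqP; rewrite eqn_leq cI /=; apply: leq_trans nd _.
  by apply: leq_trans dD _; rewrite -cD subset_leq_card.
have Ainj : injective A.
  have /imset_injP H : #|[set A k | k in 'I_n]| == #|'I_n| by rewrite cIn card_ord.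
  by move=> k l E; apply: H.
have DE : D = [set A k | k : 'I_n].
  by apply/eqP; rewrite eqEcard Dsub cIn cD {1}nE.
have Am k : #|A k| = m.
  have : A k \in D by rewrite DE imset_f.
  by rewrite inE => /eqP.
(* A transposition of two indices outside [A k0] preserves that set; since [A] is injective it
   preserves the row, so the two values agree. *)
have yconst i : i \notin A k0 -> phi k0 i = phi k0 j0.
  move=> iA; have [k Hk] := orb k0 (tperm i j0).
  have AA : A k = A k0.
    apply/setP => l; have -> : (l \in A k) = (tperm i j0 l \in A k0).
      by apply/AE/AE; rewrite Hk.
    by case: tpermP => [->|->|//]; rewrite (negbTE iA) (negbTE j0A).
  by have := Hk j0; rewrite (Ainj _ _ AA) tpermR.
have two k i : phi k i = if i \in A k then x else phi k0 j0.
  have [k' [E [s [Hs Hp]]]] := surj _ (Am k).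
  by rewrite -(Ainj _ _ E) Hp E -Hs; case: ifP => [/AE //|/negbT /yconst].
(* The value [x] is either taken at exactly one index or missed at exactly one; in the second case
   it plays the part of [q]. *)
split=> //; have [m1|md1] := bin_eq m0 md (leq_trans Dn nd).
  have pick k : exists i, A k = [set i] by apply/cards1P; rewrite Am m1.
  have [pi Hpi] := choice pick.
  exists x, (phi k0 j0), pi; split => //.
    by move=> k l E; apply: Ainj; rewrite !Hpi E.
  by move=> k i; rewrite two Hpi inE.
have pick k : exists i, ~: A k = [set i].
  apply/cards1P; have := cardsC (A k); rewrite Am card_ord md1.
  move=> E; rewrite -(eqn_add2l d.-1) E addn1 prednK //.
  by apply: leq_trans md.
have [pi Hpi] := choice pick.
exists (phi k0 j0), x, pi; split => //.
- by move=> E; apply: neq; rewrite -/x E.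
- by move=> k l E; apply: Ainj; apply: (can_inj (@finset.setCK _)); rewrite !Hpi E.
- move=> k i; rewrite two.
  have <- : (i \in ~: A k) = (i == pi k) by rewrite Hpi finset.in_set1.
  by rewrite finset.in_setC; case: ifP.
Qed.

End Combinatorics.

(** * Weights of an irreducible representation *)

Section Weights.
Variable R : realType.
Local Notation C := R[i].

Definition rep d n (c : 'M[C]_d -> 'M[C]_n) : Prop :=
  (forall u v, unitary u -> unitary v -> c (u *m v) = c u *m c v) /\
  (forall u, unitary u -> unitary (c u)).

Lemma rep1 d n (c : 'M[C]_d -> 'M[C]_n) : rep c -> c 1%:M = 1%:M.
Proof.
move=> [cM cU]; have H := cM _ _ (unitary1 _ d) (unitary1 _ d).
rewrite mulmx1 in H; have [c1 _] := cU _ (unitary1 _ d).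
by rewrite -[LHS]mul1mx -[X in X *m _]c1 -mulmxA -H c1.
Qed.

Lemma rep_star d n (c : 'M[C]_d -> 'M[C]_n) u : rep c -> unitary u ->
  c (mxstar u) = mxstar (c u).
Proof.
move=> rc uu; have [cM cU] := rc; have us := unitary_star uu.
have [u1 u2] := uu; have [c1 c2] := cU _ uu.
have := cM _ _ us uu; rewrite u1 (rep1 rc) => /(congr1 (mulmx^~ (mxstar (c u)))).
by rewrite mul1mx -mulmxA c2 mulmx1.
Qed.

Lemma rep_conj d n (c : 'M[C]_d -> 'M[C]_n) P : rep c -> unitary P ->
  rep (fun u => P *m c u *m mxstar P).
Proof.
move=> [cM cU] [P1 P2]; split=> [u v uu vv|u uu].
  by rewrite cM // !mulmxA -(mulmxA _ (mxstar P) P) P1 mulmx1.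
by apply: unitaryM; [apply: unitaryM => //; exact: cU|exact: unitary_star].
Qed.

Lemma irreducible_conj d n (c : 'M[C]_d -> 'M[C]_n) P : irreducible_rep c ->
  unitary P -> irreducible_rep (fun u => P *m c u *m mxstar P).
Proof.
move=> irr [P1 P2] W [W0 [WD [WZ Wc]]].
have [] := irr [set v | W (P *m v)].
- split; first by rewrite /= mulmx0.
  split=> [v w|]; first by rewrite /= mulmxDr; exact: WD.
  split=> [a v|u v uu]; first by rewrite /= -scalemxAr; exact: WZ.
  move=> /= Wv; have := Wc u _ uu Wv.
  by rewrite !mulmxA -(mulmxA _ (mxstar P) P) P1 mulmx1.
- move=> /seteqP[H _]; left; apply/seteqP; split=> v; last by move=> ->.
  move=> Wv; have : mxstar P *m v = 0.
    by apply: H; rewrite /= mulmxA P2 mul1mx.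
  by move/(congr1 (mulmx P)); rewrite mulmxA P2 mul1mx mulmx0.
- move=> /seteqP[_ H]; right; apply/seteqP; split=> // v _.
  by have := H (mxstar P *m v) I; rewrite /= mulmxA P2 mul1mx.
Qed.

Lemma torus_rep_diag d n (c : 'M[C]_d -> 'M[C]_n) : rep c ->
  exists2 P, unitary P & forall t, torus t -> forall i j, i != j ->
    (P *m c (diag_mx t) *m mxstar P) i j = 0.
Proof.
move=> rc; have [cM cU] := rc.
pose S A := exists t, torus t /\ A = c (diag_mx t).
have [] := @codiag R n S.
- move=> _ _ [t [/unitary_diag T ->]] [u [/unitary_diag U ->]].
  by rewrite -!cM // diag_mxC.
- move=> _ [t [T ->]]; exists (map_mx Num.conj t); split.
    by move=> i; rewrite mxE nmJ.
  by rewrite -rep_star ?mxstar_diag //; exact/unitary_diag.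
by move=> P PU H; exists P => // t T i j ij; apply: H => //; exists t.
Qed.

Definition single d (i : 'I_d) (s : C) : 'rV[C]_d := \row_j if j == i then s else 1.

Lemma torus_single d (i : 'I_d) s : nm s = 1 -> torus (single i s).
Proof. by move=> s1 j; rewrite mxE; case: ifP => // _; exact: nm1. Qed.

Section Diagonal.
Variables (d n : nat) (c : 'M[C]_d -> 'M[C]_n).
Hypothesis rc : rep c.
Hypothesis cD : forall t, torus t -> forall i j, i != j -> c (diag_mx t) i j = 0.

Definition wt (k : 'I_n) (t : 'rV[C]_d) : C := c (diag_mx t) k k.

Lemma cDE t : torus t -> c (diag_mx t) = diag_mx (\row_k wt k t).
Proof.
move=> T; apply/matrixP => i j; rewrite !mxE.
by have [->|ij] := eqVneq i j; rewrite ?mulr1n // mulr0n cD.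
Qed.

Lemma wtM k t u : torus t -> torus u ->
  wt k (\row_j (t 0 j * u 0 j)) = wt k t * wt k u.
Proof.
move=> T U; rewrite /wt; have [cM _] := rc.
have := cM _ _ (proj1 (unitary_diag _) T) (proj1 (unitary_diag _) U).
rewrite mulmx_diag => ->; rewrite (cDE T) (cDE U) mulmx_diag.
by rewrite !mxE !eqxx !mulr1n.
Qed.

Lemma nm_wt k t : torus t -> nm (wt k t) = 1.
Proof.
move=> T; have [_ cU] := rc.
have := cU _ (proj1 (unitary_diag _) T); rewrite (cDE T).
by move/unitary_diag/(_ k); rewrite mxE.
Qed.

Definition ph k i (s : C) : C := wt k (single i s).

Lemma phM k i s t : nm s = 1 -> nm t = 1 -> ph k i (s * t) = ph k i s * ph k i t.
Proof.
move=> s1 t1; rewrite /ph -wtM; [|exact: torus_single..].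
by congr wt; apply/rowP => j; rewrite !mxE; case: ifP; rewrite ?mulr1.
Qed.

Lemma nm_ph k i s : nm s = 1 -> nm (ph k i s) = 1.
Proof. by move=> s1; apply/nm_wt/torus_single. Qed.

Lemma wt_prod k t : torus t -> wt k t = \prod_i ph k i (t 0 i).
Proof.
move=> T.
have H (s : seq 'I_d) : uniq s -> wt k (\row_j if j \in s then t 0 j else 1) =
    \prod_(i <- s) ph k i (t 0 i).
  elim: s => [_|i s IH /= /andP[isn us]].
    rewrite big_nil /wt (_ : diag_mx _ = 1%:M) ?(rep1 rc) ?mxE ?eqxx //.
    by apply/matrixP => a b; rewrite !mxE.
  rewrite big_cons -IH // /ph -wtM.
  - congr wt; apply/rowP => j; rewrite !mxE in_cons.
    by have [->|] := eqVneq j i; rewrite ?(negbTE isn) ?mulr1 ?mul1r.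
  - exact: torus_single.
  - by move=> j; rewrite mxE; case: ifP => // _; exact: nm1.
rewrite -H ?index_enum_uniq //; congr wt; apply/rowP => j.
by rewrite mxE mem_index_enum.
Qed.

Lemma unitary_perm (s : 'S_d) : unitary (perm_mx s : 'M[C]_d).
Proof.
apply: unitaryP; rewrite mxstar_tC tr_perm_mx map_perm_mx -perm_mxM mulVg.
exact: perm_mx1.
Qed.

(** Permutation matrices normalise the torus, so [Q] intertwines two diagonal matrices. Its row [k]
    is non-zero by unitarity, and any entry [Q k m != 0] forces the corresponding weights to
    agree. *)
Lemma ph_perm k (s : 'S_d) : exists m, forall i x, nm x = 1 ->
  ph m i x = ph k (s i) x.
Proof.
have [cM cU] := rc; pose Q := c (perm_mx s^-1%g).
have UP := unitary_perm s^-1%g.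
have [m Qm] : exists m, Q k m != 0.
  apply: contrapT => H; have [_ /matrixP/(_ k k)] := cU _ UP.
  rewrite !mxE eqxx big1 => [/eqP|m _]; first by rewrite eq_sym oner_eq0.
  case: (eqVneq (Q k m) 0) => [->|Qn]; first by rewrite mul0r.
  by exfalso; apply: H; exists m.
exists m => i x x1; have Ti := torus_single i x1.
have Ts := torus_single (s i) x1.
have E : perm_mx s^-1%g *m diag_mx (single i x) = diag_mx (single (s i) x) *m perm_mx s^-1%g.
  apply/matrixP => a b; rewrite mul_mx_diag mul_diag_mx !mxE.
  have [<-|_] := eqVneq (s^-1%g a) b; rewrite ?mulr0 ?mul0r ?mulr1 ?mul1r //.
  by congr (if _ then _ else _); apply/eqP/eqP => [<-|->]; rewrite ?permKV ?permK.
have := congr1 c E; rewrite cM ?cM //; try exact/unitary_diag.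
rewrite (cDE Ti) (cDE Ts) => /matrixP/(_ k m).
rewrite mul_mx_diag mul_diag_mx !mxE mulrC => /(mulIf Qm); exact.
Qed.

Hypothesis irr : irreducible_rep c.

(* If all coordinates of every weight agree then [c u] only depends on
   [det u], hence is diagonal. *)
Lemma weight_nonconst : (0 < d)%N -> (1 < n)%N ->
  exists k i j x, nm x = 1 /\ ph k i x <> ph k j x.
Proof.
move=> d0 n1; apply: contrapT => H.
have eqph k i j x : nm x = 1 -> ph k i x = ph k j x.
  by move=> x1; apply: contrapT => K; apply: H; exists k, i, j, x.
have [cM cU] := rc.
have cs u : unitary u -> forall i j, i != j -> c u i j = 0.
  move=> /unitary_spectral[V [t [VU T ->]]].
  (* The scalar matrix [eta] has the determinant of [diag_mx t], hence the same image under [c];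
     being central, it absorbs the conjugation by [V]. *)
  have [eta Heta] : exists eta : C, eta ^+ d = \prod_i t 0 i.
    by exists (d.-root (\prod_i t 0 i)); rewrite rootCK.
  have eta1 : nm eta = 1.
    apply/eqP; rewrite -(@eqrXn2 _ d) ?nm_ge0 // expr1n -nmX Heta.
    elim/big_ind: _ => [|x y /eqP x1 /eqP y1|i _].
    - by rewrite nm1.
    - by rewrite nmM x1 y1 mulr1.
    - by rewrite T.
  have Te : torus (const_mx eta : 'rV[C]_d) by move=> i; rewrite mxE.
  have E : c (diag_mx t) = c (diag_mx (const_mx eta)).
    rewrite !cDE //; congr diag_mx; apply/rowP => k; rewrite !mxE !wt_prod //.
    have phe i x : nm x = 1 -> ph k i x = ph k (Ordinal d0) x by exact: eqph.
    rewrite (eq_bigr (fun i => ph k (Ordinal d0) (t 0 i))); last by move=> i _; exact: phe.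
    rewrite [RHS](eq_bigr (fun=> ph k (Ordinal d0) eta)); last first.
      by move=> i _; rewrite mxE; exact: phe.
    have P (F : 'I_d -> C) : (forall i, nm (F i) = 1) ->
       \prod_i ph k (Ordinal d0) (F i) = ph k (Ordinal d0) (\prod_i F i) /\
       nm (\prod_i F i) = 1.
      move=> F1; apply: (big_ind2 (fun x y => x = ph k (Ordinal d0) y /\ nm y = 1)).
      - split; last exact: nm1.
        have := @phM k (Ordinal d0) 1 1 (nm1 _) (nm1 _); rewrite mulr1.
        move/eqP; rewrite -{1}(mulr1 (ph _ _ _)) (inj_eq (mulfI _)) => [/eqP //|].
        by rewrite -nm_gt0 nm_ph // nm1.
      - by move=> _ x _ y [-> x1] [-> y1]; rewrite phM // nmM x1 y1 mulr1.
      - by move=> i _.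
    rewrite (P (fun i => t 0 i) T).1 (P (fun=> eta) (fun=> eta1)).1.
    by rewrite -Heta prodr_const card_ord.
  have UT := proj1 (unitary_diag _) T; have UE := proj1 (unitary_diag _) Te.
  have VS := unitary_star VU.
  rewrite !cM //; last exact: unitaryM.
  rewrite E -cM // -cM //; last exact: unitaryM.
  rewrite diag_const_mx mul_mx_scalar -scalemxAl (proj1 VU).
  by rewrite scalemx1 -diag_const_mx; exact: cD.
pose k0 : 'I_n := Ordinal (ltnW n1); pose k1 : 'I_n := Ordinal n1.
(* With every [c u] diagonal the first coordinate axis is invariant; as [1 < n] it is neither zero
   nor the whole space. *)
have [] := irr (W := [set v | forall k, k != k0 -> v k 0 = 0]).
- split; first by move=> k _; rewrite mxE.
  split=> [v w Wv Ww k kn|]; first by rewrite mxE Wv // Ww // addr0.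
  split=> [a v Wv k kn|u v uu Wv k kn]; first by rewrite mxE Wv // mulr0.
  rewrite mxE big1 // => m _; have [mk|mk] := eqVneq m k0.
    by rewrite cs ?mul0r // mk.
  by rewrite Wv // mulr0.
- move=> /seteqP[H1 _]; have : (delta_mx k0 0 : 'cV[C]_n) = 0.
    by apply: H1 => k kn; rewrite mxE (negbTE kn).
  by move/matrixP/(_ k0 0); rewrite !mxE !eqxx /= => /eqP; rewrite oner_eq0.
- move=> /seteqP[_ H1]; have := H1 (delta_mx k1 0) I k1 isT.
  by rewrite mxE !eqxx /= => /eqP; rewrite oner_eq0.
Qed.

Lemma weights : (1 < n)%N -> (n <= d)%N -> n = d /\
  exists (p q : C -> C) (pi : 'I_n -> 'I_d), [/\ injective pi,
    exists2 x, nm x = 1 & p x <> q x &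
    forall k i x, nm x = 1 -> ph k i x = if i == pi k then p x else q x].
Proof.
move=> n1 nd; have d0 : (0 < d)%N by apply: leq_trans nd; exact: ltnW.
have [k0 [i0 [j0 [x0 [x01 neq]]]]] := weight_nonconst d0 n1.
(* Characters are compared as functions on the circle only, where they are controlled; the extension
   by 0 below is arbitrary. *)
pose phi k i (x : {x : C | nm x = 1}) := ph k i (sval x).
have [] := @small_orbit _ n d phi k0 i0 j0 nd.
- move=> k s; have [m Hm] := ph_perm k s; exists m => i.
  by apply/funext => -[x x1]; rewrite /phi /= Hm.
- by move=> /(congr1 (@^~ (exist _ x0 x01))).
move=> nE [p [q [pi [pq pinj H]]]]; split=> //.
pose ext (f : {x : C | nm x = 1} -> C) x :=
  if pselect (nm x = 1) is left x1 then f (exist _ x x1) else 0.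
exists (ext p), (ext q), pi; split=> //.
- apply: contrapT => K; apply: pq; apply/funext => -[x x1].
  apply: contrapT => px; apply: K; exists x => //; rewrite /ext.
  by case: pselect => // x1'; rewrite (Prop_irrelevance x1' x1).
- move=> k i x x1; have := congr1 (@^~ (exist _ x x1)) (H k i).
  rewrite /phi /= => ->; rewrite /ext; case: pselect => // x1'.
  by rewrite (Prop_irrelevance x1' x1); case: ifP.
Qed.

End Diagonal.

End Weights.

(** * The defining representation up to a character of the torus *)

Section Theta.
Variable R : realType.
Local Notation C := R[i].

Lemma nm_det_unitary n (u : 'M[C]_n) : unitary u -> nm (\det u) = 1.
Proof.
move=> [u1 _]; apply/conj_nm1; rewrite mulrC -(det1 C n) -u1 det_mulmx.
by congr (_ * _); rewrite /mxstar det_tr det_map_mx.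
Qed.

Definition uhom (th : C -> C) := (forall s t, nm s = 1 -> nm t = 1 ->
  th (s * t) = th s * th t) /\ (forall s, nm s = 1 -> nm (th s) = 1).

Lemma uhom1 th : uhom th -> th 1 = 1.
Proof.
move=> [tM t1]; have := tM 1 1 (nm1 _) (nm1 _); rewrite mulr1.
move/eqP; rewrite -{1}(mulr1 (th 1)) (inj_eq (mulfI _)) => [/eqP //|].
by rewrite -nm_gt0 t1 // nm1.
Qed.

Lemma uhomJ th s : uhom th -> nm s = 1 -> th (s^*) = (th s)^*.
Proof.
move=> ut s1; have [tM t1] := ut; have tn : th s != 0 by rewrite -nm_gt0 t1.
apply: (mulfI tn); rewrite -tM ?nmJ // (proj2 (conj_nm1 _) s1) (uhom1 ut).
by apply/esym/conj_nm1; exact: t1.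
Qed.

Lemma prod_uhom th (I : finType) (F : I -> C) : uhom th ->
  (forall i, nm (F i) = 1) -> \prod_i th (F i) = th (\prod_i F i).
Proof.
move=> ut F1; have [tM t1] := ut.
suff [] : \prod_i th (F i) = th (\prod_i F i) /\ nm (\prod_i F i) = 1 by [].
apply: (big_ind2 (fun x y => x = th y /\ nm y = 1)).
- by split; [rewrite uhom1|exact: nm1].
- by move=> _ x _ y [-> x1] [-> y1]; rewrite tM // nmM x1 y1 mulr1.
- by move=> i _.
Qed.

(** The k-th weight is [p] at coordinate [pi k] times [q] at all others, that is [p / q] at
    coordinate [pi k] times [q] of the determinant. Dividing by [q (\det u)] and permuting the basis
    along [pi] leaves [th = p / q]. *)
Lemma rep_theta d (c : 'M[C]_d -> 'M[C]_d) : (1 < d)%N -> rep c -> irreducible_rep c ->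
  exists (P : 'M[C]_d) (q th : C -> C), [/\ unitary P, uhom q, uhom th,
    exists2 x, nm x = 1 & th x <> 1 &
    let c' u := (q (\det u))^-1 *: (P *m c u *m mxstar P) in
    rep c' /\ forall t, torus t -> c' (diag_mx t) = diag_mx (\row_i th (t 0 i))].
Proof.
move=> d1 rc irr; have [P0 P0U P0D] := torus_rep_diag rc.
pose c1 u := P0 *m c u *m mxstar P0.
have rc1 : rep c1 by exact: rep_conj.
have irr1 : irreducible_rep c1 by exact: irreducible_conj.
have cD1 : forall t, torus t -> forall i j, i != j -> c1 (diag_mx t) i j = 0 := P0D.
have [_ [p [q [pi [pinj [x x1 pqx] Hph]]]]] := weights rc1 cD1 irr1 d1 (leqnn d).
pose s := perm pinj; pose Q : 'M[C]_d := perm_mx s^-1%g.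
have QU : unitary Q by exact: unitary_perm.
pose k0 : 'I_d := Ordinal (ltnW d1).
have pE y : nm y = 1 -> p y = ph c1 k0 (pi k0) y by move=> y1; rewrite Hph // eqxx.
(* A second index shows that [q], like [p], is a restriction of a weight to a circle factor, hence
   multiplicative. *)
have [i1 i1n] : exists i, i != pi k0.
  have [E|] := eqVneq k0 (pi k0); last by exists k0.
  by exists (Ordinal d1); rewrite -E.
have qE y : nm y = 1 -> q y = ph c1 k0 i1 y by move=> y1; rewrite Hph // (negbTE i1n).
have up : uhom p.
  split=> [y z y1 z1|y y1]; rewrite !pE ?nmM ?y1 ?z1 ?mulr1 //.
    exact: phM.
  exact: nm_ph.
have uq : uhom q.
  split=> [y z y1 z1|y y1]; rewrite !qE ?nmM ?y1 ?z1 ?mulr1 //.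
    exact: phM.
  exact: nm_ph.
have qn0 y : nm y = 1 -> q y != 0 by move=> y1; rewrite -nm_gt0 (proj2 uq).
pose th y := p y / q y.
exists (Q *m P0), q, th; split => //.
- exact: unitaryM.
- split=> [y z y1 z1|y y1]; last by rewrite /th nmM nmV (proj2 up) // (proj2 uq) // divr1.
  by rewrite /th (proj1 up) // (proj1 uq) // invfM mulrACA.
- by exists x => // E; apply: pqx; rewrite -[p x](divfK (qn0 _ x1)) -/(th x) E mul1r.
pose c2 u := Q *m c1 u *m mxstar Q.
have rc2 : rep c2 by exact: rep_conj.
have cE u : Q *m P0 *m c u *m mxstar (Q *m P0) = c2 u.
  by rewrite mxstarM /c2 /c1 !mulmxA.
have c2E u : c2 u = Q *m c1 u *m mxstar Q by [].
move: c2E cE rc2; move: c2 => c2 c2E cE rc2.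
split.
  split=> [u v uu vv|u uu]; rewrite !cE.
    rewrite (proj1 rc2 u v uu vv) det_mulmx.
    rewrite (proj1 uq _ _ (nm_det_unitary uu) (nm_det_unitary vv)) invfM.
    by rewrite -scalemxAl -scalemxAr scalerA.
  have q1 : nm (q (\det u))^-1 = 1.
    by rewrite nmV (proj2 uq) ?invr1 // nm_det_unitary.
  have [w1 _] := (proj2 rc2) u uu.
  apply: unitaryP; rewrite [mxstar _](_ : _ = ((q (\det u))^-1)^* *: mxstar (c2 u)).
    rewrite -scalemxAl -scalemxAr scalerA w1 mulrC (proj2 (conj_nm1 _) q1).
    exact: scale1r.
  by apply/matrixP => i j; rewrite !(mxE, rmorphM).
move=> t T; rewrite cE c2E (cDE cD1 T).
have -> : mxstar Q = perm_mx s by rewrite /Q mxstar_tC tr_perm_mx map_perm_mx invgK.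
have -> : Q *m diag_mx (\row_k wt c1 k t) = diag_mx (\row_k wt c1 (s^-1%g k) t) *m Q.
  apply/matrixP => a b; rewrite mul_mx_diag mul_diag_mx !mxE.
  by have [<-|_] := eqVneq (s^-1%g a) b; rewrite ?mulr0 ?mul0r ?mulr1 ?mul1r.
rewrite -mulmxA -perm_mxM mulVg perm_mx1 mulmx1.
apply/matrixP => a b; rewrite !mxE; have [->|_] := eqVneq a b; last by rewrite !mulr0n mulr0.
rewrite !mulr1n (wt_prod rc1) //.
have -> : \prod_i ph c1 (s^-1%g b) i (t 0 i) = th (t 0 b) * \prod_i q (t 0 i).
  rewrite (bigD1 b) //= (bigD1 b (F := fun i => q (t 0 i))) //= mulrA /th divfK ?qn0 //.
  have sb : pi (s^-1%g b) = b by rewrite -[LHS](permE pinj) permKV.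
  congr (_ * _); first by rewrite Hph // sb eqxx.
  by apply: eq_bigr => i ib; rewrite Hph // sb (negbTE ib).
rewrite (prod_uhom uq) // det_diag.
rewrite mulrCA mulVf ?mulr1 // qn0 //.
rewrite -det_diag; apply: nm_det_unitary; exact/unitary_diag.
Qed.

(** * Recovering a representation from its restriction to the torus *)

Section Standard.
Variables (d : nat) (c : 'M[C]_d -> 'M[C]_d).
Hypothesis rc : rep c.

Lemma trace_rep th : (forall t, torus t -> c (diag_mx t) = diag_mx (\row_i th (t 0 i))) ->
  forall V t, unitary V -> torus t ->
    \tr (c (mxstar V *m diag_mx t *m V)) = \sum_i th (t 0 i).
Proof.
move=> cth V t VU T; have [cM cU] := rc.
have UT := proj1 (unitary_diag _) T; have VS := unitary_star VU.
rewrite !cM //; last exact: unitaryM.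
rewrite mxtrace_mulC mulmxA -cM // (proj2 VU) (rep1 rc) mul1mx cth // mxtrace_diag.
by apply: eq_bigr => i _; rewrite mxE.
Qed.

Hypothesis cid : forall t, torus t -> c (diag_mx t) = diag_mx t.

Lemma trace_rep_id u : unitary u -> \tr (c u) = \tr u.
Proof.
move=> /unitary_spectral[V [t [VU T ->]]].
rewrite (@trace_rep id) //; last first.
  by move=> w W; rewrite cid //; congr diag_mx; apply/rowP => i; rewrite mxE.
by rewrite -mulmxA mxtrace_mulC -mulmxA (proj2 VU) mulmx1 mxtrace_diag.
Qed.

(** The values at the all-ones vector and at the same vector with j-th entry -1 differ by
    [2 b j]. *)
Lemma torus_linear0 (b : 'I_d -> C) :
  (forall t : 'rV[C]_d, torus t -> \sum_j b j * t 0 j = 0) -> forall j, b j = 0.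
Proof.
move=> H j.
have T1 : torus (const_mx 1 : 'rV[C]_d) by move=> i; rewrite mxE nm1.
have n1 : nm (-1 : C) = 1 by rewrite nmN nm1.
have := H _ (torus_single j n1); have := H _ T1.
rewrite (bigD1 j) //= [in X in _ -> X -> _](bigD1 j) //= !mxE eqxx mulr1 mulrN1.
rewrite (eq_bigr b); last by move=> i _; rewrite mxE mulr1.
rewrite [in X in _ -> X -> _](eq_bigr b); last first.
  by move=> i ij; rewrite mxE (negbTE ij) mulr1.
move=> h1 h2; have : b j + b j = 0.
  move: h1 h2; move: (\sum_(i | _) _) => S h1 h2.
  rewrite (_ : b j + b j = (b j + S) - (- b j + S)); last by ring.
  by rewrite h1 h2 subrr.
by move/eqP; rewrite -mulr2n mulrn_eq0 /= => /eqP.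
Qed.

(** The traces of [u D_t v D_w] and of its image are equal, and both are bilinear in the torus
    elements [t] and [w]; the two sides of the identity are the coefficients of [t_j w_i]. *)
Lemma entry_prod u v i j : unitary u -> unitary v ->
  c u i j * c v j i = u i j * v j i.
Proof.
move=> uu vv; have [cM cU] := rc.
have tr4 (A B : 'M[C]_d) (t w : 'rV[C]_d) : \tr (A *m diag_mx t *m (B *m diag_mx w)) =
    \sum_i (\sum_j (A i j * B j i) * t 0 j) * w 0 i.
  rewrite /mxtrace; apply: eq_bigr => k _; rewrite mxE mulr_suml.
  by apply: eq_bigr => l _; rewrite !mul_mx_diag !mxE; ring.
apply/eqP; rewrite -subr_eq0; apply/eqP.
have H t w : torus t -> torus w ->
   \sum_i (\sum_j (c u i j * c v j i - u i j * v j i) * t 0 j) * w 0 i = 0.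
  move=> T W; have UT := proj1 (unitary_diag _) T; have UW := proj1 (unitary_diag _) W.
  have := trace_rep_id (unitaryM (unitaryM uu UT) (unitaryM vv UW)).
  rewrite !cM //; try exact: unitaryM.
  rewrite !cid // !tr4 => /eqP; rewrite -subr_eq0 -sumrB => /eqP E.
  rewrite -[RHS]E; apply: eq_bigr => k _; rewrite -mulrBl -sumrB.
  by congr (_ * _); apply: eq_bigr => l _; rewrite -mulrBl.
have H2 t : torus t -> forall i, \sum_j (c u i j * c v j i - u i j * v j i) * t 0 j = 0.
  by move=> T; apply: torus_linear0 => w W; exact: H.
apply: (@torus_linear0 (fun j => c u i j * c v j i - u i j * v j i)) => t T.
exact: H2.
Qed.

(** Taking a transposition for [v] in [entry_prod] gives [c u i j = g i j * u i j] with unimodular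
    [g]. Multiplicativity makes [g] a cocycle, [g i k = g i j * g j k], hence a coboundary:
    conjugation by the diagonal of [g i0] removes it. *)
Lemma rep_standard (i0 : 'I_d) : exists2 G : 'M[C]_d, unitary G &
  forall u, unitary u -> G *m c u *m mxstar G = u.
Proof.
have [cM cU] := rc.
have TU i j : unitary (tperm_mx i j : 'M[C]_d) by exact: unitary_perm.
have Tij i j : (tperm_mx i j : 'M[C]_d) i j = 1 by rewrite !mxE tpermL eqxx.
have Tji i j : (tperm_mx i j : 'M[C]_d) j i = 1 by rewrite !mxE tpermR eqxx.
pose g i j := c (tperm_mx i j) i j.
have gg i j : g i j * c (tperm_mx i j) j i = 1.
  by rewrite entry_prod // Tij Tji mulr1.
have cg u i j : unitary u -> c u i j = g i j * u i j.
  move=> uu; have := entry_prod i j uu (TU i j); rewrite Tji mulr1 => <-.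
  by rewrite mulrCA gg mulr1.
have g1 i j : nm (g i j) = 1.
  apply/conj_nm1; rewrite -(gg i j); congr (_ * _).
  rewrite /g -mxstarE -rep_star //; congr (c _ _ _).
  by rewrite mxstar_tC tr_perm_mx map_perm_mx tpermV.
have gM i j k : g i k = g i j * g j k.
  (* A torus element between these two makes the [(i, k)] entry linear in [t]; its j-th coefficient
     is the cocycle relation. *)
  pose u : 'M[C]_d := tperm_mx i j; pose v : 'M[C]_d := tperm_mx j k.
  have H (t : 'rV[C]_d) : torus t ->
     \sum_l (g i k - g i l * g l k) * (u i l * v l k) * t 0 l = 0.
    move=> T; have UT := proj1 (unitary_diag _) T.
    have uT : unitary (u *m diag_mx t) := unitaryM (TU i j) UT.
    have := cg _ i k (unitaryM uT (TU j k)).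
    rewrite (cM _ _ uT (TU j k)) (cM _ _ (TU i j) UT) (cid T) !mxE mulr_sumr.
    move=> /eqP; rewrite eq_sym -subr_eq0.
    rewrite -sumrB => /eqP E; rewrite -[RHS]E; apply: eq_bigr => l _.
    rewrite !mul_mx_diag !mxE (cg _ i l (TU i j)) (cg _ l k (TU j k)).
    by rewrite /u /v !mxE; ring.
  have := torus_linear0 H j; rewrite /u /v Tij Tij !mulr1 => /eqP.
  by rewrite subr_eq0 => /eqP.
have T : torus (\row_i g i0 i) by move=> i; rewrite mxE.
exists (diag_mx (\row_i g i0 i)); first exact/unitary_diag.
move=> u uu; rewrite mxstar_diag; apply/matrixP => i j.
rewrite mul_mx_diag mul_diag_mx !mxE cg // mulrA -gM mulrAC.
by rewrite (proj2 (conj_nm1 _) (g1 _ _)) mul1r.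
Qed.

End Standard.

End Theta.

(** * Rigidity of the torus character *)

Section MultiplicativeJensen.
Variables (R : realType) (f : R -> R).
Local Notation I1 x := (-1 <= x <= 1).
Hypothesis fM : forall a b, I1 a -> I1 b -> f (a * b) = f a * f b.
Hypothesis fJ : forall p q, I1 p -> I1 q -> f p + f q = 2 * f ((p + q) / 2).
Hypothesis f1 : f 1 = 1.
Hypothesis fn : exists2 x, I1 x & f x <> 1.

Let I0 : I1 (0 : R). Proof. by apply/andP; split; lra. Qed.
Let Ipos (x : R) : 0 <= x -> x <= 1 -> I1 x.
Proof. by move=> *; apply/andP; split; lra. Qed.

Lemma mj_zero : f 0 = 0.
Proof.
have [x xI fx] := fn; have := fM I0 xI; rewrite mul0r => /eqP.
rewrite -{1}(mulr1 (f 0)) -subr_eq0 -mulrBr mulf_eq0 => /orP[/eqP //|].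
by rewrite subr_eq0 eq_sym => /eqP.
Qed.

(** Jensen's equation for the pairs [p + q, 0] and [p, q] has the same right-hand side. *)
Lemma mj_add p q : I1 p -> I1 q -> I1 (p + q) -> f (p + q) = f p + f q.
Proof.
move=> pI qI pqI; have := fJ pqI I0; rewrite mj_zero !addr0 => ->.
by rewrite fJ.
Qed.

(** [f x] is the square of [f (sqrt x)]. Positivity with additivity gives monotonicity, and [f],
    fixed on fractions, is squeezed to the identity. *)
Lemma mj_ge0 x : 0 <= x -> x <= 1 -> 0 <= f x.
Proof.
move=> x0 x1; have s0 := sqrtr_ge0 x.
have s1 : Num.sqrt x <= 1 by rewrite -sqrtr1 ler_sqrt.
have sI := Ipos s0 s1.
by rewrite -(sqr_sqrtr x0) expr2 fM // -expr2 sqr_ge0.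
Qed.

Lemma mj_mono x y : 0 <= x -> x <= y -> y <= 1 -> f x <= f y.
Proof.
move=> x0 xy y1; rewrite -(subrKC x y) mj_add ?lerDl.
- by apply: mj_ge0; lra.
- by apply: Ipos; lra.
- by apply: Ipos; lra.
- by rewrite subrKC; apply: Ipos; lra.
Qed.

Lemma mj_nat x n : 0 <= x -> n%:R * x <= 1 -> f (n%:R * x) = n%:R * f x.
Proof.
move=> x0; elim: n => [|n IH]; first by rewrite !mul0r mj_zero.
rewrite -[n.+1]addn1 natrD mulrDl mul1r => H.
have nx0 : 0 <= n%:R * x by rewrite mulr_ge0.
have nx1 : n%:R * x <= 1 by lra.
by rewrite mj_add ?IH ?mulrDl ?mul1r //; apply: Ipos; lra.
Qed.

Lemma mj_frac k n : (0 < n)%N -> (k <= n)%N -> f (k%:R / n%:R) = k%:R / n%:R.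
Proof.
move=> n0 kn; have n0' : 0 < n%:R :> R by rewrite ltr0n.
have i0 : 0 <= n%:R^-1 :> R by rewrite invr_ge0 ltW.
have nn : n%:R / n%:R = 1 :> R by rewrite divff // gt_eqF.
have fi : f n%:R^-1 = n%:R^-1.
  have := @mj_nat n%:R^-1 n i0; rewrite nn f1 lexx => /(_ isT) E.
  by rewrite -[LHS](mulKf (_ : n%:R != 0)) ?gt_eqF // -E mulr1.
by rewrite mj_nat ?fi // ler_pdivrMr // mul1r ler_nat.
Qed.

Lemma frac_dense (x y : R) : 0 <= x -> x < y ->
  exists k n, [/\ (0 < n)%N, x < k%:R / n%:R & k%:R / n%:R < y].
Proof.
move=> x0 xy; have d0 : 0 < y - x by rewrite subr_gt0.
have [n nd] : exists n : nat, (y - x)^-1 < n%:R.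
  by exists (Num.bound (y - x)^-1); apply: archi_boundP; rewrite invr_ge0 ltW.
have n0 : 0 < n%:R :> R by apply: lt_trans nd; rewrite invr_gt0.
have [k0 Hk0] : exists k : nat, n%:R * x < k%:R.
  by exists (Num.bound (n%:R * x)); apply: archi_boundP; rewrite mulr_ge0 // ltW.
case: (ex_minnP (P := fun k => n%:R * x < k%:R) (ex_intro _ k0 Hk0)) => k Hk kmin.
exists k, n; split; first by rewrite -(ltr0n R).
  by rewrite ltr_pdivlMr // mulrC.
rewrite ltr_pdivrMr //; case: k Hk kmin => [|k] Hk kmin.
  by rewrite mulr_gt0 //; exact: le_lt_trans xy.
have kx : k%:R <= n%:R * x.
  by rewrite leNgt; apply/negP => /kmin; rewrite ltnn.
rewrite -[k.+1]addn1 natrD.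
have : 1 < n%:R * (y - x) by rewrite -ltr_pdivrMr // mul1r.
by rewrite mulrBr (mulrC y); lra.
Qed.

Lemma mj_id_pos x : 0 <= x -> x <= 1 -> f x = x.
Proof.
move=> x0 x1; have f0 := mj_ge0 x0 x1.
have fx1 : f x <= 1 by rewrite -f1; exact: mj_mono.
have frac_le k n : (0 < n)%N -> k%:R / n%:R <= 1 :> R -> (k <= n)%N.
  by move=> n0; rewrite ler_pdivrMr ?ltr0n // mul1r ler_nat.
case: (ltgtP (f x) x) => // H.
  have [k [n [n0 h1 h2]]] := frac_dense f0 H.
  have k1 : k%:R / n%:R <= 1 :> R := le_trans (ltW h2) x1.
  have := mj_mono (le_trans f0 (ltW h1)) (ltW h2) x1.
  by rewrite (mj_frac n0 (frac_le _ _ n0 k1)) leNgt h1.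
have [k [n [n0 h1 h2]]] := frac_dense x0 H.
have k1 : k%:R / n%:R <= 1 :> R := le_trans (ltW h2) fx1.
by have := mj_mono x0 (ltW h1) k1; rewrite (mj_frac n0 (frac_le _ _ n0 k1)) leNgt h2.
Qed.

Lemma multiplicative_jensen_id x : I1 x -> f x = x.
Proof.
move=> /andP[x1 x2]; case: (leP 0 x) => x0; first exact: mj_id_pos.
have := @mj_add x (- x); rewrite subrr mj_zero (mj_id_pos (x := - x)); [|lra..].
move=> H; have := H (ltac:(by apply/andP; split; lra))
  (ltac:(by apply/andP; split; lra)) I0; lra.
Qed.

End MultiplicativeJensen.

Section ThetaRigid.
Variable R : realType.
Local Notation C := R[i].

Lemma cplx_ReIm (z : C) : z + z^* = (2 * complex.Re z)%:C%C.
Proof.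
by rewrite conj_ReIm; apply: complexP; rewrite ?cReD ?cImD /=; ring.
Qed.

Variables (e : nat) (c : 'M[C]_(2 + e) -> 'M[C]_(2 + e)) (th : C -> C).
Hypothesis rc : rep c.
Hypothesis ut : uhom th.
Hypothesis cth : forall t, torus t -> c (diag_mx t) = diag_mx (\row_i th (t 0 i)).
Hypothesis thn : exists2 x, nm x = 1 & th x <> 1.

(** [Re (th s)] depends on [Re s] only, since [th] commutes with conjugation; lifting [x] to the
    upper half circle is one of two equivalent choices ([fRe]). *)
Let f (x : R) : R := complex.Re (th (x +i* Num.sqrt (1 - x ^+ 2))%C).

Lemma nm_sq (z : C) : complex.Re z ^+ 2 + complex.Im z ^+ 2 = nm z ^+ 2.
Proof. by apply: complexI; rewrite add_Re2_Im2 -nmE rmorphXn. Qed.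

Lemma Re_bound (s : C) : nm s = 1 -> -1 <= complex.Re s <= 1.
Proof. by move=> s1; rewrite -ler_norml -s1 Re_le_nm. Qed.

Lemma nm_lift (x : R) : -1 <= x <= 1 -> nm (x +i* Num.sqrt (1 - x ^+ 2))%C = 1.
Proof.
move=> /andP[x1 x2]; apply/eqP; rewrite -(@eqrXn2 _ 2) ?nm_ge0 // expr1n -nm_sq /=.
by rewrite sqr_sqrtr ?subrKC //; nra.
Qed.

Lemma fRe (s : C) : nm s = 1 -> f (complex.Re s) = complex.Re (th s).
Proof.
move=> s1; rewrite /f.
have -> : Num.sqrt (1 - complex.Re s ^+ 2) = `|complex.Im s|.
  by rewrite -sqrtr_sqr; congr Num.sqrt; have := nm_sq s; rewrite s1; lra.
have [i0|i0] := leP 0 (complex.Im s); first by rewrite ger0_norm //; case: s {s1 i0}.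
rewrite ltr0_norm //.
have -> : (complex.Re s +i* - complex.Im s)%C = s^* by rewrite conj_ReIm.
by rewrite uhomJ // conj_ReIm.
Qed.

Lemma lift01 : lift ord0 ord0 = 1 :> 'I_2. Proof. exact/val_inj. Qed.

Definition pair_row (s t : C) : 'rV[C]_2 := \row_i if i == 0 then s else t.

Definition blk (v : 'M[C]_2) (t : C) : 'M[C]_(2 + e) :=
  block_mx v 0 0 (diag_mx (const_mx t)).

Lemma blkM v t v' t' : blk v t *m blk v' t' = blk (v *m v') (t * t').
Proof.
rewrite /blk mulmx_block !mulmx0 !mul0mx !addr0 !add0r mulmx_diag.
by congr (block_mx _ _ _ (diag_mx _)); apply/rowP => i; rewrite !mxE.
Qed.

Lemma blk_star v t : mxstar (blk v t) = blk (mxstar v) t^*.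
Proof.
rewrite /blk /mxstar map_block_mx tr_block_mx !map_mx0 !trmx0 -/(mxstar (diag_mx _)).
rewrite mxstar_diag; congr (block_mx _ _ _ (diag_mx _)).
by apply/rowP => i; rewrite !mxE.
Qed.

Lemma blk_unitary v t : unitary v -> nm t = 1 -> unitary (blk v t).
Proof.
move=> [v1 _] t1; apply: unitaryP; rewrite blk_star blkM v1 mulrC (proj2 (conj_nm1 _) t1).
rewrite /blk diag_const_mx; exact/esym/scalar_mx_block.
Qed.

Lemma blk_diag s t w : blk (diag_mx (pair_row s t)) w =
  diag_mx (row_mx (pair_row s t) (const_mx w)).
Proof. by rewrite diag_mx_row. Qed.

Lemma torus_row s t w : nm s = 1 -> nm t = 1 -> nm w = 1 ->
  torus (row_mx (pair_row s t) (const_mx w : 'rV[C]_e)).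
Proof.
move=> s1 t1 w1 i; rewrite !mxE; case: splitP => j _; rewrite !mxE //.
by case: ifP.
Qed.

(** The eigenvalues of [v] are [s] and its conjugate, so the trace of the image is [2 Re (th s)]
    plus the scalar block, and [Re s] is half the trace of [v]. *)
Lemma trace_blk v w : unitary v -> \det v = 1 -> nm w = 1 ->
  \tr (c (blk v w)) = (2 * f (complex.Re (\tr v) / 2))%:C%C + e%:R * th w.
Proof.
move=> vU v1 w1; have [V [t [VU T vE]]] := unitary_spectral vU.
pose s := t 0 0; pose s' := t 0 1.
have tE : t = pair_row s s'.
  apply/rowP => i; rewrite mxE; case: (eqVneq i 0) => [->//|i0].
  by congr (t 0 _); apply/val_inj; case: i i0 => -[|[|]].
have s1 : nm s = 1 := T 0.
have s'1 : nm s' = 1 := T 1.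
have ss' : s * s' = 1.
  move: v1; rewrite vE !det_mulmx mulrAC -det_mulmx (proj1 VU) det1 mul1r det_diag.
  by rewrite big_ord_recl big_ord1 lift01.
have s'E : s' = s^*.
  have sn : s != 0 by rewrite -nm_gt0 s1.
  by apply: (mulfI sn); rewrite ss' (proj2 (conj_nm1 _) s1).
have trv : \tr v = s + s^*.
  rewrite vE -mulmxA mxtrace_mulC -mulmxA (proj2 VU) mulmx1 mxtrace_diag.
  by rewrite big_ord_recl big_ord1 lift01 -s'E.
have -> : complex.Re (\tr v) / 2 = complex.Re s.
  by rewrite trv cplx_ReIm /= mulrC mulKf // pnatr_eq0.
have -> : blk v w = mxstar (blk V 1) *m diag_mx (row_mx (pair_row s s') (const_mx w)) *m blk V 1.
  by rewrite blk_star -blk_diag !blkM -tE -vE conjC1 mul1r mulr1.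
rewrite (trace_rep rc cth); last first.
- exact: torus_row.
- by apply: blk_unitary => //; exact: nm1.
rewrite big_split_ord /= big_ord_recl big_ord1 !row_mxEl !mxE /=.
rewrite s'E uhomJ // cplx_ReIm fRe //; congr (_ + _).
rewrite (eq_bigr (fun=> th w)); last by move=> i _; rewrite row_mxEr mxE.
by rewrite sumr_const card_ord mulr_natl.
Qed.

Definition rot2 (a b : R) : 'M[C]_2 := \matrix_(i, j)
  if i == 0 then (if j == 0 then a%:C%C else - b%:C%C)
  else (if j == 0 then b%:C%C else a%:C%C).

Lemma rot2_props a b : a ^+ 2 + b ^+ 2 = 1 -> unitary (rot2 a b) /\ \det (rot2 a b) = 1.
Proof.
move=> ab; have abC : a%:C%C * a%:C%C + b%:C%C * b%:C%C = 1 :> C.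
  by rewrite -!rmorphM -rmorphD -!expr2 ab.
have cR (x : R) : (x%:C%C : C)^* = x%:C%C by rewrite conj_ReIm /= oppr0.
split.
  apply: unitaryP; apply/matrixP => i j; rewrite !mxE big_ord_recl big_ord1 !mxE /=.
  case: i j => -[|[|//]] pi [[|[|//]] pj]; rewrite /= ?rmorphN /= !cR -?abC //=; try ring.
rewrite (expand_det_row _ 0) big_ord_recl big_ord1 /cofactor !det_mx11 !mxE /=.
by rewrite -[RHS]abC expr0 expr1; ring.
Qed.

(** The trace of the image of a rotation of cosine [a] times [diag (s, conj s, w, ..., w)] is
    computed twice: from the spectrum of the product, and linearly in [th s], [conj (th s)], [th w].
    Symmetrising in [s] gives [(A1 + A2) f (Re s) = 2 f (a Re s)], and [s = 1] gives
    [A1 + A2 = 2 f a]. *)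
Lemma f_mul a x : -1 <= a <= 1 -> -1 <= x <= 1 -> f (a * x) = f a * f x.
Proof.
move=> aI xI; pose b := Num.sqrt (1 - a ^+ 2).
have ab : a ^+ 2 + b ^+ 2 = 1.
  by rewrite sqr_sqrtr ?subrKC //; move: aI => /andP[*]; nra.
have [rU rd] := rot2_props ab.
pose X := c (blk (rot2 a b) 1).
pose A1 := X (lshift e 0) (lshift e 0); pose A2 := X (lshift e 1) (lshift e 1).
pose A3 := \sum_(i < e) X (rshift 2 i) (rshift 2 i).
have main s w : nm s = 1 -> nm w = 1 ->
   A1 * th s + A2 * (th s)^* + A3 * th w =
   (2 * f (a * complex.Re s))%:C%C + e%:R * th w.
  move=> s1 w1; have sJ : nm (s^*) = 1 by rewrite nmJ.
  have TT := torus_row s1 sJ w1; have UD := proj1 (unitary_diag _) TT.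
  have U1 := blk_unitary rU (nm1 R).
  pose v := rot2 a b *m diag_mx (pair_row s s^*).
  have UP : unitary (diag_mx (pair_row s s^*)).
    by apply/unitary_diag => i; rewrite mxE; case: ifP.
  have vU : unitary v by exact: unitaryM.
  have vd : \det v = 1.
    rewrite det_mulmx rd mul1r det_diag big_ord_recl big_ord1 !mxE /=.
    exact/conj_nm1.
  have vtr : complex.Re (\tr v) / 2 = a * complex.Re s.
    rewrite /mxtrace big_ord_recl big_ord1 /v !mul_mx_diag !mxE /= -mulrDr cplx_ReIm.
    by rewrite -rmorphM /= mulrCA mulrC mulKf // pnatr_eq0.
  rewrite -vtr -(trace_blk vU vd w1).
  have -> : blk v w = blk (rot2 a b) 1 *m diag_mx (row_mx (pair_row s s^*) (const_mx w)).
    by rewrite -blk_diag blkM mul1r.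
  rewrite (proj1 rc) // cth // -/X /mxtrace big_split_ord /= big_ord_recl big_ord1.
  rewrite !mul_mx_diag !mxE; congr (_ + _ + _).
  - by rewrite (unsplitK (inl _)) !mxE.
  - by rewrite lift01 (unsplitK (inl _)) !mxE -uhomJ.
  - rewrite /A3 mulr_suml; apply: eq_bigr => i _.
    by rewrite !mxE (unsplitK (inr _)) !mxE.
have th1 := uhom1 ut.
(* A value [th w <> 1] separates the scalar block from the rest. *)
have A3e : A3 = e%:R.
  have [w w1 thw] := thn.
  have := main 1 w (nm1 _) w1; have := main 1 1 (nm1 _) (nm1 _).
  rewrite th1 conjC1 !mulr1 => h1 h2.
  have : (A3 - e%:R) * (th w - 1) = 0.
    rewrite (_ : _ * _ = (A1 + A2 + A3 * th w) - e%:R * th w - ((A1 + A2 + A3) - e%:R)); last by ring.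
    by rewrite h1 h2; ring.
  move/eqP; rewrite mulf_eq0 !subr_eq0 => /orP[/eqP //|/eqP //].
have main2 s : nm s = 1 -> A1 * th s + A2 * (th s)^* = (2 * f (a * complex.Re s))%:C%C.
  move=> s1; have := main s 1 s1 (nm1 _); rewrite A3e => /addIr; exact.
have main3 s : nm s = 1 -> (A1 + A2) * (f (complex.Re s))%:C%C = (2 * f (a * complex.Re s))%:C%C.
  move=> s1; have sJ : nm (s^*) = 1 by rewrite nmJ.
  have h1 := main2 _ s1; have h2 := main2 _ sJ.
  rewrite uhomJ // conjCK (conj_ReIm s) /= in h2.
  have TF : th s + (th s)^* = 2 * (f (complex.Re s))%:C%C.
    by rewrite cplx_ReIm fRe // rmorphM rmorph_nat.
  move: h1 h2 TF; set K := (2 * f (a * _))%:C%C; set F := (f _)%:C%C.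
  move: K F => K F h1 h2 TF.
  apply: (@mulfI _ 2); first by rewrite pnatr_eq0.
  rewrite mulrCA -TF; have -> : 2 * K = K + K by ring.
  by rewrite -{1}h1 -h2; ring.
have A12 : A1 + A2 = (2 * f a)%:C%C.
  have := main3 1 (nm1 _); rewrite fRe ?nm1 // th1 /= (mulr1 a) => <-.
  exact/esym/mulr1.
have := main3 _ (nm_lift xI); rewrite A12 /= -rmorphM => /(@complexI R).
by rewrite -mulrA => /mulfI -> //; rewrite pnatr_eq0.
Qed.

(** Write the lifts as [P = s t] and [Q = s conj t] with [s^2 = P Q]. Both sides become
    [2 f (Re s) f (Re t)], using [(p + q) / 2 = Re s * Re t] and [f_mul]. *)
Lemma f_jensen p q : -1 <= p <= 1 -> -1 <= q <= 1 -> f p + f q = 2 * f ((p + q) / 2).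
Proof.
move=> pI qI.
pose P := (p +i* Num.sqrt (1 - p ^+ 2))%C; pose Q := (q +i* Num.sqrt (1 - q ^+ 2))%C.
have P1 : nm P = 1 := nm_lift pI. have Q1 : nm Q = 1 := nm_lift qI.
pose s := sqrtC (P * Q).
have s2 : s ^+ 2 = P * Q := sqrtCK _.
have s1 : nm s = 1.
  by apply/eqP; rewrite -(@eqrXn2 _ 2) ?nm_ge0 // -nmX s2 nmM P1 Q1 expr1n mulr1.
have sn : s != 0 by rewrite -nm_gt0 s1.
pose t := P / s.
have t1 : nm t = 1 by rewrite nmM nmV P1 s1 divr1.
have tJ : nm (t^*) = 1 by rewrite nmJ.
have stP : s * t = P by rewrite /t mulrC divfK.
have stQ : s * t^* = Q.
  have tn : t != 0 by rewrite -nm_gt0 t1.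
  apply: (mulIf tn); rewrite -mulrA (mulrC _ t) (proj2 (conj_nm1 _) t1) mulr1.
  by apply: (mulIf sn); rewrite -mulrA (mulrC t) stP -expr2 s2 mulrC.
have Pp : complex.Re P = p by []. have Qq : complex.Re Q = q by [].
rewrite -{1}Pp -{1}Qq !fRe // -{1}stP -{1}stQ (proj1 ut) // (proj1 ut s _ s1 tJ).
rewrite uhomJ // -cReD -mulrDr cplx_ReIm cReM /= mulr0 subr0 -!fRe //.
have -> : (p + q) / 2 = complex.Re s * complex.Re t.
  rewrite -Pp -Qq -stP -stQ -cReD -mulrDr cplx_ReIm cReM /= mulr0 subr0.
  by rewrite mulrA mulrAC mulfK ?pnatr_eq0 // mulrC.
by rewrite f_mul ?Re_bound //; ring.
Qed.

(** Once [th] preserves real parts, [th i] is [i] or [-i]; applying the same fact to [s * i]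
    expresses the imaginary part of [th s] through that sign. *)
Lemma theta_rigid : (forall s, nm s = 1 -> th s = s) \/ (forall s, nm s = 1 -> th s = s^*).
Proof.
have fE x : -1 <= x <= 1 -> f x = x.
  apply: multiplicative_jensen_id.
  - exact: f_mul.
  - exact: f_jensen.
  - by have := fRe (nm1 R); rewrite (uhom1 ut).
  - have [y y1 thy] := thn; exists (complex.Re y); first exact: Re_bound.
    rewrite fRe // => E; apply: thy; apply: complexP => //.
    have := nm_sq (th y); rewrite E (proj2 ut) // => /eqP.
    by rewrite expr1n -subr_eq0 addrAC subrr add0r sqrf_eq0 => /eqP.
have RE s : nm s = 1 -> complex.Re (th s) = complex.Re s.
  by move=> s1; rewrite -fRe // fE // Re_bound.
have i1 := nmi R.
have I2 : complex.Im (th 'i%C) ^+ 2 = 1.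
  by have := nm_sq (th 'i%C); rewrite (proj2 ut) // RE //= expr0n add0r expr1n.
have IE s : nm s = 1 -> complex.Im (th s) = complex.Im (th 'i%C) * complex.Im s.
  move=> s1; have i1s : nm (s * 'i%C) = 1 by rewrite nmM s1 i1 mulr1.
  have := RE _ i1s; rewrite (proj1 ut) // ReiNIm cReM (RE _ i1) /= mulr0 sub0r.
  by move/oppr_inj <-; rewrite mulrCA -expr2 I2 mulr1.
move: I2 => /eqP; rewrite sqrf_eq1 => /orP[/eqP E|/eqP E]; [left|right] => s s1.
  by apply: complexP; rewrite ?RE // IE // E mul1r.
by rewrite conj_ReIm; apply: complexP; rewrite ?RE // IE // E mulN1r.
Qed.

End ThetaRigid.

(** * Irreducible representations of dimension at most d *)

Section Dichotomy.
Variable R : realType.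
Local Notation C := R[i].

Lemma no_small_irrep d n (c : 'M[C]_d -> 'M[C]_n) : (1 < n)%N -> (n < d)%N ->
  rep c -> irreducible_rep c -> False.
Proof.
move=> n1 nd rc irr; have [P PU PD] := torus_rep_diag rc.
have [E _] := weights (rep_conj rc PU) PD (irreducible_conj irr PU) n1 (ltnW nd).
by move: nd; rewrite E ltnn.
Qed.

Lemma mxstar_conj m n (A : 'M[C]_(m, n)) :
  mxstar (map_mx Num.conj A) = map_mx Num.conj (mxstar A).
Proof. by rewrite /mxstar map_trmx. Qed.

Lemma unitary_conj n (u : 'M[C]_n) : unitary u -> unitary (map_mx Num.conj u).
Proof.
by move=> [u1 _]; apply: unitaryP; rewrite mxstar_conj -map_mxM u1 map_mx1.
Qed.

Lemma map_conjK m n (A : 'M[C]_(m, n)) : map_mx Num.conj (map_mx Num.conj A) = A.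
Proof. by apply/matrixP => i j; rewrite !mxE conjCK. Qed.

Theorem rep_dichotomy d (c : 'M[C]_d -> 'M[C]_d) : (1 < d)%N ->
  rep c -> irreducible_rep c ->
  exists U : 'M[C]_d, exists chi : 'M[C]_d -> C, [/\ unitary U,
    forall u, unitary u -> nm (chi u) = 1 &
    (forall u, unitary u -> U *m c u *m mxstar U = chi u *: u) \/
    (forall u, unitary u -> U *m c u *m mxstar U = chi u *: map_mx Num.conj u)].
Proof.
case: d c => [//|[//|e]] c d1 rc irr.
have [P [q [th [PU uq ut thn []]]]] := rep_theta d1 rc irr.
pose c' u := (q (\det u))^-1 *: (P *m c u *m mxstar P).
move=> rc0 cth0; have rc' : rep c' := rc0.
have cth t : torus t -> c' (diag_mx t) = diag_mx (\row_i th (t 0 i)) := @cth0 t.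
have qn u : unitary u -> q (\det u) != 0.
  by move=> uu; rewrite -nm_gt0 (proj2 uq) // nm_det_unitary.
have c'E u : unitary u -> P *m c u *m mxstar P = q (\det u) *: c' u.
  by move=> uu; rewrite /c' scalerA divff ?qn // scale1r.
have fin (G : 'M[C]_(e.+2)) (F : 'M[C]_(e.+2) -> 'M[C]_(e.+2)) :
    (forall u, unitary u -> G *m c' u *m mxstar G = F u) ->
    forall u, unitary u -> (G *m P) *m c u *m mxstar (G *m P) = q (\det u) *: F u.
  move=> H u uu; rewrite mxstarM !mulmxA -(mulmxA G P) -(mulmxA G (P *m c u)) c'E //.
  by rewrite -scalemxAr -scalemxAl H.
have qdet u : unitary u -> nm (q (\det u)) = 1.
  by move=> uu; rewrite (proj2 uq) // nm_det_unitary.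
have [tid|tconj] := theta_rigid rc' ut cth thn.
  have cid t : torus t -> c' (diag_mx t) = diag_mx t.
    by move=> T; rewrite cth //; congr diag_mx; apply/rowP => i; rewrite mxE tid.
  have [G GU HG] := rep_standard rc' cid ord0.
  exists (G *m P), (fun u => q (\det u)); split.
  - exact: unitaryM.
  - exact: qdet.
  - by left; exact: fin.
(* Entrywise conjugation turns the torus character into the identity; the result is conjugated back
   at the end. *)
pose c'' u := map_mx Num.conj (c' u).
have rc'' : rep c''.
  split=> [u v uu vv|u uu]; first by rewrite /c'' (proj1 rc') // map_mxM.
  by apply: unitary_conj; exact: (proj2 rc').
have cid t : torus t -> c'' (diag_mx t) = diag_mx t.
  move=> T; rewrite /c'' cth //; apply/matrixP => i j; rewrite !mxE.
  case: eqP => _; last by rewrite !mulr0n conjC0.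
  by rewrite !mulr1n tconj // conjCK.
have [G GU HG] := rep_standard rc'' cid ord0.
exists (map_mx Num.conj G *m P), (fun u => q (\det u)); split.
- by apply: unitaryM => //; exact: unitary_conj.
- exact: qdet.
right; apply: fin => u uu.
have := congr1 (map_mx Num.conj) (HG u uu).
by rewrite map_mxM map_mxM map_conjK mxstar_conj.
Qed.

End Dichotomy.

(** * Kernels along complex lines *)

Section Lines.
Variable R : realType.
Local Notation C := R[i].

Definition sqn n (z : 'cV[C]_n) : R := \sum_i nm (z i 0) ^+ 2.

Lemma cinner_sqn n (z : 'cV[C]_n) : cinner z z = (sqn z)%:C%C.
Proof. rewrite /cinner /sqn rmorph_sum; apply: eq_bigr => i _; exact/esym/nm_sqr. Qed.

Lemma in_ballE n (z : 'cV[C]_n) : in_ball z <-> sqn z < 1.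
Proof. by rewrite /in_ball cinner_sqn -(rmorph1 (real_complex R)) ltcR. Qed.

Lemma cinnerE n (z w : 'cV[C]_n) : cinner z w = (mxstar w *m z) 0 0.
Proof. by rewrite !mxE; apply: eq_bigr => i _; rewrite mxstarE mulrC. Qed.

Lemma cinner_unitary n (u : 'M[C]_n) z w : unitary u ->
  cinner (u *m z) (u *m w) = cinner z w.
Proof.
move=> [u1 _]; rewrite !cinnerE mxstarM mulmxA -(mulmxA (mxstar w)) u1 mulmx1 //.
Qed.

Lemma in_ball_unitary n (u : 'M[C]_n) z : unitary u -> in_ball (u *m z) <-> in_ball z.
Proof. by move=> uu; rewrite /in_ball cinner_unitary. Qed.

Lemma hol_line d m n (f : 'cV[C]_d -> 'M[C]_(m, n))
    (z0 v : ('cV[C]_d : normedModType C)) (l : C) i j :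
  differentiable (f : _ -> ('M[C]_(m, n) : normedModType C)) (z0 + l *: v) ->
  cdiff (fun l => f (z0 + l *: v) i j) l.
Proof.
move=> /(@diff_derivable _ _ _ _ _ v) => H.
move: H; rewrite /derivable => /cvg_ex[D HD].
exists (D i j) => e e0; have e0C : 0 < e%:C%C :> C by rewrite ltcR.
move/cvg_ballP: HD => /(_ _ e0C) /nbhs_ballP[dC /= dC0 Hd].
(* Radii of balls over [C] are elements of [C]; a positive one is real. *)
have [dl dE] : exists dl : R, dC = dl%:C%C.
  by exists (complex.Re dC); rewrite RRe_real // gtr0_real.
move: dC0 Hd; rewrite {}dE => dC0 Hd; rewrite ltcR in dC0.
exists dl => // w wd; have [->|wl] := eqVneq w l.
  by rewrite !subrr mulr0 subr0 nm0 mulr0.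
have h0 : w - l != 0 by rewrite subr_eq0.
have := Hd (w - l); rewrite /ball /= sub0r normrN -nmE ltcR => /(_ wd h0).
case=> _ /(_ i j); rewrite /ball /= -nmE ltcR /shift /= => /ltW.
have -> : (w - l) *: v + (z0 + l *: v) = z0 + w *: v.
  by rewrite addrCA -scalerDl subrK.
rewrite !mxE => K.
have -> : f (z0 + w *: v) i j - f (z0 + l *: v) i j - D i j * (w - l) =
  - (D i j - (w - l)^-1 * (f (z0 + w *: v) i j - f (z0 + l *: v) i j)) * (w - l).
  by field.
by rewrite nmM nmN ler_wpM2r ?nm_ge0.
Qed.

Lemma cdiff_conj (g : C -> C) z : cdiff g (z^*) -> cdiff (fun z => (g (z^*))^*) z.
Proof.
move=> [A H]; exists (A^*) => e e0; have [d d0 Hd] := H _ e0; exists d => // w wd.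
have wE : nm (w^* - z^*) = nm (w - z) by rewrite -rmorphB nmJ.
have := Hd (w^*); rewrite wE => /(_ wd).
rewrite -(nmJ (_ - A * _)) (rmorphB _ _ (A * _)) (rmorphB _ (g _)) rmorphM rmorphB.
by rewrite /= !conjCK.
Qed.

(* All that the argument uses of [sesqui_analytic]. *)
Definition line_analytic d n (K : 'cV[C]_d -> 'cV[C]_d -> 'M[C]_n) : Prop :=
  (forall w z0 v l i j, in_ball w -> in_ball (z0 + l *: v) ->
    cdiff (fun l => K (z0 + l *: v) w i j) l) /\
  (forall z w0 v l i j, in_ball z -> in_ball (w0 + l *: v) ->
    cdiff (fun l => (K z (w0 + l *: v) i j)^*) l).

Lemma sesqui_line_analytic d n (K : 'cV[C]_d -> 'cV[C]_d -> 'M[C]_n) :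
  sesqui_analytic K -> line_analytic K.
Proof.
move=> [Kz Kw]; split=> [w z0 v l i j wB zB|z w0 v l i j zB wB].
  by apply: (@hol_line _ _ _ (fun z => K z w)); exact: Kz.
have := @hol_line _ _ _ (fun w => map_mx Num.conj (K z w)) w0 v l i j.
by move=> /(_ (Kw z zB _ wB)); apply: cdiff_eq => t; rewrite mxE.
Qed.

Lemma cdiff_sum (I : finType) (f : I -> C -> C) l :
  (forall i, cdiff (f i) l) -> cdiff (fun l => \sum_i f i l) l.
Proof.
move=> H; have : forall s : seq I, cdiff (fun l => \sum_(i <- s) f i l) l; last exact.
elim=> [|i s IH].
  by apply: (@cdiff_eq _ (fun=> 0)) => [t|]; [rewrite big_nil|exact: cdiff_cst].
apply: (@cdiff_eq _ (fun l => f i l + \sum_(i <- s) f i l)) => [t|].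
  by rewrite big_cons.
exact: cdiffD.
Qed.

Lemma line_analytic_mulmx d n (P Q : 'M[C]_n) (K : 'cV[C]_d -> 'cV[C]_d -> 'M[C]_n) :
  line_analytic K -> line_analytic (fun z w => P *m K z w *m Q).
Proof.
move=> [Kz Kw]; split=> [w z0 v l i j wB zB|z w0 v l i j zB wB].
  apply: (@cdiff_eq _ (fun l => \sum_k \sum_m P i m * K (z0 + l *: v) w m k * Q k j)) => [t|].
    by rewrite !mxE; apply: eq_bigr => k _; rewrite !mxE mulr_suml.
  apply: cdiff_sum => k; apply: cdiff_sum => m.
  apply: (@cdiffM _ (fun l => _ * _) (fun=> _)); last exact: cdiff_cst.
by apply: (@cdiffM _ (fun=> _)); [exact: cdiff_cst|exact: Kz].
apply: (@cdiff_eq _ (fun l => \sum_k \sum_m (P i m)^* * (K z (w0 + l *: v) m k)^* * (Q k j)^*)) => [t|].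
  rewrite !mxE rmorph_sum; apply: eq_bigr => k _; rewrite !mxE mulr_suml rmorph_sum.
  by apply: eq_bigr => m _; rewrite !rmorphM.
apply: cdiff_sum => k; apply: cdiff_sum => m.
apply: (@cdiffM _ (fun l => _ * _) (fun=> _)); last exact: cdiff_cst.
by apply: (@cdiffM _ (fun=> _)); [exact: cdiff_cst|exact: Kw].
Qed.

Lemma line_analytic_tr d n (K : 'cV[C]_d -> 'cV[C]_d -> 'M[C]_n) :
  line_analytic K -> line_analytic (fun z w => (K z w)^T).
Proof.
move=> [Kz Kw]; split=> [w z0 v l i j wB zB|z w0 v l i j zB wB].
  by apply: cdiff_eq (Kz w z0 v l j i wB zB) => t; rewrite mxE.
by apply: cdiff_eq (Kw z w0 v l j i zB wB) => t; rewrite mxE.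
Qed.

End Lines.

(** * Covariant kernels on pairs of vectors *)

Section Structure.
Variable R : realType.
Local Notation C := R[i].
Variable e : nat.
Local Notation d := e.+2.
Variable L : 'cV[C]_d -> 'cV[C]_d -> 'M[C]_d.
Hypothesis La : line_analytic L.
Hypothesis Li : forall u z w, unitary u -> in_ball z -> in_ball w ->
  L (u *m z) (u *m w) = u *m L z w *m mxstar u.

Definition i1 : 'I_d := lift ord0 ord0.

Definition vec (a b : C) : 'cV[C]_d :=
  \col_i if i == ord0 then a else if i == i1 then b else 0.

Lemma sum_vec (F : 'I_d -> R) : (forall i, i != ord0 -> i != i1 -> F i = 0) ->
  \sum_i F i = F ord0 + F i1.
Proof.
move=> H; rewrite !big_ord_recl big1 ?addr0 // => i _.
by apply: H; rewrite -val_eqE.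
Qed.

Lemma sqn_vec a b : sqn (vec a b) = nm a ^+ 2 + nm b ^+ 2.
Proof.
rewrite /sqn sum_vec; first by rewrite !mxE.
by move=> i /negbTE i0 /negbTE i1n; rewrite mxE i0 i1n nm0 expr0n.
Qed.

Lemma ball_vec a b : in_ball (vec a b) <-> nm a ^+ 2 + nm b ^+ 2 < 1.
Proof. by rewrite in_ballE sqn_vec. Qed.

Lemma nm_sq_lt1 (a : C) : (nm a ^+ 2 < 1) = (nm a < 1).
Proof. by rewrite expr_lt1 ?nm_ge0. Qed.

Lemma ball_vec0 a : in_ball (vec a 0) <-> nm a < 1.
Proof. by rewrite ball_vec nm0 expr0n addr0 nm_sq_lt1. Qed.

Lemma ball_vec0' a : nm a < 1 -> in_ball (vec a 0).
Proof. by move/ball_vec0. Qed.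

Lemma vec_line1 a b : vec a b = vec a 0 + b *: vec 0 1.
Proof.
apply/colP => i; rewrite !mxE; case: ifP => _; first by rewrite mulr0 addr0.
by case: ifP => _; rewrite ?mulr1 ?mulr0 ?add0r.
Qed.

Lemma vec_line0 a b : vec a b = vec 0 b + a *: vec 1 0.
Proof.
apply/colP => i; rewrite !mxE; case: ifP => _; first by rewrite mulr1 add0r.
by case: ifP => _; rewrite ?mulr0 ?addr0.
Qed.

Lemma diag_vec (t : 'rV[C]_d) a b :
  diag_mx t *m vec a b = vec (t 0 ord0 * a) (t 0 i1 * b).
Proof.
rewrite mul_diag_mx; apply/colP => i; rewrite !mxE.
by case: eqP => [->//|_]; case: eqP => [->|_]; rewrite ?mulr0.
Qed.

Lemma L_diag t z w i j : torus t -> in_ball z -> in_ball w ->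
  L (diag_mx t *m z) (diag_mx t *m w) i j = t 0 i * L z w i j * (t 0 j)^*.
Proof.
move=> T zB wB; rewrite Li //; last exact/unitary_diag.
by rewrite mxstar_diag mul_mx_diag mul_diag_mx !mxE.
Qed.

Lemma L_perm (s : 'S_d) z w i j : in_ball z -> in_ball w ->
  L (perm_mx s *m z) (perm_mx s *m w) i j = L z w (s i) (s j).
Proof.
move=> zB wB; rewrite Li //; last exact: unitary_perm.
rewrite mxstar_tC tr_perm_mx map_perm_mx -row_permE -{1}(invgK s) -col_permE.
by rewrite !mxE ?invgK.
Qed.

Lemma in_ball_sqrt (z1 l : C) : nm z1 < 1 -> nm l < Num.sqrt (1 - nm z1 ^+ 2) <-> in_ball (vec z1 l).
Proof.
move=> z11; rewrite ball_vec (addrC (nm z1 ^+ 2)) -ltrBrDr.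
have p0 : 0 <= 1 - nm z1 ^+ 2 by rewrite subr_ge0 ltW // nm_sq_lt1.
by rewrite -[nm l < _](@ltr_pXn2r _ 2) ?nnegrE ?nm_ge0 ?sqrtr_ge0 // sqr_sqrtr.
Qed.

Lemma ser_line1 z1 w1 i j : nm z1 < 1 -> nm w1 < 1 ->
  exists p, ser p (Num.sqrt (1 - nm z1 ^+ 2))
    (fun l => L (vec z1 l) (vec w1 0) i j).
Proof.
move=> z11 w11; pose r := Num.sqrt (1 - nm z1 ^+ 2).
have r0 : 0 < r by rewrite sqrtr_gt0 subr_gt0 nm_sq_lt1.
exists (fun k => coef (fun l => L (vec z1 l) (vec w1 0) i j) k (r / 2)).
apply: hol_series; last 2 first.
- by rewrite divr_gt0.
- by rewrite ltr_pdivrMr // mulr_natr mulr2n ltrDl.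
move=> l lr; apply: (@cdiff_eq _ (fun l => L (vec z1 0 + l *: vec 0 1) (vec w1 0) i j)).
  by move=> x; rewrite -vec_line1.
apply: (proj1 La) => //; first exact: ball_vec0'.
by rewrite -vec_line1; exact/in_ball_sqrt.
Qed.

Definition rot1 (s : C) : 'rV[C]_d := \row_i if i == ord0 then 1 else s.

Lemma torus_rot1 s : nm s = 1 -> torus (rot1 s).
Proof. by move=> s1 i; rewrite mxE; case: ifP => // _; exact: nm1. Qed.

Lemma L_rot1 s z1 l w1 i j : nm s = 1 -> in_ball (vec z1 l) -> nm w1 < 1 ->
  L (vec z1 (s * l)) (vec w1 0) i j =
  rot1 s 0 i * L (vec z1 l) (vec w1 0) i j * (rot1 s 0 j)^*.
Proof.
move=> s1 zB w1B; rewrite -(L_diag i j (torus_rot1 s1) zB (ball_vec0' w1B)).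
by rewrite !diag_vec !mxE /= !mul1r mulr0.
Qed.

Lemma sqrt_gt0 (z1 : C) : nm z1 < 1 -> 0 < Num.sqrt (1 - nm z1 ^+ 2).
Proof. by move=> z11; rewrite sqrtr_gt0 subr_gt0 nm_sq_lt1. Qed.

Lemma in_ball_z1 z1 z2 : in_ball (vec z1 z2) -> nm z1 < 1.
Proof.
move/ball_vec => H; rewrite -nm_sq_lt1; apply: le_lt_trans H.
by rewrite lerDl sqr_ge0.
Qed.

(** Rotating all coordinates but the first fixes [w] and multiplies [z2] by [s]. For these entries
    the phases cancel, so the power series in [z2] is rotation-invariant, hence constant. *)
Lemma L_const z1 z2 w1 i j : in_ball (vec z1 z2) -> nm w1 < 1 ->
  (i == ord0) = (j == ord0) ->
  L (vec z1 z2) (vec w1 0) i j = L (vec z1 0) (vec w1 0) i j.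
Proof.
move=> zB w1B ij; have z11 := in_ball_z1 zB.
have [p ps] := ser_line1 i j z11 w1B.
have p0 : forall l, l <> 0%N -> p l = 0.
  move=> l l0; apply: (@ser_rot _ p _ _ 0 0 (sqrt_gt0 z11) ps) => // s z s1 zr.
  rewrite !expr0 !mul1r L_rot1 //; last exact/in_ball_sqrt.
  rewrite !mxE -ij; case: ifP => _; first by rewrite conjC1 mul1r mulr1.
  by rewrite mulrAC (proj2 (conj_nm1 _) s1) mul1r.
have H l : in_ball (vec z1 l) -> L (vec z1 l) (vec w1 0) i j = p 0%N.
  by move=> lB; rewrite (ser_single ps p0) ?expr0 ?mulr1 //; exact/in_ball_sqrt.
by rewrite !H //; exact: ball_vec0'.
Qed.

(** Under the same rotation the entry would have to scale like the power -1 of [z2], which no power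
    series does. *)
Lemma L_row0 z1 z2 w1 j : in_ball (vec z1 z2) -> nm w1 < 1 -> j != ord0 ->
  L (vec z1 z2) (vec w1 0) ord0 j = 0.
Proof.
move=> zB w1B j0; have z11 := in_ball_z1 zB.
have [p ps] := ser_line1 ord0 j z11 w1B.
apply: (ser_zero ps); last exact/in_ball_sqrt.
move=> l; apply: (@ser_rot _ p _ _ 1 0 (sqrt_gt0 z11) ps) => // s z s1 zr.
rewrite expr0 expr1 mul1r L_rot1 //; last exact/in_ball_sqrt.
by rewrite !mxE eqxx (negbTE j0) mul1r mulrCA (proj2 (conj_nm1 _) s1) mulr1.
Qed.

Lemma L_col0 z1 w1 i : nm z1 < 1 -> nm w1 < 1 -> i != ord0 ->
  exists p, forall z2, in_ball (vec z1 z2) -> L (vec z1 z2) (vec w1 0) i ord0 = p * z2.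
Proof.
move=> z11 w1B i0; have [p ps] := ser_line1 i ord0 z11 w1B.
have p0 : forall l, l <> 1%N -> p l = 0.
  move=> l l0; apply: (@ser_rot _ p _ _ 0 1 (sqrt_gt0 z11) ps) => // s z s1 zr.
  rewrite expr0 expr1 mul1r L_rot1 //; last exact/in_ball_sqrt.
  by rewrite !mxE eqxx (negbTE i0) conjC1 mulr1.
exists (p 1%N) => z2 zB; rewrite (ser_single ps p0) ?expr1 //.
exact/in_ball_sqrt.
Qed.

(** Changing the sign of coordinate [i] fixes both vectors and negates the entry. *)
Lemma L_col0_zero z1 z2 w1 i : in_ball (vec z1 z2) -> nm w1 < 1 ->
  i != ord0 -> i != i1 -> L (vec z1 z2) (vec w1 0) i ord0 = 0.
Proof.
move=> zB w1B i0 in1; have n1 : nm (-1 : C) = 1 by rewrite nmN nm1.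
have := L_diag i ord0 (torus_single i n1) zB (ball_vec0' w1B).
rewrite !diag_vec !mxE eqxx [ord0 == i]eq_sym (negbTE i0) [i1 == i]eq_sym (negbTE in1).
rewrite !mul1r conjC1 mulr1 mulN1r => /eqP.
by rewrite -addr_eq0 -mulr2n mulrn_eq0 => /eqP.
Qed.

Lemma L_offdiag z1 w1 i j : nm z1 < 1 -> nm w1 < 1 -> i != ord0 -> i != j ->
  L (vec z1 0) (vec w1 0) i j = 0.
Proof.
move=> z1B w1B i0 ij; have n1 : nm (-1 : C) = 1 by rewrite nmN nm1.
have := L_diag i j (torus_single i n1) (ball_vec0' z1B) (ball_vec0' w1B).
rewrite !diag_vec !mxE eqxx [ord0 == i]eq_sym (negbTE i0) [j == i]eq_sym (negbTE ij).
rewrite !mul1r !mulr0 conjC1 mulr1 mulN1r => /eqP.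
by rewrite -addr_eq0 -mulr2n mulrn_eq0 => /eqP.
Qed.

Lemma perm_vec0 (s : 'S_d) a : s ord0 = ord0 -> perm_mx s *m vec a 0 = vec a 0.
Proof.
move=> s0; apply/colP => i; rewrite -row_permE !mxE !if_same.
by rewrite -{1}s0 (inj_eq perm_inj).
Qed.

Lemma L_diag_eq z1 w1 i : nm z1 < 1 -> nm w1 < 1 -> i != ord0 ->
  L (vec z1 0) (vec w1 0) i i = L (vec z1 0) (vec w1 0) i1 i1.
Proof.
move=> z1B w1B i0; have s0 : tperm i1 i ord0 = ord0 by rewrite tpermD.
have := L_perm (tperm i1 i) i i (ball_vec0' z1B) (ball_vec0' w1B).
by rewrite !perm_vec0 // tpermR.
Qed.

Definition LF z1 w1 := L (vec z1 0) (vec w1 0) ord0 ord0.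
Definition LG z1 w1 := L (vec z1 0) (vec w1 0) i1 i1.

Lemma L_form z1 z2 w1 : in_ball (vec z1 z2) -> nm w1 < 1 ->
  L (vec z1 z2) (vec w1 0) = LG z1 w1 *: 1%:M +
    (LF z1 w1 - LG z1 w1) *: delta_mx ord0 ord0 +
    L (vec z1 z2) (vec w1 0) i1 ord0 *: delta_mx i1 ord0.
Proof.
move=> zB w1B; have z11 := in_ball_z1 zB; apply/matrixP => i j.
have [->|i0] := eqVneq i ord0.
  have [->|j0] := eqVneq j ord0.
    by rewrite !mxE !eqxx L_const //= mulr1n !mulr1 mulr0 addr0 subrKC.
  by rewrite L_row0 // !mxE [ord0 == j]eq_sym (negbTE j0) /= !mulr0 !addr0.
have [->|j0] := eqVneq j ord0.
  have [->|in1] := eqVneq i i1; first by rewrite !mxE !eqxx /= !(mulr0, mulr1, add0r).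
  by rewrite L_col0_zero // !mxE (negbTE i0) (negbTE in1) /= !(mulr0, addr0).
rewrite L_const ?(negbTE i0) ?(negbTE j0) // !mxE (negbTE i0) (negbTE j0) /= andbF.
rewrite !mulr0 !addr0; have [<-|ij] := eqVneq i j.
  by rewrite L_diag_eq // mulr1.
by rewrite L_offdiag // mulr0.
Qed.

(** Conjugating the second argument makes the entry holomorphic in both variables; invariance under
    scalar unitaries is then the hypothesis of [two_var]. *)
Lemma two_var_entry i : exists a F, ser a 1 F /\ forall z1 w1, nm z1 < 1 -> nm w1 < 1 ->
  L (vec z1 0) (vec w1 0) i i = F (z1 * w1^*).
Proof.
pose psi z v := L (vec z 0) (vec (v^*) 0) i i.
have := @two_var R psi.
case=> [v z v1 z1B|z v z1B v1|s z v s1 z1B v1|a [F [aF H]]].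
- apply: (@cdiff_eq _ (fun l => L (vec 0 0 + l *: vec 1 0) (vec (v^*) 0) i i)).
    by move=> l; rewrite -vec_line0.
  apply: (proj1 La) => //; first by apply: ball_vec0'; rewrite nmJ.
  by rewrite -vec_line0; exact: ball_vec0'.
- apply: (@cdiff_eq _ (fun l => ((L (vec z 0) (vec 0 0 + l^* *: vec 1 0) i i)^*)^*)).
    by move=> l; rewrite -vec_line0 conjCK.
  apply: (@cdiff_conj _ (fun l => (L (vec z 0) (vec 0 0 + l *: vec 1 0) i i)^*)).
  apply: (proj2 La) => //; first exact: ball_vec0'.
  by rewrite -vec_line0; apply: ball_vec0'; rewrite nmJ.
- rewrite /psi.
  have T : torus (const_mx s : 'rV[C]_d) by move=> k; rewrite mxE.
  have svB : nm ((s * v)^*) < 1 by rewrite nmJ nmM s1 mul1r.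
  have := L_diag i i T (ball_vec0' z1B) (ball_vec0' svB).
  rewrite !diag_vec !mxE mulr0 rmorphM mulrA (proj2 (conj_nm1 _) s1) mul1r => ->.
  by rewrite mulrAC (proj2 (conj_nm1 _) s1) mul1r.
exists a, F; split=> // z1 w1 z1B w1B; rewrite -H ?nmJ // /psi conjCK //.
Qed.

(** The counterpart of [L_row0] in the second argument: the conjugate entry is holomorphic in [w2]
    and of weight -1 under rotation. *)
Lemma L_col0_anti z1 w1 w2 : nm z1 < 1 -> in_ball (vec w1 w2) ->
  L (vec z1 0) (vec w1 w2) i1 ord0 = 0.
Proof.
move=> z1B wB; have w1B := in_ball_z1 wB.
pose r := Num.sqrt (1 - nm w1 ^+ 2).
have r0 : 0 < r := sqrt_gt0 w1B.
pose g l := (L (vec z1 0) (vec w1 l) i1 ord0)^*.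
have ps : ser (fun k => coef g k (r / 2)) r g.
  apply: hol_series; last 2 first.
  - by rewrite divr_gt0.
  - by rewrite ltr_pdivrMr // mulr_natr mulr2n ltrDl.
  move=> l lr; apply: (@cdiff_eq _ (fun l => (L (vec z1 0) (vec w1 0 + l *: vec 0 1) i1 ord0)^*)).
    by move=> x; rewrite -vec_line1.
  apply: (proj2 La) => //; first exact: ball_vec0'.
  by rewrite -vec_line1; exact/in_ball_sqrt.
have g0 : g w2 = 0.
  apply: (ser_zero ps); last exact/in_ball_sqrt.
  move=> l; apply: (@ser_rot _ _ _ _ 1 0 r0 ps) => // s w s1 wr.
  rewrite expr1 expr0 mul1r /g.
  have := L_diag i1 ord0 (torus_rot1 s1) (ball_vec0' z1B) (proj1 (in_ball_sqrt w w1B) wr).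
  rewrite !diag_vec !mxE /= !mul1r mulr0 conjC1 mulr1 => ->.
  by rewrite rmorphM mulrA (proj2 (conj_nm1 _) s1) mul1r.
by move/eqP: g0; rewrite conjC_eq0 => /eqP.
Qed.

Definition rot01 (a b : R) : 'M[C]_d :=
  \matrix_(i, j) if i == ord0 then
      (if j == ord0 then a%:C%C else if j == i1 then b%:C%C else 0)
    else if i == i1 then
      (if j == ord0 then - b%:C%C else if j == i1 then a%:C%C else 0)
    else (i == j)%:R.

Lemma sumC_vec (F : 'I_d -> C) : (forall i, i != ord0 -> i != i1 -> F i = 0) ->
  \sum_i F i = F ord0 + F i1.
Proof.
move=> H; rewrite !big_ord_recl big1 ?addr0 // => i _.
by apply: H; rewrite -val_eqE.
Qed.

Lemma conjR (x : R) : (x%:C%C : C)^* = x%:C%C.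
Proof. by rewrite conj_ReIm /= oppr0. Qed.

Lemma rot01_unitary a b : a ^+ 2 + b ^+ 2 = 1 -> unitary (rot01 a b).
Proof.
move=> ab; have abC : a%:C%C * a%:C%C + b%:C%C * b%:C%C = 1 :> C.
  by rewrite -!rmorphM -rmorphD -!expr2 ab.
apply: unitaryP; apply/matrixP => i j; rewrite !mxE.
have [i00|i0] := eqVneq i ord0; last have [i11|in1] := eqVneq i i1.
- rewrite sumC_vec; last first.
    move=> k k0 k1; rewrite !mxE (negbTE k0) (negbTE k1) i00 (negbTE k0).
    by rewrite conjC0 mul0r.
  rewrite !mxE i00 /= rmorphN /= !conjR.
  have [j00|j0] := eqVneq j ord0; first by rewrite mulr1n -abC; ring.
  by rewrite mulr0n; case: ifP => _; ring.
- rewrite sumC_vec; last first.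
    move=> k k0 k1; rewrite !mxE (negbTE k0) (negbTE k1) i11 (negbTE k1).
    by rewrite conjC0 mul0r.
  rewrite !mxE i11 /= !conjR.
  have [j00|j0] := eqVneq j ord0; first by rewrite j00 mulr0n /=; ring.
  have [j11|j1] := eqVneq j i1; first by rewrite mulr1n -abC; ring.
  by rewrite !mulr0 addr0.
- rewrite (bigD1 i) //= big1 ?addr0.
    rewrite !mxE (negbTE i0) (negbTE in1) eqxx conjC1 mul1r.
    by [].
  move=> k ki; rewrite !mxE (negbTE i0) (negbTE in1) (negbTE ki).
  by case: ifP => _; [|case: ifP => _]; rewrite conjC0 mul0r.
Qed.

Lemma rot01_vec a b x y : rot01 a b *m vec x y =
  vec (a%:C%C * x + b%:C%C * y) (- b%:C%C * x + a%:C%C * y).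
Proof.
apply/colP => i; rewrite !mxE sumC_vec; last first.
  by move=> k k0 k1; rewrite !mxE (negbTE k0) (negbTE k1) mulr0.
rewrite !mxE /=; case: ifP => // i0; case: ifP => // in1.
by rewrite ?i0 !mul0r addr0.
Qed.

Lemma sandwich3 n (P Q M N : 'M[C]_n) (s t r : C) i j :
  (P *m (s *: 1%:M + t *: M + r *: N) *m Q) i j =
  s * (P *m Q) i j + t * (P *m M *m Q) i j + r * (P *m N *m Q) i j.
Proof.
rewrite !mulmxDr !mulmxDl -!scalemxAr -!scalemxAl mulmx1.
by move: (P *m Q) (P *m M *m Q) (P *m N *m Q) => X Y Z; rewrite !mxE.
Qed.

(* Compare the two kernels at [z = vec z1 0], [w = vec w1 w2] before and after
   rotating [w] onto the first axis. *)
Lemma L_col0_rel x r z2 : nm x < 1 -> 0 < r -> r < 1 -> in_ball (vec x z2) ->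
  L (vec x z2) (vec r%:C%C 0) i1 ord0 * x =
  z2 * (LF x r%:C%C - LG x r%:C%C).
Proof.
move=> x1 r0 r1 zB; pose rC : C := r%:C%C.
have rB : nm rC < 1 by rewrite nmR gtr0_norm.
have nx := nm_ge0 x.
(* The cosine of the rotation: above [nm x], so that [x = c z1] with [z1] in the disc, and below 1,
   so that the sine [b] can be cancelled. *)
pose c : R := (1 + nm x) / 2.
have c0 : 0 < c by rewrite /c; lra.
have c1 : c < 1 by rewrite /c; lra.
have xc : nm x < c by rewrite /c; lra.
pose b : R := Num.sqrt (1 - c ^+ 2).
have b2 : b ^+ 2 = 1 - c ^+ 2 by rewrite sqr_sqrtr //; nra.
have b0 : 0 < b by rewrite sqrtr_gt0; nra.
have cb : c ^+ 2 + b ^+ 2 = 1 by rewrite b2 subrKC.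
have cn : c%:C%C != 0 :> C by rewrite -nm_gt0 nmR gtr0_norm.
have bn : b%:C%C != 0 :> C by rewrite -nm_gt0 nmR gtr0_norm.
have cbC : c%:C%C * c%:C%C + b%:C%C * b%:C%C = 1 :> C.
  by rewrite -!rmorphM -rmorphD -!expr2 cb.
pose z1 := x / c%:C%C.
have z1B : nm z1 < 1 by rewrite nmM nmV nmR gtr0_norm // ltr_pdivrMr // mul1r.
pose w1 : C := c%:C%C * rC; pose w2 : C := b%:C%C * rC.
have uu := rot01_unitary cb.
have uw : rot01 c b *m vec w1 w2 = vec rC 0.
  rewrite rot01_vec /w1 /w2; congr vec; last by ring.
  by rewrite -[RHS]mul1r -cbC; ring.
have uz : rot01 c b *m vec z1 0 = vec x (- b%:C%C * z1).
  by rewrite rot01_vec !mulr0 !addr0 /z1; congr vec; rewrite mulrC divfK.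
have wB : in_ball (vec w1 w2).
  by apply/(in_ball_unitary _ uu); rewrite uw; exact: ball_vec0'.
have zB0 : in_ball (vec z1 0) by exact: ball_vec0'.
have zB1 : in_ball (vec x (- b%:C%C * z1)) by rewrite -uz; exact/in_ball_unitary.
have E : L (vec z1 0) (vec w1 w2) =
    mxstar (rot01 c b) *m L (vec x (- b%:C%C * z1)) (vec rC 0) *m rot01 c b.
  rewrite -uw -uz Li // !mulmxA (proj1 uu) mul1mx -mulmxA (proj1 uu) mulmx1 //.
have [p Hp] := L_col0 x1 rB (isT : i1 != ord0).
have := L_col0_anti z1B wB; rewrite E (L_form zB1 rB) (Hp _ zB1) -/rC.
set F := LF x rC; set G := LG x rC.
have Ed k : (mxstar (rot01 c b) *m delta_mx k ord0 *m rot01 c b) i1 ord0 =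
    (rot01 c b k i1)^* * c%:C%C.
  rewrite mxE (bigD1 ord0) //= big1 ?addr0.
    rewrite !mxE (bigD1 k) //= big1 ?addr0; first by rewrite !mxE !eqxx mulr1.
    by move=> l lk; rewrite !mxE (negbTE lk) mulr0.
  move=> l l0; rewrite mxE big1 ?mul0r // => m _.
  by rewrite !mxE (negbTE l0) andbF mulr0.
rewrite sandwich3 (proj1 uu) !Ed !mxE /= mulr0 add0r !conjR => H.
rewrite (Hp _ zB).
have {H} : b%:C%C * ((F - G) - p * x) = 0.
  apply: (mulfI cn); rewrite mulr0 -[RHS]H /z1; field.
  by [].
move/eqP; rewrite mulf_eq0 (negbTE bn) subr_eq0 => /eqP ->.
by rewrite mulrAC mulrC mulrA.
Qed.

End Structure.

(** * The form of a covariant kernel *)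

Section Align.
Variable R : realType.
Local Notation C := R[i].

Lemma unitary_scalar n (s : C) : nm s = 1 -> unitary (s%:M : 'M[C]_n).
Proof.
move=> s1; rewrite -diag_const_mx; apply/unitary_diag => i.
by rewrite mxE.
Qed.

(** If [V] diagonalises the rank-one projector multiple [v v^*], the off-diagonal products of
    coordinates of [V v] vanish, so at most one coordinate is non-zero; a permutation and a phase
    finish. *)
Lemma align n (v : 'cV[C]_n.+1) : exists2 u : 'M[C]_n.+1, unitary u &
  exists2 r : R, 0 <= r & u *m v = r%:C%C *: delta_mx ord0 0.
Proof.
pose A := v *m mxstar v.
have AE : mxstar A = A by rewrite /A mxstarM mxstarK.
have : A \is normalmx by apply/normalmxP; rewrite -mxstar_tC AE.
move/orthomx_spectral_subproof => [[V t] /= VU E].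
have VU' : unitary V by apply/unitary_unitarymx.
have [y [yd yE]] : exists y, V *m v = y /\ y *m mxstar y = diag_mx t.
  exists (V *m v); split=> //; rewrite mxstarM mulmxA -(mulmxA V v) -/A E.
  rewrite -unitary_inv // !mulmxA.
  by rewrite mulmxV ?unitarymx_unit // mul1mx mulmxK ?unitarymx_unit.
have [k Hk] : exists k, forall i, i != k -> y i 0 = 0.
  have [[k yk]|H] := pselect (exists k, y k 0 != 0); last first.
    by exists ord0 => i _; apply/eqP; apply: contrapT => /negP yi; apply: H; exists i.
  exists k => i ik; have /matrixP/(_ i k) := yE.
  rewrite !mxE (negbTE ik) mulr0n big_ord1 mxstarE => /eqP.
  by rewrite mulf_eq0 conjC_eq0 (negbTE yk) orbF => /eqP.
pose c := y k 0.
have [s s1 sc] : exists2 s : C, nm s = 1 & s * c = (nm c)%:C%C.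
  have [c0|cn] := eqVneq c 0; first by exists 1; rewrite ?nm1 // c0 mulr0 nm0.
  have nc : (nm c)%:C%C != 0 :> C by rewrite nmE normr_eq0.
  exists (c^* / (nm c)%:C%C).
    rewrite nmM nmV nmJ nmR ger0_norm ?nm_ge0 // divff // nm_eq0 //.
  by rewrite mulrAC (mulrC _ c) -nm_sqr expr2 rmorphM mulfK.
have PU := unitary_perm R (tperm ord0 k); have SU := unitary_scalar n.+1 s1.
exists (s%:M *m (perm_mx (tperm ord0 k) *m V)).
  by apply: unitaryM => //; exact: unitaryM.
exists (nm c); first exact: nm_ge0.
rewrite -!mulmxA yd mul_scalar_mx -row_permE; apply/colP => i; rewrite !mxE.
rewrite andbT; have [->|i0] := eqVneq i ord0; first by rewrite tpermL sc mulr1.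
rewrite mulr0 Hk ?mulr0 //; apply: contra i0 => /eqP E1.
by rewrite -(tpermK ord0 k i) E1 tpermR.
Qed.

Variable e : nat.

(** After [w] is put on the first axis, a unitary acting on the remaining coordinates moves the tail
    of [z] to the second axis without disturbing [w]. *)
Lemma align2 (z w : 'cV[C]_e.+2) : exists2 u : 'M[C]_e.+2, unitary u &
  exists z1 z2 (r : R), [/\ 0 <= r, u *m z = vec e z1 z2 & u *m w = vec e r%:C%C 0].
Proof.
have [u1 U1 [r r0 uw]] := align w.
have [z' zE] : exists z' : 'cV[C]_(1 + e.+1), u1 *m z = z' by exists (u1 *m z).
have [u2 U2 [r2 _ uz]] := align (dsubmx z').
pose u3 : 'M[C]_(1 + e.+1) := block_mx 1%:M 0 0 u2.
have U3 : unitary u3.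
  apply: unitaryP; rewrite /mxstar map_block_mx tr_block_mx !map_mx0 !trmx0 map_mx1 trmx1.
  rewrite mulmx_block !mul0mx !mulmx0 !addr0 !add0r mulmx1 -/(mxstar u2) (proj1 U2).
  exact/esym/scalar_mx_block.
have u3E (x : 'cV[C]_(1 + e.+1)) : u3 *m x = col_mx (usubmx x) (u2 *m dsubmx x).
  by rewrite -{1}(vsubmxK x) mul_block_col !mul0mx mul1mx addr0 add0r.
exists (u3 *m u1); first exact: unitaryM.
exists (z' 0 0), r2%:C%C, r; split => //.
- rewrite -mulmxA zE u3E uz; apply/colP => i; rewrite !mxE.
  case: splitP => j jE; rewrite !mxE.
    have -> : i = ord0 by apply/val_inj; rewrite /= jE ord1.
    by rewrite eqxx; congr (z' _ _); apply/val_inj; rewrite /= ord1.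
  have -> : (i == ord0) = false by rewrite -val_eqE /= jE.
  have -> : (i == i1 e) = (j == ord0) by rewrite -!val_eqE /= jE.
  by rewrite andbT; case: eqP => _; rewrite ?mulr1 ?mulr0.
- rewrite -mulmxA uw -scalemxAr u3E; apply/colP => i; rewrite !mxE if_same.
  case: splitP => j jE; rewrite !mxE.
    have -> : i = ord0 by apply/val_inj; rewrite /= jE ord1.
    by rewrite ord1 /= mulr1.
  have -> : (i == ord0) = false by rewrite -val_eqE /= jE.
  by rewrite big1 ?mulr0 // => k _; rewrite !mxE /= mulr0.
Qed.

(** Fills the point [x = 0], at which [L_col0_rel] is vacuous. *)
Lemma ser_agree0 (a b : nat -> C) (r : R) (f g : C -> C) : 0 < r ->
  ser a r f -> ser b r g ->
  (forall z, z != 0 -> nm z < r -> f z = g z) -> f 0 = g 0.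
Proof.
move=> r0 af bg fg; rewrite (ser0 r0 af) (ser0 r0 bg).
have [K1 [d1 [K10 d10 H1]]] := ser_tail 1 r0 af.
have [K2 [d2 [K20 d20 H2]]] := ser_tail 1 r0 bg.
apply/eqP; rewrite -subr_eq0; apply/eqP; apply: nm_small_eq0 => eps e0.
pose t := Num.min (Num.min d1 d2) (Num.min (r / 2) (eps / (K1 + K2 + 1))).
have K0 : 0 < K1 + K2 + 1 by rewrite ltr_wpDl // addr_ge0.
have t0 : 0 < t by rewrite !lt_min d10 d20 !divr_gt0.
have td1 : t <= d1 by rewrite !ge_min lexx.
have td2 : t <= d2 by rewrite !ge_min lexx !orbT.
have tr : t <= r / 2 by rewrite !ge_min lexx !orbT.
have te : t <= eps / (K1 + K2 + 1) by rewrite !ge_min lexx !orbT.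
have nt : nm t%:C%C = t by rewrite nmR gtr0_norm.
have {}H1 := H1 t%:C%C; have {}H2 := H2 t%:C%C; rewrite nt in H1 H2.
have {}H1 := H1 td1; have {}H2 := H2 td2.
have E : f t%:C%C = g t%:C%C.
  apply: fg; first by rewrite -nm_gt0 nt.
  rewrite nt; apply: le_lt_trans tr _.
  by rewrite ltr_pdivrMr // mulr_natr mulr2n ltrDl.
rewrite big_ord1 expr0 mulr1 expr1 in H1; rewrite big_ord1 expr0 mulr1 expr1 in H2.
rewrite (_ : a 0%N - b 0%N = (g t%:C%C - b 0%N) - (f t%:C%C - a 0%N)); last first.
  by rewrite E; ring.
apply: le_trans (nmB _ _) _; apply: le_trans (lerD H2 H1) _.
by move: te; rewrite ler_pdivlMr // => te; nra.
Qed.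

Variable L : 'cV[C]_e.+2 -> 'cV[C]_e.+2 -> 'M[C]_e.+2.
Hypothesis La : line_analytic L.
Hypothesis Li : forall u z w, unitary u -> in_ball z -> in_ball w ->
  L (u *m z) (u *m w) = u *m L z w *m mxstar u.
Local Notation vec := (vec e).
Local Notation i1 := (i1 e).

Lemma ball_swap (a b : C) : in_ball (vec a b) -> in_ball (vec b a).
Proof. by move/ball_vec => H; apply/ball_vec; rewrite addrC. Qed.

Lemma ser_line0 w z2 i j : in_ball w -> nm z2 < 1 ->
  exists p, ser p (Num.sqrt (1 - nm z2 ^+ 2)) (fun l => L (vec l z2) w i j).
Proof.
move=> wB z21; pose r := Num.sqrt (1 - nm z2 ^+ 2).
have r0 : 0 < r by exact: sqrt_gt0.
exists (fun k => coef (fun l => L (vec l z2) w i j) k (r / 2)).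
apply: hol_series; last 2 first.
- by rewrite divr_gt0.
- by rewrite ltr_pdivrMr // mulr_natr mulr2n ltrDl.
move=> l lr; apply: (@cdiff_eq _ (fun l => L (vec 0 z2 + l *: vec 1 0) w i j)).
  by move=> x; rewrite -vec_line0.
apply: (proj1 La) => //; rewrite -vec_line0; apply: ball_swap.
exact/(@in_ball_sqrt _ e).
Qed.

Lemma in_ball_sqrt0 (z2 l : C) : nm z2 < 1 ->
  nm l < Num.sqrt (1 - nm z2 ^+ 2) <-> in_ball (vec l z2).
Proof.
move=> z21; rewrite (in_ball_sqrt e l z21) !ball_vec addrC //.
Qed.

(** Covers [w = 0], excluded by [0 < r] in [L_col0_rel]: rotating the first coordinate gives the
    entry weight -1. *)
Lemma L_zero_right z1 z2 : in_ball (vec z1 z2) ->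
  L (vec z1 z2) (vec 0 0) i1 ord0 = 0.
Proof.
move=> zB; have z21 : nm z2 < 1.
  exact: in_ball_z1 (ball_swap zB).
have B0 : in_ball (vec 0 0 : 'cV[C]_e.+2) by apply: ball_vec0'; rewrite nm0.
have [p ps] := ser_line0 i1 ord0 B0 z21.
apply: (ser_zero ps); last exact/in_ball_sqrt0.
move=> l; apply: (@ser_rot _ p _ _ 1 0 (sqrt_gt0 z21) ps) => // s w s1 wr.
rewrite expr1 expr0 mul1r.
have := L_diag Li i1 ord0 (torus_single ord0 s1) (proj1 (in_ball_sqrt0 w z21) wr) B0.
rewrite !diag_vec !mxE /= !mul1r !mulr0 => ->.
by rewrite mulrCA (proj2 (conj_nm1 _) s1) mulr1.
Qed.

Theorem covariant_kernel : exists (a b : nat -> C) (A B : C -> C),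
  [/\ ser a 1 A, ser b 1 B & forall z w, in_ball z -> in_ball w ->
    L z w = A (cinner z w) *: (z *m mxstar w) + B (cinner z w) *: 1%:M].
Proof.
have [f [F [fF HF]]] := two_var_entry La Li ord0.
have [g [G [gG HG]]] := two_var_entry La Li i1.
have B0 : in_ball (vec 0 0 : 'cV[C]_e.+2) by apply: ball_vec0'; rewrite nm0.
have v0 : vec 0 0 = 0 :> 'cV[C]_e.+2.
  by apply/colP => i; rewrite !mxE !if_same.
have FG0 : F 0 = G 0.
  have := HF 0 0; rewrite nm0 conjC0 mul0r => <- //.
  have := HG 0 0; rewrite nm0 conjC0 mul0r => <- //.
  have := L_perm Li (tperm ord0 i1) ord0 ord0 B0 B0.
  by rewrite v0 !mulmx0 tpermL.
have fg0 : f 0%N = g 0%N by rewrite -(ser0 ltr01 fF) -(ser0 ltr01 gG).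
(* [F] and [G] agree at 0 because a transposition swaps the diagonal entries of [L 0 0]; hence
   [F - G] is divisible by [x], with shifted coefficients. *)
pose a l := f l.+1 - g l.+1.
pose A x := if x == 0 then a 0%N else (F x - G x) / x.
have xA x : x * A x = F x - G x.
  rewrite /A; have [->|x0] := eqVneq x 0; last by rewrite mulrC divfK.
  by rewrite mul0r FG0 subrr.
have aA : ser a 1 A.
  move=> x x1; rewrite /A; have [->|x0] := eqVneq x 0.
    apply: geo_shiftV; exists 0, 0; split => // N.
    rewrite big_ord_recl expr0 mulr1 big1 ?addr0 ?subrr ?nm0 ?mul0r //.
    by move=> i _; rewrite expr0n /= mulr0.
  have := geoD (fF x x1) (geoZ (-1) (gG x x1)); rewrite mulN1r.
  move/(geoZ x^-1)/geo_shift; rewrite mulrC; apply: eq_geo => N.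
  rewrite !big_ord_recl /= !expr0 !mulr1 mulN1r opprD addrACA fg0 subrr add0r.
  rewrite -sumrB mulr_sumr; apply: eq_bigr => k _.
  by rewrite /a /bump /= add1n exprS; field.
have mE x z2 (r : R) : in_ball (vec x z2) -> 0 < r -> r < 1 ->
    L (vec x z2) (vec r%:C%C 0) i1 ord0 = z2 * r%:C%C * A (x * r%:C%C).
  move=> zB r0 r1; have x1 := in_ball_z1 zB.
  have rB : nm (r%:C%C : C) < 1 by rewrite nmR gtr0_norm.
  have rn : r%:C%C != 0 :> C by rewrite -nm_gt0 nmR gtr0_norm.
  have main y : in_ball (vec y z2) -> y != 0 ->
     L (vec y z2) (vec r%:C%C 0) i1 ord0 = z2 * r%:C%C * A (y * r%:C%C).
    move=> yB y0; have y1 := in_ball_z1 yB; apply: (mulIf y0).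
    rewrite (L_col0_rel La Li y1 r0 r1 yB) /LF /LG HF // HG // conjR -xA.
    by ring.
  have [x0|xn] := eqVneq x 0; last exact: main.
  have z21 : nm z2 < 1.
    exact: in_ball_z1 (ball_swap zB).
  rewrite x0; have rho0 := sqrt_gt0 z21.
  have [p ps] := ser_line0 i1 ord0 (ball_vec0' e rB) z21.
  have qs : ser (fun l => z2 * r%:C%C * (a l * r%:C%C ^+ l)) (Num.sqrt (1 - nm z2 ^+ 2))
      (fun l => z2 * r%:C%C * A (r%:C%C * l)).
    apply: serZ; apply: (ser_dil aA) => z /in_ball_sqrt0 zB'.
    have z1 := in_ball_z1 (zB' z21).
    by rewrite nmM mulr_ilt1 ?nm_ge0.
  have := ser_agree0 rho0 ps qs; rewrite (mulrC 0); apply=> z zn zr.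
  by rewrite main ?(mulrC z) //; exact/in_ball_sqrt0.
exists a, g, A, G; split => // z w zB wB.
have [u uu [z1 [z2 [r [r0 uz uw]]]]] := align2 z w.
have zB' : in_ball (vec z1 z2) by rewrite -uz; exact/in_ball_unitary.
have wB' : in_ball (vec r%:C%C 0 : 'cV[C]_e.+2) by rewrite -uw; exact/in_ball_unitary.
have z11 := in_ball_z1 zB'.
have rB : nm (r%:C%C : C) < 1 := proj1 (ball_vec0 e _) wB'.
have r1 : r < 1 by move: rB; rewrite nmR ger0_norm.
have xE : cinner z w = z1 * r%:C%C.
  rewrite -(cinner_unitary _ _ uu) uz uw /cinner sumC_vec.
    by rewrite !mxE /= conjR conjC0 mulr0 addr0.
  by move=> i i0 in1; rewrite !mxE (negbTE i0) (negbTE in1) mul0r.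
have K : L (vec z1 z2) (vec r%:C%C 0) = A (cinner z w) *: (vec z1 z2 *m mxstar (vec r%:C%C 0))
     + G (cinner z w) *: 1%:M.
  rewrite (L_form La Li zB' rB) /LF /LG HF // HG // conjR -xE -xA.
  have -> : L (vec z1 z2) (vec r%:C%C 0) i1 ord0 = z2 * r%:C%C * A (cinner z w).
    move: r0; rewrite le_eqVlt => /predU1P[r00|r0]; last by rewrite mE // xE.
    by rewrite -r00 mulr0 mul0r; exact: L_zero_right.
  rewrite xE; apply/matrixP => i j; rewrite !mxE big_ord1 mxstarE !mxE.
  move: (G _) (A _) => g' a'.
  have -> : (if j == ord0 then r%:C%C else if j == i1 then 0 else 0)^* =
      (j == ord0)%:R * r%:C%C :> C.
    by case: eqP => _; rewrite ?if_same ?conjR ?conjC0 ?mul1r ?mul0r.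
  have [->|i0] := eqVneq i ord0.
    rewrite /= mulr0 addr0; move: ((_ == _)%:R) ((_ == _)%:R) => p q; ring.
  have [->|in1] := eqVneq i i1; last by rewrite /= !mulr0 !mul0r !mulr0 !addr0 add0r.
  rewrite /= mulr0 addr0; move: ((_ == _)%:R) ((_ == _)%:R) => p q; ring.
have -> : L z w = mxstar u *m L (vec z1 z2) (vec r%:C%C 0) *m u.
  by rewrite -uz -uw Li // !mulmxA (proj1 uu) mul1mx -mulmxA (proj1 uu) mulmx1.
rewrite K mulmxDr mulmxDl -!scalemxAr -!scalemxAl mulmx1 (proj1 uu) -uz -uw.
rewrite mxstarM !mulmxA (proj1 uu) mul1mx -!mulmxA (proj1 uu) mulmx1 //.
Qed.

End Align.

(** * Positivity of the homogeneous parts *)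

Section Positivity.
Variable R : realType.
Local Notation C := R[i].

Definition omega (N k : nat) : C := cis (2 * pi / N%:R) ^+ k.

Lemma nm_omega N k : nm (omega N k) = 1.
Proof. by rewrite nmX nm_cis expr1n. Qed.

Lemma cis_neq1 (t : R) : 0 < t -> t < 2 * pi -> cis t != 1.
Proof.
move=> t0 tp; apply/eqP => /(congr1 (@complex.Re R)) /= ct.
have : 0 < sin (t / 2).
  apply: sin_gt0_pi; rewrite divr_gt0 //=.
  by rewrite ltr_pdivrMr // mulrC.
have : cos t = 1 - 2 * sin (t / 2) ^+ 2.
  have {1}-> : t = t / 2 + t / 2 by field.
  rewrite cosD -!expr2; have := cos2Dsin2 (t / 2).
  by move: (cos _ ^+ 2) (sin _ ^+ 2) => *; lra.
rewrite ct => E s0; have : 0 < sin (t / 2) ^+ 2 by rewrite exprn_gt0.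
by lra.
Qed.

Lemma omega_orth N i q : (i < N)%N -> (q < N)%N ->
  \sum_(k < N) omega N k ^+ i * ((omega N k)^*) ^+ q = if i == q then N%:R else 0.
Proof.
move=> iN qN; have [<-|iq] := eqVneq i q.
  rewrite (eq_bigr (fun=> 1)); first by rewrite sumr_const card_ord.
  by move=> k _; rewrite -exprMn (proj2 (conj_nm1 _) (nm_omega _ _)) expr1n.
have N0 : (0 < N)%N by apply: leq_ltn_trans iN.
have Np : 0 < N%:R :> R by rewrite ltr0n.
wlog : i q iN qN iq / (i < q)%N.
  move=> H; move: (iq); rewrite neq_ltn => /orP[|] lt; first exact: H.
  have := H q i qN iN; rewrite eq_sym => /(_ iq lt) /(congr1 Num.conj).
  rewrite conjC0 rmorph_sum => E; rewrite -[RHS]E; apply: eq_bigr => k _.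
  by rewrite rmorphM !rmorphXn /= conjCK mulrC.
move=> lt; pose m := (q - i)%N.
have m0 : (0 < m)%N by rewrite subn_gt0.
have mN : (m < N)%N by apply: leq_ltn_trans qN; exact: leq_subr.
pose w : C := (cis (2 * pi / N%:R))^* ^+ m.
rewrite (eq_bigr (fun k : 'I_N => w ^+ k)); last first.
  move=> k _; rewrite -(subnKC (ltnW lt)) exprD mulrA -exprMn.
  rewrite (proj2 (conj_nm1 _) (nm_omega _ _)) expr1n mul1r /omega rmorphXn /=.
  by rewrite -/m /w -!exprM mulnC.
have w1 : w - 1 != 0.
  rewrite subr_eq0 -(inj_eq (can_inj (@conjCK C))) conjC1 rmorphXn /= conjCK -cisMn.
  apply: cis_neq1; first by rewrite pmulrn_rgt0 // divr_gt0 ?mulr_gt0 ?pi_gt0.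
  rewrite -(mulr_natr (_ / _)) mulrAC ltr_pdivrMr // ltr_pM2l ?ltr_nat //.
  by rewrite mulr_gt0 ?pi_gt0.
apply: (mulfI w1); rewrite mulr0 -subrX1 -exprM mulnC exprM -rmorphXn /= -cisMn.
by rewrite -(mulr_natr (_ / _)) divfK ?gt_eqF // cis2pi conjC1 expr1n subrr.
Qed.

(** Averaging twice over the roots extracts the coefficient of [X^q] in [(1 + X)^m]; exponents below
    [N] exclude aliasing. *)
Lemma omega_double N m q : (m < N)%N -> (q < N)%N ->
  \sum_(k < N) \sum_(k' < N) (1 + omega N k * (omega N k')^*) ^+ m *
     ((omega N k)^* * omega N k') ^+ q = (N%:R ^+ 2) *+ 'C(m, q) :> C.
Proof.
move=> mN qN.
pose S i := \sum_(k < N) omega N k ^+ i * ((omega N k)^*) ^+ q.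
have E : \sum_(k < N) \sum_(k' < N) (1 + omega N k * (omega N k')^*) ^+ m *
     ((omega N k)^* * omega N k') ^+ q = \sum_(i < m.+1) (S i * (S i)^*) *+ 'C(m, i).
  transitivity (\sum_(k < N) \sum_(k' < N) \sum_(i < m.+1)
    (omega N k ^+ i * ((omega N k)^*) ^+ q * ((omega N k')^* ^+ i * omega N k' ^+ q)) *+ 'C(m, i)).
    apply: eq_bigr => k _; apply: eq_bigr => k' _.
    rewrite exprDn mulr_suml; apply: eq_bigr => i _.
    by rewrite expr1n mul1r !exprMn mulrnAl; congr (_ *+ _); ring.
  under eq_bigr do rewrite exchange_big /=.
  rewrite exchange_big /=; apply: eq_bigr => i _.
  rewrite /= (eq_bigr (fun k : 'I_N => (omega N k ^+ i * ((omega N k)^*) ^+ q) *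
     ((S i)^* *+ 'C(m, i)))); last first.
    move=> k _; rewrite mulrnAr /S rmorph_sum mulr_sumr -sumrMnl.
    by apply: eq_bigr => k' _; rewrite rmorphM !rmorphXn /= conjCK.
  by rewrite -mulr_suml -/(S i) mulrnAr.
rewrite E; have SE i : (i < m.+1)%N -> S i = if i == q then N%:R else 0.
  by move=> im; apply: omega_orth => //; exact: leq_ltn_trans mN.
have [qm|mq] := leqP q m.
  rewrite (bigD1 (Ordinal (qm : (q < m.+1)%N))) //= big1 ?addr0.
    by rewrite SE // eqxx conjC_nat -expr2.
  by move=> i iq; rewrite SE // -val_eqE in iq *; rewrite (negbTE iq) mul0r mul0rn.
rewrite big1 ?bin_small // => i _; rewrite SE //.
by have [iq|] := eqVneq (i : nat) q; [move: (ltn_ord i); rewrite iq ltnS leqNgt mq|rewrite mul0r mul0rn].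
Qed.

Lemma serD (a b : nat -> C) (r : R) f g : ser a r f -> ser b r g ->
  ser (fun k => a k + b k) r (fun z => f z + g z).
Proof.
move=> fa gb z zr; apply: eq_geo (geoD (fa z zr) (gb z zr)) => N.
by rewrite -big_split; apply: eq_bigr => k _; rewrite mulrDl.
Qed.

Lemma ser_mulX (a : nat -> C) (r : R) f : ser a r f ->
  ser (fun k => if k is k'.+1 then a k' else 0) r (fun z => z * f z).
Proof.
move=> fa z zr; apply: geo_shiftV; apply: eq_geo (geoZ z (fa z zr)) => N.
rewrite big_ord_recl /= mul0r add0r mulr_sumr; apply: eq_bigr => k _.
by rewrite exprS; ring.
Qed.

Lemma ser_sum (I : finType) (a : I -> nat -> C) (r : R) (f : I -> C -> C) :
  (forall i, ser (a i) r (f i)) -> ser (fun k => \sum_i a i k) r (fun z => \sum_i f i z).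
Proof.
move=> H z zr.
have : forall s : seq I, geo (\sum_(i <- s) f i z)
    (fun N => \sum_(k < N) (\sum_(i <- s) a i k) * z ^+ k).
  elim=> [|i s IH].
    rewrite big_nil; exists 0, 0; split => // N.
    by rewrite big1 ?subrr ?nm0 ?mul0r // => k _; rewrite big_nil mul0r.
  rewrite big_cons; apply: eq_geo (geoD (H i z zr) IH) => N.
  by rewrite -big_split; apply: eq_bigr => k _; rewrite big_cons mulrDl.
exact.
Qed.

Lemma cinnerDl n (x y z : 'cV[C]_n) : cinner (x + y) z = cinner x z + cinner y z.
Proof. by rewrite -big_split; apply: eq_bigr => i _; rewrite mxE mulrDl. Qed.
Lemma cinnerDr n (x y z : 'cV[C]_n) : cinner z (x + y) = cinner z x + cinner z y.
Proof. by rewrite -big_split; apply: eq_bigr => i _; rewrite mxE rmorphD mulrDr. Qed.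
Lemma cinnerZl n s (x z : 'cV[C]_n) : cinner (s *: x) z = s * cinner x z.
Proof. by rewrite /cinner mulr_sumr; apply: eq_bigr => i _; rewrite mxE mulrA. Qed.
Lemma cinnerZr n s (x z : 'cV[C]_n) : cinner z (s *: x) = s^* * cinner z x.
Proof. by rewrite /cinner mulr_sumr; apply: eq_bigr => i _; rewrite mxE rmorphM; ring. Qed.
Lemma cinner_delta n (i j : 'I_n) :
  cinner (delta_mx i 0) (delta_mx j 0) = (i == j)%:R :> C.
Proof.
rewrite /cinner (bigD1 j) //= big1 ?addr0.
  by rewrite !mxE !eqxx /= conjC1 mulr1 andbT eq_sym.
by move=> k kj; rewrite !mxE (negbTE kj) /= conjC0 mulr0.
Qed.

Variables (n : nat) (A B : C -> C) (a b : nat -> C).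
Variable T : 'cV[C]_n -> 'cV[C]_n -> 'cV[C]_n -> 'cV[C]_n -> C.
Hypothesis aA : ser a 1 A.
Hypothesis bB : ser b 1 B.
Hypothesis TZ : forall s t t' s' x z w y,
  T (s *: x) (t *: z) (t' *: w) (s' *: y) = s^* * t * t'^* * s' * T x z w y.
Hypothesis psd : forall (I : finType) (z x : I -> 'cV[C]_n),
  (forall i, in_ball (z i)) -> 0 <= \sum_i \sum_j
    (A (cinner (z i) (z j)) * T (x i) (z i) (z j) (x j) +
     B (cinner (z i) (z j)) * cinner (x j) (x i)).

Lemma ge0_approx (c : C) (K d : R) (h : R -> C) : 0 < d ->
  (forall y, 0 < y -> y <= d -> 0 <= h y /\ nm (h y - c) <= K * y) -> 0 <= c.
Proof.
move=> d0 H.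
have small e : 0 < e -> exists2 y, 0 < y & y <= d /\ K * y <= e.
  move=> e0; exists (Num.min d (e / (`|K| + 1))).
    by rewrite lt_min d0 divr_gt0 // ltr_wpDl.
  split; first by rewrite ge_min lexx.
  have k1 : 0 < `|K| + 1 by rewrite ltr_wpDl.
  have : Num.min d (e / (`|K| + 1)) <= e / (`|K| + 1) by rewrite ge_min lexx orbT.
  have : 0 < Num.min d (e / (`|K| + 1)) by rewrite lt_min d0 divr_gt0.
  move: (Num.min _ _) => y y0; rewrite ler_pdivlMr // => ye.
  by have := ler_norm K; nra.
rewrite lecE /=; apply/andP; split.
  apply/eqP; apply: (@complexI R); apply: nm_small_eq0 => e e0.
  have [y y0 [yd Ke]] := small e e0; have [h0 hc] := H y y0 yd.
  rewrite nmR; apply: le_trans Ke; apply: le_trans hc.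
  by apply: le_trans (Im_le_nm _); rewrite cImD cImN (ger0_Im h0) sub0r normrN.
rewrite leNgt; apply/negP => c0.
have [y y0 [yd Ke]] := small (- complex.Re c / 2) (ltac:(lra)).
have [h0 hc] := H y y0 yd.
have := le_trans (le_trans (Re_le_nm _) hc) Ke; rewrite cReD cReN.
have : 0 <= complex.Re (h y) by move: h0; rewrite lecE => /andP[].
move=> hy /(le_trans (ler_norm _)); lra.
Qed.

(** Positivity is applied at the points [sqrt y * omega^k * z i] with vectors [omega^(k l) * x i].
    Summation over the roots kills degrees below [l], those above are [O(y^(l+1))], and dividing by
    [y^l] leaves degree [l] as [y] tends to 0. By homogeneity the [z i] need not lie in the ball.
    [T] stands for the rank-one term or its transpose. *)
Lemma homog (I : finType) (z x : I -> 'cV[C]_n) l :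
  0 <= \sum_i \sum_j
    ((if l is l'.+1 then a l' * cinner (z i) (z j) ^+ l' else 0) * T (x i) (z i) (z j) (x j) +
     b l * cinner (z i) (z j) ^+ l * cinner (x j) (x i)).
Proof.
pose X i j := cinner (z i) (z j).
pose G w := \sum_i \sum_j (T (x i) (z i) (z j) (x j) * (w * A (X i j * w)) +
   cinner (x j) (x i) * B (X i j * w)).
pose c k := \sum_i \sum_j (T (x i) (z i) (z j) (x j) *
    (if k is k'.+1 then a k' * X i j ^+ k' else 0) +
   cinner (x j) (x i) * (b k * X i j ^+ k)).
(* Small enough both for [nm (X i j * w) < 1] and for the rescaled points to lie in the ball. *)
pose rho : R := (1 + \sum_i \sum_j nm (X i j) + \sum_i sqn (z i))^-1.
have S1 : 0 <= \sum_i \sum_j nm (X i j).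
  by apply: sumr_ge0 => i _; apply: sumr_ge0 => j _; exact: nm_ge0.
have sq0 i : 0 <= sqn (z i) by apply: sumr_ge0 => k _; rewrite sqr_ge0.
have S2 : 0 <= \sum_i sqn (z i) by apply: sumr_ge0.
have r0' : 0 < 1 + \sum_i \sum_j nm (X i j) + \sum_i sqn (z i) by lra.
have rho0 : 0 < rho by rewrite invr_gt0.
have Xr i j w : nm w < rho -> nm (X i j * w) < 1.
  move=> wr; rewrite nmM; have Xn := nm_ge0 (X i j); have wn := nm_ge0 w.
  have : nm (X i j) <= \sum_i \sum_j nm (X i j).
    rewrite (bigD1 i) //= (bigD1 j) //= -addrA lerDl addr_ge0 //.
      by apply: sumr_ge0 => *; exact: nm_ge0.
    by apply: sumr_ge0 => *; apply: sumr_ge0 => *; exact: nm_ge0.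
  move: wr; rewrite -[rho]mul1r /rho ltr_pdivlMr // => wr Xs; nra.
have Gs : ser c rho G.
  apply: ser_sum => i; apply: ser_sum => j; apply: serD.
    apply: serZ; apply: (@eq_ser _ (fun k => if k is k'.+1 then a k' * X i j ^+ k' else 0)) => //.
    apply: (@ser_mulX (fun k => a k * X i j ^+ k)).
    by apply: ser_dil aA _ => w; exact: Xr.
  by apply: serZ; apply: ser_dil bB _ => w; exact: Xr.
pose N := l.+1; have lN : (l < N)%N by [].
have Nn : N%:R != 0 :> C by rewrite pnatr_eq0.
pose H (y : C) := \sum_(k < N) \sum_(k' < N)
   ((omega N k)^* ^+ l * omega N k' ^+ l) * G (y * (omega N k * (omega N k')^*)).
have Hge (y : R) : 0 < y -> y < rho -> 0 <= H y%:C%C.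
  move=> y0 yr; pose eps : C := (Num.sqrt y)%:C%C.
  have eps2 : eps * eps^* = y%:C%C.
    by rewrite -nm_sqr nmR ger0_norm ?sqrtr_ge0 // sqr_sqrtr // ltW.
  have zB (p : 'I_N * I) : in_ball ((eps * omega N p.1) *: z p.2).
    case: p => k i /=; apply/in_ballE.
    have -> : sqn ((eps * omega N k) *: z i) = y * sqn (z i).
      rewrite /sqn mulr_sumr; apply: eq_bigr => m _; rewrite mxE !nmM nm_omega mulr1 exprMn.
      by rewrite nmR ger0_norm ?sqrtr_ge0 // sqr_sqrtr // ltW.
    have : sqn (z i) <= \sum_i sqn (z i).
      by rewrite (bigD1 i) //= lerDl; apply: sumr_ge0.
    move: yr; rewrite -[rho]mul1r /rho ltr_pdivlMr // => yr si.
    by have := sq0 i; nra.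
  have := psd (fun p : ('I_N * I)%type => (omega N p.1 ^+ l) *: x p.2) zB.
  rewrite [X in 0 <= X -> _](_ : _ = H y%:C%C) // /H.
  pose trm (k : 'I_N) i (k' : 'I_N) j :=
    A (cinner ((eps * omega N k) *: z i) ((eps * omega N k') *: z j)) *
    T (omega N k ^+ l *: x i) ((eps * omega N k) *: z i)
      ((eps * omega N k') *: z j) (omega N k' ^+ l *: x j) +
    B (cinner ((eps * omega N k) *: z i) ((eps * omega N k') *: z j)) *
    cinner (omega N k' ^+ l *: x j) (omega N k ^+ l *: x i).
  rewrite -(pair_bigA _ (fun k i => \sum_(q : ('I_N * I)%type) trm k i q.1 q.2)) /=.
  apply: eq_bigr => k _.
  transitivity (\sum_i \sum_(k' < N) \sum_j (
      (omega N k)^* ^+ l * omega N k' ^+ l * (T (x i) (z i) (z j) (x j) *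
      (y%:C%C * (omega N k * (omega N k')^*) * A (X i j * (y%:C%C * (omega N k * (omega N k')^*)))) +
       cinner (x j) (x i) * B (X i j * (y%:C%C * (omega N k * (omega N k')^*)))))); last first.
    rewrite exchange_big /=; apply: eq_bigr => k' _.
    by rewrite /G mulr_sumr; apply: eq_bigr => i _; rewrite mulr_sumr.
  apply: eq_bigr => i _; rewrite -(pair_bigA _ (trm k i)) /=.
  apply: eq_bigr => k' _; apply: eq_bigr => j _.
  rewrite /trm; move: (omega N k) (omega N k') => u v.
  rewrite TZ !cinnerZl !cinnerZr !rmorphM !rmorphXn /= -/(X i j).
  have -> : eps * u * (eps^* * v^* * X i j) = X i j * (y%:C%C * (u * v^*)).
    by rewrite -eps2; ring.
  by move: (A _) (B _) => A' B'; rewrite -eps2; ring.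
have [K [d [K0 d0 HK]]] := ser_tail l.+1 rho0 Gs.
have Hc (y : R) : 0 < y -> y <= d ->
    nm (H y%:C%C - N%:R ^+ 2 * c l * y%:C%C ^+ l) <= (N%:R ^+ 2 * K) * y ^+ l.+1.
  move=> y0 yd.
  have HE : N%:R ^+ 2 * c l * y%:C%C ^+ l = \sum_(k < N) \sum_(k' < N)
     ((omega N k)^* ^+ l * omega N k' ^+ l) *
     \sum_(p < l.+1) c p * (y%:C%C * (omega N k * (omega N k')^*)) ^+ p.
    pose S i := \sum_(k < N) omega N k ^+ i * ((omega N k)^*) ^+ l.
    transitivity (\sum_(p < l.+1) c p * y%:C%C ^+ p * (S p * (S p)^*)).
      rewrite big_ord_recr /= big1 ?add0r => [|p _].
        by rewrite /S omega_orth // eqxx conjC_nat; ring.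
      rewrite /S omega_orth ?(ltn_trans (ltn_ord p)) // ltn_eqF //.
      by rewrite mul0r mulr0.
    rewrite [RHS](eq_bigr (fun k : 'I_N => \sum_(p < l.+1) \sum_(k' < N)
       (c p * y%:C%C ^+ p * (omega N k ^+ p * ((omega N k)^*) ^+ l *
       (omega N k' ^+ p * ((omega N k')^*) ^+ l)^*)))).
      rewrite [RHS]exchange_big /=; apply: eq_bigr => p _.
      rewrite {1}/S [X in _ * X = _]mulr_suml mulr_sumr; apply: eq_bigr => k _.
      by rewrite /S rmorph_sum [X in _ * X = _]mulr_sumr mulr_sumr.
    move=> k _; rewrite [RHS]exchange_big /=; apply: eq_bigr => k' _.
    rewrite mulr_sumr; apply: eq_bigr => p _.
    move: (omega N k) (omega N k') => u v.
    by rewrite rmorphM !rmorphXn /= conjCK !exprMn; ring.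
  rewrite HE /H -sumrB; apply: le_trans (nm_sum _ _ _) _.
  apply: (@le_trans _ _ (\sum_(k < N) (N%:R * (K * y ^+ l.+1)))); last first.
    by rewrite sumr_const card_ord -[leLHS]mulr_natl expr2 !mulrA.
  apply: ler_sum => k _; rewrite -sumrB; apply: le_trans (nm_sum _ _ _) _.
  apply: (@le_trans _ _ (\sum_(k' < N) (K * y ^+ l.+1))); last first.
    by rewrite sumr_const card_ord mulr_natl.
  apply: ler_sum => k' _; rewrite -mulrBr nmM.
  have -> : nm ((omega N k)^* ^+ l * omega N k' ^+ l) = 1.
    by rewrite nmM !(nmX _ l) nmJ !nm_omega !expr1n mulr1.
  rewrite mul1r.
  have ny : nm (y%:C%C * (omega N k * (omega N k')^*)) = y.
    by rewrite !nmM nmJ !nm_omega !mulr1 nmR gtr0_norm.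
  by have := HK (y%:C%C * (omega N k * (omega N k')^*)); rewrite ny => /(_ yd).
have : 0 <= N%:R ^+ 2 * c l.
  apply: (@ge0_approx _ (N%:R ^+ 2 * K) (Num.min d (rho / 2))
     (fun y => H y%:C%C / y%:C%C ^+ l)).
    by rewrite lt_min d0 divr_gt0.
  move=> y y0; rewrite le_min => /andP[yd yr].
  have yC : 0 < y%:C%C :> C by rewrite ltcR.
  split.
    rewrite mulr_ge0 ?invr_ge0 ?exprn_ge0 ?(ltW yC) // Hge //.
    by apply: le_lt_trans yr _; rewrite ltr_pdivrMr // mulr_natr mulr2n ltrDl.
  have yn : y%:C%C ^+ l != 0 :> C by rewrite expf_neq0 // gt_eqF.
  have yl : 0 < nm (y%:C%C ^+ l) by rewrite nm_gt0.
  rewrite -(ler_pM2r yl) -nmM mulrBl divfK //; apply: le_trans (Hc y y0 yd) _.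
  by rewrite (nmX _ l) nmR gtr0_norm // [y ^+ l.+1]exprS !mulrA.
rewrite pmulr_rge0 ?exprn_gt0 ?ltr0n // => cl.
rewrite [X in 0 <= X](_ : _ = c l) //; apply: eq_bigr => i _; apply: eq_bigr => j _.
by rewrite /X; case: (l) => [|l']; ring.
Qed.

End Positivity.

(** * Test vectors *)

Section Tests.
Variable R : realType.
Local Notation C := R[i].

Lemma sum_unit_plus (J : finType) (F : unit + J -> C) :
  \sum_p F p = F (inl tt) + \sum_j F (inr j).
Proof. by rewrite big_sumType /= (big_pred1 tt) //; case. Qed.

Lemma sum_unit_plus2 (J : finType) (F : unit + J -> unit + J -> C) :
  \sum_p \sum_q F p q = F (inl tt) (inl tt) + \sum_j F (inl tt) (inr j) +
    \sum_j F (inr j) (inl tt) + \sum_j \sum_j' F (inr j) (inr j').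
Proof.
rewrite sum_unit_plus sum_unit_plus -[RHS]addrA; congr (_ + _).
by rewrite -big_split; apply: eq_bigr => j _; rewrite sum_unit_plus.
Qed.

Section Std.
Variables (e : nat) (a b : nat -> C).
Local Notation n := e.+2.
Hypothesis pos : forall (I : finType) (z x : I -> 'cV[C]_n) l,
  0 <= \sum_i \sum_j
    ((if l is l'.+1 then a l' * cinner (z i) (z j) ^+ l' else 0) *
       (cinner (z i) (x i) * cinner (x j) (z j)) +
     b l * cinner (z i) (z j) ^+ l * cinner (x j) (x i)).
Let dl (i : 'I_n) : 'cV[C]_n := delta_mx i 0.

Lemma std_pos l : 0 <= b l.
Proof.
have := pos (fun _ : unit => dl 0) (fun _ => dl (lift 0 0)) l.
rewrite !(big_pred1 tt) ?(big_pred1 tt) //; try by case.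
by rewrite !cinner_delta eqxx expr1n mulr1 mulr1 mulr0 mulr0 add0r.
Qed.

(** The test functional is [N] times the divergence at [e_0] on maps [f] homogeneous of degree
    [m + 1]: averaging over roots extracts the derivative of [f_j] along [e_j] for [j >= 1], and
    Euler's identity gives [(m + 1) f_0] for the remaining term, hence the weight [N (m + 1)]. *)
Lemma std_pos_a m : 0 <= (m.+1 + e.+1)%:R * a m + m.+1%:R * b m.+1.
Proof.
pose N := m.+2; pose J := ('I_e.+1 * 'I_N)%type.
pose z (p : unit + J) := if p is inr jk then dl 0 + omega R N jk.2 *: dl (lift 0 jk.1) else dl 0.
pose x (p : unit + J) := if p is inr jk then omega R N jk.2 *: dl (lift 0 jk.1)
  else (N * m.+1)%:R *: dl 0.
have ww k : (omega R N k)^* * omega R N k = 1.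
  by rewrite mulrC -nm_sqr nm_omega expr1n.
have := pos z x m.+1; rewrite sum_unit_plus2 /z /x /=.
rewrite [X in _ + X + _ + _](_ : _ = N%:R ^+ 2 * (m.+1%:R * e.+1%:R * a m)); last first.
  rewrite (eq_bigr (fun=> (N * m.+1)%:R * a m)); last first.
    move=> [j k] _ /=; have := ww k; move: (omega R N k) => u u1.
    rewrite !(cinnerDr, cinnerZr, cinnerZl, cinnerDl) !cinner_delta conjC_nat.
    rewrite !eqxx !(mulr0, mulr1, addr0, add0r) ?expr1n u1; ring.
  rewrite sumr_const card_prod !card_ord -mulr_natl !natrM; ring.
rewrite [X in _ + X + _](_ : _ = N%:R ^+ 2 * (m.+1%:R * e.+1%:R * a m)); last first.
  rewrite (eq_bigr (fun=> (N * m.+1)%:R * a m)); last first.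
    move=> [j k] _ /=; have := ww k; move: (omega R N k) => u u1.
    rewrite !(cinnerDr, cinnerZr, cinnerZl, cinnerDl) !cinner_delta.
    rewrite !eqxx !(mulr0, mulr1, addr0, add0r) ?expr1n u1; ring.
  rewrite sumr_const card_prod !card_ord -mulr_natl !natrM; ring.
pose W k k' : C := omega R N k * (omega R N k')^*.
(* Points on distinct axes have inner product 1 and contribute [a m] alone; on a common axis
   [omega_double] with exponents 0 and 1 extracts the two coefficients. *)
rewrite [X in _ + _ + _ + X](_ : _ =
   N%:R ^+ 2 * (e.+1%:R ^+ 2 * a m + e.+1%:R * m.+1%:R * b m.+1)); last first.
  transitivity (\sum_(j < e.+1) \sum_(k < N) \sum_(j' < e.+1) \sum_(k' < N)
    (a m + (if j == j' then a m * (1 + W k k') ^+ m * ((omega R N k)^* * omega R N k') ^+ 0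
      - a m + b m.+1 * (1 + W k k') ^+ m.+1 * ((omega R N k)^* * omega R N k') ^+ 1 else 0))).
    rewrite [RHS]pair_bigA; apply: eq_bigr => -[j k] _ /=.
    rewrite [RHS]pair_bigA; apply: eq_bigr => -[j' k'] _ /=.
    rewrite !(cinnerDr, cinnerZr, cinnerZl, cinnerDl) !cinner_delta /W.
    rewrite !(inj_eq (@lift_inj _ 0)) [j' == j]eq_sym !eqxx ?(mulr0, mulr1, addr0, add0r) /=.
    have w1 := ww k; have w2 := ww k'.
    move: w1 w2; move: (omega R N k) (omega R N k') => u v u1 v1; rewrite u1 v1.
    case: (j == j') => /=; rewrite ?(mulr0, mulr1, addr0, add0r, expr1n, expr0, expr1);
      first by rewrite [v^* * u]mulrC; ring.
    by [].
  under eq_bigr do rewrite exchange_big /=.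
  rewrite (eq_bigr (fun=> e.+1%:R * N%:R ^+ 2 * a m + N%:R ^+ 2 * (m.+1%:R * b m.+1))); last first.
    move=> j _; under eq_bigr do under eq_bigr do rewrite big_split /=.
    transitivity (\sum_(j' < e.+1) (N%:R ^+ 2 * a m + if j == j' then N%:R ^+ 2 * (m.+1%:R * b m.+1) else 0)).
      apply: eq_bigr => j' _.
      rewrite big_split /= !sumr_const !card_ord -mulrnA.
      congr (_ + _); first by rewrite -[LHS]mulr_natl natrM.
      case: (j == j'); last by rewrite big1 // => k _; rewrite big1.
      under eq_bigr do rewrite big_split sumrB /=.
      rewrite big_split sumrB /= !sumr_const !card_ord.
      under eq_bigr do under eq_bigr do rewrite -mulrA.
      under eq_bigr do rewrite -mulr_sumr.
      rewrite -mulr_sumr omega_double // bin0.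
      under eq_bigr do under eq_bigr do rewrite -mulrA.
      under eq_bigr do rewrite -mulr_sumr.
      rewrite -mulr_sumr omega_double // bin1 mulr1n.
      rewrite -(mulr_natr (_ ^+ 2)) -(mulr_natr (a m)) -(mulr_natr (a m * _)).
      ring.
    rewrite big_split /= sumr_const card_ord -big_mkcond /= (big_pred1 j) //.
    by rewrite -mulr_natl; ring.
  by rewrite sumr_const card_ord -mulr_natl; ring.
rewrite !(cinnerZr, cinnerZl) !cinner_delta eqxx conjC_nat !mulr1 !expr1n !mulr1.
rewrite [X in 0 <= X](_ : _ = N%:R ^+ 2 * (m.+1 + e.+1)%:R *
   ((m.+1 + e.+1)%:R * a m + m.+1%:R * b m.+1)).
  by rewrite pmulr_rge0 // mulr_gt0 ?exprn_gt0 ?ltr0n.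
by rewrite natrM natrD; move: (N%:R : C) => M; ring.
Qed.
End Std.

Section Conj.
Variables (e : nat) (a b : nat -> C).
Local Notation n := e.+2.
Local Notation cj := (map_mx Num.conj).
Hypothesis pos : forall (I : finType) (z x : I -> 'cV[C]_n) l,
  0 <= \sum_i \sum_j
    ((if l is l'.+1 then a l' * cinner (z i) (z j) ^+ l' else 0) *
       (cinner (cj (z j)) (x i) * cinner (x j) (cj (z i))) +
     b l * cinner (z i) (z j) ^+ l * cinner (x j) (x i)).
Let dl (i : 'I_n) : 'cV[C]_n := delta_mx i 0.
Let i1 : 'I_n := lift 0 0.

Lemma conj_pos l : 0 <= (if l is l'.+1 then a l' else 0) + b l.
Proof.
have := pos (fun _ : unit => dl 0) (fun _ => dl 0) l.
rewrite !(big_pred1 tt) ?(big_pred1 tt) //; try by case.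
rewrite map_delta_mx !cinner_delta eqxx expr1n !mulr1.
by case: l => [//|l]; rewrite expr1n !mulr1.
Qed.

(** Here the functional is [N] times the curl component [d_1 f_0 - d_0 f_1] at [e_0], discretised in
    the same way; it annihilates gradients, which form the other irreducible piece. *)
Lemma conj_pos_b m : 0 <= m.+1%:R * b m.+1 - a m.
Proof.
pose N := m.+2.
pose z (p : unit + 'I_N) := if p is inr k then dl 0 + omega R N k *: dl i1 else dl 0.
pose x (p : unit + 'I_N) := if p is inr k then omega R N k *: dl 0
  else (- (N * m.+1)%:R) *: dl i1.
have ww k : (omega R N k)^* * omega R N k = 1.
  by rewrite mulrC -nm_sqr nm_omega expr1n.
have cjD u : cj (dl 0 + u *: dl i1) = dl 0 + u^* *: dl i1 :> 'cV[C]_n.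
  by rewrite map_mxD map_mxZ !map_delta_mx.
have cj0 : cj (dl 0) = dl 0 by rewrite map_delta_mx.
have i01 : (0 == i1) = false :> bool by [].
have i10 : (i1 == 0) = false :> bool by [].
have cDD (u v : C) : cinner (dl 0 + u *: dl i1) (dl 0 + v *: dl i1) = 1 + u * v^*.
  rewrite !(cinnerDr, cinnerDl) !cinnerZl !cinnerZr !cinner_delta !eqxx i01 i10 /=; ring.
have cDZ (u v : C) : cinner (dl 0 + u *: dl i1) (v *: dl 0) = v^*.
  by rewrite cinnerDl cinnerZl !cinnerZr !cinner_delta eqxx i10 /=; ring.
have cZD (u v : C) : cinner (v *: dl 0) (dl 0 + u *: dl i1) = v.
  by rewrite cinnerDr !cinnerZl cinnerZr !cinner_delta eqxx i01 /=; ring.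
have := pos z x m.+1; rewrite sum_unit_plus2 /z /x /=.
rewrite [X in _ + X + _ + _](_ : _ = - N%:R ^+ 2 * (m.+1%:R * a m)); last first.
  rewrite (eq_bigr (fun=> - (N * m.+1)%:R * a m)); last first.
    move=> k _ /=; have := ww k; move: (omega R N k) => u u1; rewrite cjD cj0.
    rewrite !(cinnerDr, cinnerZr, cinnerZl, cinnerDl) !cinner_delta rmorphN /= conjC_nat.
    rewrite ?eqxx ?i01 ?i10 !(mulr0, mulr1, addr0, add0r) ?expr1n.
    transitivity (a m * - (N * m.+1)%:R * (u^* * u)); [ring | rewrite u1; ring].
  rewrite sumr_const !card_ord -mulr_natl natrM; ring.
rewrite [X in _ + X + _](_ : _ = - N%:R ^+ 2 * (m.+1%:R * a m)); last first.
  rewrite (eq_bigr (fun=> - (N * m.+1)%:R * a m)); last first.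
    move=> k _ /=; have := ww k; move: (omega R N k) => u u1; rewrite cjD cj0.
    rewrite !(cinnerDr, cinnerZr, cinnerZl, cinnerDl) !cinner_delta conjCK.
    rewrite ?eqxx ?i01 ?i10 !(mulr0, mulr1, addr0, add0r) ?expr1n.
    transitivity (a m * - (N * m.+1)%:R * (u^* * u)); [ring | rewrite u1; ring].
  rewrite sumr_const !card_ord -mulr_natl natrM; ring.
rewrite [X in _ + _ + _ + X](_ : _ = N%:R ^+ 2 * (m%:R * a m + m.+1%:R * b m.+1)); last first.
  transitivity (\sum_(k < N) \sum_(k' < N)
    (a m * ((1 + omega R N k * (omega R N k')^*) ^+ m * ((omega R N k)^* * omega R N k') ^+ 1) +
     b m.+1 * ((1 + omega R N k * (omega R N k')^*) ^+ m.+1 * ((omega R N k)^* * omega R N k') ^+ 1))).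
    apply: eq_bigr => k _; apply: eq_bigr => k' _ /=.
    move: (omega R N k) (omega R N k') => u v; rewrite !cjD.
    rewrite !cDD !cZD !cDZ cinnerZl cinnerZr cinner_delta eqxx mulr1 expr1.
    by move: (_ ^+ m) (_ ^+ m.+1) => P Q; ring.
  under eq_bigr do rewrite big_split -!mulr_sumr /=.
  rewrite big_split /= -!mulr_sumr !omega_double // !bin1 -!(mulr_natr (_ ^+ 2)).
  ring.
rewrite cj0 !(cinnerZr, cinnerZl) !cinner_delta ?eqxx ?i01 ?i10 rmorphN /= conjC_nat.
rewrite !(mulr0, mulr1, add0r, expr1n).
rewrite [X in 0 <= X](_ : _ = N%:R ^+ 2 * (m.+1 + 1)%:R * (m.+1%:R * b m.+1 - a m)).
  by rewrite pmulr_rge0 // mulr_gt0 ?exprn_gt0 ?ltr0n.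
by rewrite natrM natrD; move: (N%:R : C) => M; ring.
Qed.
End Conj.

End Tests.

(** * The two normal forms *)

Section Final.
Variable R : realType.
Local Notation C := R[i].
Local Notation cj := (map_mx Num.conj).

(** The termwise bound [s t <= (s^2 + t^2) / 2] suffices, as both square norms are below 1. *)
Lemma nm_cinner_lt1 d (z w : 'cV[C]_d) : in_ball z -> in_ball w -> nm (cinner z w) < 1.
Proof.
move=> /in_ballE zB /in_ballE wB.
apply: le_lt_trans (nm_sum _ _ _) _.
apply: (@le_lt_trans _ _ (\sum_(i < d) (nm (z i 0) ^+ 2 + nm (w i 0) ^+ 2) / 2)).
  apply: ler_sum => i _; rewrite nmM nmJ.
  move: (nm _) (nm _) => s t; have := sqr_ge0 (s - t); nra.
rewrite -mulr_suml big_split /=; move: zB wB; rewrite /sqn.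
by move: (\sum_(i < d) _) (\sum_(i < d) _) => s t; lra.
Qed.

Lemma ser_cvg (a : nat -> C) A x d (M : 'M[C]_d) : ser a 1 A -> nm x < 1 ->
  (fun N : nat => \sum_(l < N) (a l * x ^+ l) *: M : ('M[C]_d : normedModType C)) @ \oo
    --> (A x *: M : ('M[C]_d : normedModType C)).
Proof.
move=> aA x1.
rewrite (_ : (fun N => _) = fun N : nat => (\sum_(l < N) a l * x ^+ l) *: M); last first.
  by apply: funext => N; rewrite scaler_suml.
apply: cvgZr_tmp; apply/cvgrPdist_le => e e0.
have [r rE] : exists r : R, e = r%:C%C.
  by exists (complex.Re e); rewrite RRe_real // gtr0_real.
move: e0; rewrite rE ltcR => r0; have [N0 H] := geo_small (aA x x1) r0.
by exists N0 => // N /= NN; rewrite -nmE lecR; exact: H.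
Qed.

Lemma psd_fin d n (K : 'cV[C]_d -> 'cV[C]_d -> 'M[C]_n) : nonneg_def_kernel K ->
  forall (I : finType) (z : I -> 'cV[C]_d) (x : I -> 'cV[C]_n), (forall i, in_ball (z i)) ->
  0 <= \sum_i \sum_j (mxstar (x i) *m K (z i) (z j) *m x j) 0 0.
Proof.
move=> Kp I z x zB.
have := Kp #|I| (fun k => z (enum_val k)) (fun k => x (enum_val k)) (fun k => zB _).
rewrite [X in _ -> 0 <= X](big_enum_val _ (A := I)) /=.
congr (0 <= _); apply: eq_bigr => i _; by rewrite [RHS](big_enum_val _ (A := I)).
Qed.

Lemma nonneg_def_conj d n (K : 'cV[C]_d -> 'cV[C]_d -> 'M[C]_n) (U : 'M[C]_n) :
  nonneg_def_kernel K -> nonneg_def_kernel (fun z w => U *m K z w *m mxstar U).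
Proof.
move=> Kp m z x zB; have := Kp m z (fun i => mxstar U *m x i) zB.
congr (0 <= _); apply: eq_bigr => i _; apply: eq_bigr => j _.
by rewrite mxstarM mxstarK !mulmxA.
Qed.

Lemma rank1_form n (x y z w : 'cV[C]_n) :
  (mxstar x *m (z *m mxstar w) *m y) 0 0 = cinner z x * cinner y w.
Proof.
by rewrite !cinnerE mulmxA -(mulmxA (_ *m z)) mxE big_ord1.
Qed.

Lemma tr_rank1 n (z w : 'cV[C]_n) : (z *m mxstar w)^T = cj w *m mxstar (cj z).
Proof. by rewrite trmx_mul /mxstar trmxK map_conjK. Qed.

Lemma scale_form n (x y : 'cV[C]_n) (M N : 'M[C]_n) s t :
  (mxstar x *m (s *: M + t *: N) *m y) 0 0 =
  s * (mxstar x *m M *m y) 0 0 + t * (mxstar x *m N *m y) 0 0.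
Proof.
by rewrite mulmxDr mulmxDl -!scalemxAr -!scalemxAl mxE [X in X + _]mxE [X in _ + X]mxE.
Qed.

Lemma Re_pos (c : C) : 0 <= c -> c = (complex.Re c)%:C%C /\ 0 <= complex.Re c.
Proof. by move=> c0; split; [rewrite RRe_real // ger0_real|move: c0; rewrite lecE => /andP[]]. Qed.

Section Intro.
Variables (d : nat) (U : 'M[C]_d) (K : 'cV[C]_d -> 'cV[C]_d -> 'M[C]_d).
Variables (a b : nat -> C) (A B : C -> C).
Hypothesis aA : ser a 1 A.
Hypothesis bB : ser b 1 B.

Lemma form1_intro :
  (forall l, 0 <= (if l is l'.+1 then a l' else 0) + b l) ->
  (forall m, 0 <= m.+1%:R * b m.+1 - a m) ->
  (forall z w, in_ball z -> in_ball w -> U *m K z w *m mxstar U =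
     A (cinner z w) *: (z *m mxstar w)^T + B (cinner z w) *: 1%:M) ->
  exists a1 a2, form1 U K a1 a2.
Proof.
move=> ab ba KE.
have bR l : b l = (complex.Re (b l))%:C%C.
  suff /Re_pos[] : 0 <= b l by [].
  case: l => [|m]; first by have := ab 0%N; rewrite add0r.
  (* Adding the two inequalities eliminates [a m] and leaves [(m + 2) b m.+1]. *)
  have := addr_ge0 (ab m.+1) (ba m).
  have -> : a m + b m.+1 + (m.+1%:R * b m.+1 - a m) = (m.+1%:R + 1) * b m.+1 by ring.
  by rewrite pmulr_rge0 // addr_gt0 ?ltr0n.
have aR m : a m = (complex.Re (a m))%:C%C.
  have [H _] := Re_pos (ab m.+1).
  by move: H; rewrite cReD rmorphD /= -bR => /addIr.
(* The rank-one factor raises the degree by one, so degree [l] carries the coefficient of [A] of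
   index [l - 1]; the normal form writes it as a difference. *)
exists (fun l => (if l is l'.+1 then complex.Re (a l') else 0) + complex.Re (b l)).
exists (fun l => complex.Re (b l)); split; first by rewrite add0r.
split.
  case=> [|m].
    have /Re_pos[_ /=] := ab 0%N; rewrite !add0r => H; split=> //; by rewrite mul1r.
  have [_] := Re_pos (ab m.+1); rewrite cReD => H1; split=> //.
  have := ba m; rewrite aR bR -(rmorph_nat (real_complex R)) -rmorphM -rmorphB /= lecR.
  by rewrite -[m.+2]addn1 natrD mulrDl mul1r => H; rewrite lerD2r -subr_ge0.
move=> z w zB wB; have c1 := nm_cinner_lt1 zB wB.
exists (A (cinner z w) *: (z *m mxstar w)^T), (B (cinner z w) *: 1%:M); split; last split.
- have -> : (z *m mxstar w)^T = \matrix_(i < d, j < d) ((w i 0)^* * z j 0).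
    by apply/matrixP => i j; rewrite !mxE big_ord1 !mxE mulrC.
  have := @ser_cvg a A _ _ (\matrix_(i < d, j < d) ((w i 0)^* * z j 0)) aA c1.
  by apply: cvg_trans; apply: near_eq_cvg; apply: nearW => N; apply: eq_bigr => l _; rewrite addrK -aR.
- have := @ser_cvg b B _ _ (1%:M : 'M[C]_d) bB c1.
  by apply: cvg_trans; apply: near_eq_cvg; apply: nearW => N; apply: eq_bigr => l _; rewrite -bR.
- exact: KE.
Qed.

Lemma form2_intro : (1 < d)%N ->
  (forall l, 0 <= b l) ->
  (forall m, 0 <= (m.+1 + d.-1)%:R * a m + m.+1%:R * b m.+1) ->
  (forall z w, in_ball z -> in_ball w -> U *m K z w *m mxstar U =
     A (cinner z w) *: (z *m mxstar w) + B (cinner z w) *: 1%:M) ->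
  exists b1 b2, form2 U K b1 b2.
Proof.
move=> d1 b0 ab KE.
have bR l : b l = (complex.Re (b l))%:C%C by have [] := Re_pos (b0 l).
(* The sign of [a m] is not determined; it is real because a non-zero integer multiple of it is a
   difference of reals. *)
have aR m : a m = (complex.Re (a m))%:C%C.
  rewrite RRe_real //; have k0 : (m.+1 + d.-1)%:R != 0 :> C by rewrite pnatr_eq0.
  rewrite -(mulKf k0 (a m)) rpredM ?realV ?realn //.
  rewrite -(addrK (m.+1%:R * b m.+1) (_ * a m)) rpredB ?ger0_real //.
  by rewrite mulr_ge0.
have dE : d%:R - 1 = d.-1%:R :> R by rewrite -{1}(ltn_predK d1) -natr1 addrK.
exists (fun l => (if l is l'.+1 then complex.Re (a l') else 0) + complex.Re (b l)).
exists (fun l => complex.Re (b l)); split; first by rewrite add0r.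
split.
  move=> l; have [_ bl] := Re_pos (b0 l); split=> //; rewrite -addrA dE.
  case: l bl => [|m] bl; first by rewrite !add0r.
  have := ab m; rewrite aR bR -!(rmorph_nat (real_complex R)) -!rmorphM -rmorphD /= lecR.
  by rewrite natrD; move: (m.+1%:R : R) (d.-1%:R : R) (complex.Re _) (complex.Re _) => *; lra.
move=> z w zB wB; have c1 := nm_cinner_lt1 zB wB.
exists (A (cinner z w) *: (z *m mxstar w)), (B (cinner z w) *: 1%:M); split; last split.
- have -> : (z *m mxstar w) = \matrix_(i < d, j < d) (z i 0 * (w j 0)^*).
    by apply/matrixP => i j; rewrite !mxE big_ord1 !mxE.
  have := @ser_cvg a A _ _ (\matrix_(i < d, j < d) (z i 0 * (w j 0)^*)) aA c1.
  by apply: cvg_trans; apply: near_eq_cvg; apply: nearW => N; apply: eq_bigr => l _; rewrite addrK -aR.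
- have := @ser_cvg b B _ _ (1%:M : 'M[C]_d) bB c1.
  by apply: cvg_trans; apply: near_eq_cvg; apply: nearW => N; apply: eq_bigr => l _; rewrite -bR.
- exact: KE.
Qed.

End Intro.

Lemma std_case e (K : 'cV[C]_e.+2 -> 'cV[C]_e.+2 -> 'M[C]_e.+2) (U : 'M[C]_e.+2) :
  nonneg_def_kernel K -> sesqui_analytic K ->
  (forall u z w, unitary u -> in_ball z -> in_ball w ->
    U *m K (u *m z) (u *m w) *m mxstar U = u *m (U *m K z w *m mxstar U) *m mxstar u) ->
  exists b1 b2, form2 U K b1 b2.
Proof.
move=> Kp Ka Li; pose L z w := U *m K z w *m mxstar U.
have La : line_analytic L by apply/line_analytic_mulmx/sesqui_line_analytic.
have [a [b [A [B [aA bB LE]]]]] := covariant_kernel La Li.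
have Lp := psd_fin (nonneg_def_conj U Kp).
pose T (x z w y : 'cV[C]_e.+2) := cinner z x * cinner y w.
have TZ s t t' s' x z w y :
  T (s *: x) (t *: z) (t' *: w) (s' *: y) = s^* * t * t'^* * s' * T x z w y.
  by rewrite /T !cinnerZl !cinnerZr; ring.
have psd (I : finType) (z x : I -> 'cV[C]_e.+2) : (forall i, in_ball (z i)) ->
  0 <= \sum_i \sum_j (A (cinner (z i) (z j)) * T (x i) (z i) (z j) (x j) +
     B (cinner (z i) (z j)) * cinner (x j) (x i)).
  move=> zB; have := Lp I z x zB; congr (0 <= _).
  apply: eq_bigr => i _; apply: eq_bigr => j _.
  by rewrite -/(L _ _) LE // scale_form rank1_form mulmx1 -cinnerE.
apply: (form2_intro aA bB) => //.
  by apply: (std_pos (a := a)) => I z x l; exact: (homog aA bB TZ psd).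
by apply: std_pos_a => I z x l; exact: (homog aA bB TZ psd).
Qed.

Lemma conj_case e (K : 'cV[C]_e.+2 -> 'cV[C]_e.+2 -> 'M[C]_e.+2) (U : 'M[C]_e.+2) :
  nonneg_def_kernel K -> sesqui_analytic K ->
  (forall u z w, unitary u -> in_ball z -> in_ball w ->
    U *m K (u *m z) (u *m w) *m mxstar U = cj u *m (U *m K z w *m mxstar U) *m mxstar (cj u)) ->
  exists a1 a2, form1 U K a1 a2.
Proof.
(* Transposition exchanges conjugation by the conjugate of [u] with conjugation by [u], as
   [covariant_kernel] requires. *)
move=> Kp Ka KU; pose L z w := (U *m K z w *m mxstar U)^T.
have La : line_analytic L by apply/line_analytic_tr/line_analytic_mulmx/sesqui_line_analytic.
have Li u z w : unitary u -> in_ball z -> in_ball w ->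
    L (u *m z) (u *m w) = u *m L z w *m mxstar u.
  move=> uu zB wB; rewrite /L (KU u z w uu zB wB) trmx_mul trmx_mul mulmxA.
  by rewrite /mxstar trmxK map_conjK.
have [a [b [A [B [aA bB LE]]]]] := covariant_kernel La Li.
have KE z w : in_ball z -> in_ball w -> U *m K z w *m mxstar U =
     A (cinner z w) *: (z *m mxstar w)^T + B (cinner z w) *: 1%:M.
  move=> zB wB; rewrite -[LHS]trmxK -/(L z w) LE //.
  by rewrite linearD !linearZ /= trmx1.
have Lp := psd_fin (nonneg_def_conj U Kp).
pose T (x z w y : 'cV[C]_e.+2) := cinner (cj w) x * cinner y (cj z).
have TZ s t t' s' x z w y :
  T (s *: x) (t *: z) (t' *: w) (s' *: y) = s^* * t * t'^* * s' * T x z w y.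
  by rewrite /T !map_mxZ !cinnerZl !cinnerZr conjCK; ring.
have psd (I : finType) (z x : I -> 'cV[C]_e.+2) : (forall i, in_ball (z i)) ->
  0 <= \sum_i \sum_j (A (cinner (z i) (z j)) * T (x i) (z i) (z j) (x j) +
     B (cinner (z i) (z j)) * cinner (x j) (x i)).
  move=> zB; have := Lp I z x zB; congr (0 <= _).
  apply: eq_bigr => i _; apply: eq_bigr => j _.
  by rewrite KE // tr_rank1 scale_form rank1_form mulmx1 -cinnerE.
apply: (form1_intro aA bB) => //.
  by apply: conj_pos => I z x l; exact: (homog aA bB TZ psd).
by apply: conj_pos_b => I z x l; exact: (homog aA bB TZ psd).
Qed.

Lemma ser_const0 : ser (fun=> 0) 1 (fun=> 0 : C).
Proof.
move=> z _; exists 0, 0; split=> // N.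
by rewrite big1 ?subrr ?nm0 ?mul0r // => k _; rewrite mul0r.
Qed.

(** Matrices of size one commute, so the unimodular [c u] cancels and the kernel depends on the
    inner product only. With [A = 0] the two coefficient sequences coincide and the bound reads
    [b <= (l + 1) b]. *)
Lemma dim1_case (K : 'cV[C]_1 -> 'cV[C]_1 -> 'M[C]_1) c :
  nonneg_def_kernel K -> sesqui_analytic K -> rep c -> quasi_invariant K c ->
  exists a1 a2, form1 1%:M K a1 a2.
Proof.
move=> Kp Ka rc Kc; have [Kz Kw] := sesqui_line_analytic Ka.
have ballE (s : C) : nm s < 1 -> in_ball (s%:M : 'cV[C]_1).
  move=> s1; apply/in_ballE; rewrite /sqn big_ord1 mxE eqxx mulr1n.
  by have := nm_ge0 s; move: s1; move: (nm s) => t *; nra.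
have vE (v : 'cV[C]_1) : v = (v 0 0)%:M.
  by apply/matrixP => i j; rewrite !ord1 mxE eqxx mulr1n.
have cE (s t : C) : cinner (s%:M : 'cV[C]_1) t%:M = s * t^*.
  by rewrite /cinner big_ord1 !mxE eqxx !mulr1n.
have line (s : C) : s%:M = 0 + s *: (1%:M : 'cV[C]_1) by rewrite add0r scalemx1.
have unit1 (s : C) : nm s = 1 -> unitary (s%:M : 'M[C]_1).
  move=> s1; apply: unitaryP; apply/matrixP => i j; rewrite !ord1 !mxE big_ord1 !mxE eqxx.
  by rewrite !mulr1n mulrC -nm_sqr s1 expr1n.
have KU (s : C) z w : nm s = 1 -> in_ball z -> in_ball w ->
    K (s *: z) (s *: w) = K z w.
  move=> s1 zB wB; have uu := unit1 s s1.
  have zB' : in_ball (s *: z) by rewrite -mul_scalar_mx; apply/in_ball_unitary.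
  have wB' : in_ball (s *: w) by rewrite -mul_scalar_mx; apply/in_ball_unitary.
  rewrite (Kc _ uu _ _ zB' wB') -!mul_scalar_mx !mulmxA mulVmx ?mul1mx; last first.
    by rewrite unitmxE det_scalar1 unitfE -nm_eq0 s1 oner_eq0.
  have := proj2 rc _ uu; move: (c _) (K z w) => c' K' [_ cc].
  have C11 (P Q : 'M[C]_1) : P *m Q = Q *m P.
    by apply/matrixP => i j; rewrite !ord1 !mxE !big_ord1 mulrC.
  by rewrite (C11 c' K') -mulmxA cc mulmx1.
pose psi z v := K z%:M (v^*)%:M 0 0.
have psi1 v z : nm v < 1 -> nm z < 1 -> cdiff (psi^~ v) z.
  move=> v1 z1; have vB : in_ball ((v^*)%:M : 'cV[C]_1) by apply: ballE; rewrite nmJ.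
  apply: cdiff_eq (Kz _ 0 1%:M z 0 0 vB _) => [t|]; first by rewrite -line.
  by rewrite -line; exact: ballE.
have psi2 z v : nm z < 1 -> nm v < 1 -> cdiff (psi z) v.
  move=> z1 v1; have vB : in_ball ((v^*)%:M : 'cV[C]_1) by apply: ballE; rewrite nmJ.
  apply: cdiff_eq (cdiff_conj (Kw _ 0 1%:M v^* 0 0 (ballE z z1) _)) => [t|].
    by rewrite -line conjCK.
  by rewrite -line.
have psi_rot s z v : nm s = 1 -> nm z < 1 -> nm v < 1 -> psi (s * z) v = psi z (s * v).
  move=> s1 z1 v1; have vB : in_ball (((s * v)^*)%:M : 'cV[C]_1).
    by apply: ballE; rewrite nmJ nmM s1 mul1r.
  rewrite /psi -(KU s z%:M ((s * v)^*)%:M s1 (ballE z z1) vB) !scale_scalar_mx.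
  by rewrite [(s * v)^*]rmorphM mulrA -nm_sqr s1 expr1n mul1r.
have [b [B [bB BE]]] := two_var psi1 psi2 psi_rot.
have KE z w : in_ball z -> in_ball w -> K z w = B (cinner z w) *: 1%:M.
  move=> /in_ballE zB /in_ballE wB; have sq (v : 'cV[C]_1) : sqn v < 1 -> nm (v 0 0) < 1.
    by rewrite /sqn big_ord1; have := nm_ge0 (v 0 0); move: (nm _) => t *; nra.
  rewrite (vE z) (vE w) [LHS]vE cE scalemx1 -BE ?nmJ ?sq //.
  by rewrite /psi conjCK.
have psd (I : finType) (z x : I -> 'cV[C]_1) : (forall i, in_ball (z i)) ->
  0 <= \sum_i \sum_j ((fun=> 0) (cinner (z i) (z j)) * (fun _ _ _ _ => 0) (x i) (z i) (z j) (x j) +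
     B (cinner (z i) (z j)) * cinner (x j) (x i)).
  move=> zB; have := psd_fin Kp x zB; congr (0 <= _).
  apply: eq_bigr => i _; apply: eq_bigr => j _.
  by rewrite KE // mulr0 add0r -scalemxAr mulmx1 -scalemxAl mxE -cinnerE.
have b0 l : 0 <= b l.
  have := @homog _ 1 (fun=> 0) B (fun=> 0) b (fun _ _ _ _ => 0) ser_const0 bB
    (fun _ _ _ _ _ _ _ _ => esym (mulr0 _)) psd unit (fun=> 1%:M) (fun=> 1%:M) l.
  rewrite !(big_pred1 tt) ?(big_pred1 tt) //; try by case.
  by rewrite cE conjC1 mulr1 expr1n mulr0 add0r !mulr1.
apply: (form1_intro ser_const0 bB) => [l|m|z w zB wB].
- by case: l => *; rewrite add0r.
- by rewrite subr0 mulr_ge0.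
- by rewrite mul1mx mxstar1 mulmx1 scale0r add0r; exact: KE.
Qed.

Lemma dim0_case (K : 'cV[C]_0 -> 'cV[C]_0 -> 'M[C]_0) : exists a1 a2, form1 1%:M K a1 a2.
Proof.
apply: (form1_intro ser_const0 ser_const0) => [[|l]|m|z w _ _]; rewrite ?addr0 ?mulr0 ?subrr //.
by apply/matrixP => -[].
Qed.

End Final.

(** The kernel is multiplied by [s] on one side and by its conjugate on the other, so the scalar
    character disappears. *)
Lemma covariance_scalar (R : realType) d (K : 'cV[R[i]]_d -> 'cV[R[i]]_d -> 'M[R[i]]_d) c
    (U u F : 'M[R[i]]_d) (s : R[i]) z w :
  quasi_invariant K c -> unitary U -> unitary u -> nm s = 1 ->
  U *m c u *m mxstar U = s *: F -> in_ball z -> in_ball w ->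
  U *m K (u *m z) (u *m w) *m mxstar U = F *m (U *m K z w *m mxstar U) *m mxstar F.
Proof.
move=> Kc [UU _] uu s1 cE zB wB.
have zB' : in_ball (u *m z) by apply/in_ball_unitary.
have wB' : in_ball (u *m w) by apply/in_ball_unitary.
have uV : invmx u *m u = 1%:M by rewrite unitary_inv //; case: uu.
rewrite (Kc u uu _ _ zB' wB') !mulmxA uV !mul1mx.
have cU : U *m c u = (s *: F) *m U by rewrite -cE -mulmxA UU mulmx1.
rewrite cU -(mulmxA _ (mxstar (c u))) -mxstarM cU mxstarM.
have -> : mxstar (s *: F) = s^* *: mxstar F.
  by apply/matrixP => i j; rewrite !mxE rmorphM.
rewrite -!scalemxAl -!scalemxAr scalerA !mulmxA.
by rewrite -nm_sqr s1 expr1n scale1r.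
Qed.

Unset Implicit Arguments.
Unset Strict Implicit.

Theorem theorem5p7 (R : realType) :
  (* (a) n = d *)
  (forall (d : nat) (K : 'cV[R[i]]_d -> 'cV[R[i]]_d -> 'M[R[i]]_d)
          (c : 'M[R[i]]_d -> 'M[R[i]]_d),
      nonneg_def_kernel K -> sesqui_analytic K ->
      unitary_rep c -> irreducible_rep c -> quasi_invariant K c ->
      exists U : 'M[R[i]]_d, unitary U /\
        ((exists a1 a2 : nat -> R, form1 U K a1 a2) \/
         (exists b1 b2 : nat -> R, form2 U K b1 b2))) /\
  (* (b) 1 < n < d *)
  (forall (d n : nat) (K : 'cV[R[i]]_d -> 'cV[R[i]]_d -> 'M[R[i]]_n),
      (1 < n)%N -> (n < d)%N ->
      nonneg_def_kernel K -> sesqui_analytic K ->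
      ~ (exists c : 'M[R[i]]_d -> 'M[R[i]]_n,
            unitary_rep c /\ irreducible_rep c /\ quasi_invariant K c)).
Proof.
split; last first.
  move=> d n K n1 nd _ _ [c [[cM [cU _]] [ci _]]].
  by apply: (no_small_irrep n1 nd _ ci); split.
move=> d K c Kp Ka [cM [cU _]] ci Kc.
have rc : rep c by split.
case: d K c Kp Ka {cM cU} rc ci Kc => [|[|e]] K c Kp Ka rc ci Kc.
- by exists 1%:M; split; [exact: unitary1 | left; exact: dim0_case].
- by exists 1%:M; split; [exact: unitary1 | left; exact: dim1_case Kp Ka rc Kc].
have [U [chi [UU chi1 H]]] := rep_dichotomy (isT : 1 < e.+2)%N rc ci.
exists U; split; first exact: UU.
(* The standard representation leads to the second normal form, its conjugate to the first. *)
case: H => H; [right; apply: (std_case Kp Ka)|left; apply: (conj_case Kp Ka)] => u z w uu.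
  exact: covariance_scalar Kc UU uu (chi1 u uu) (H u uu).
exact: covariance_scalar Kc UU uu (chi1 u uu) (H u uu).
Qed.
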